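(* If $\vdash P :: \Gamma$ (i.e. $P$ has a valid typing derivation in context $\Gamma$), then $P$ is terminating.
   Context: Setting: the session calculus $\mu\mathsf{CP}^\infty$. Processes are $P,Q ::= \mathsf{A}\langle\bar x\rangle$ (invocation of a process name with a unique global definition $\mathsf{A}(\bar x) = P$) $\mid \mathsf{wait}\,x.P \mid x(y).P \mid \mathsf{case}\,x\{P,Q\} \mid (x)(P \mid Q)$ (session $x$ connecting $P$ and $Q$) $\mid \mathsf{fail}\,x \mid \mathsf{close}\,x \mid x[y](P \mid Q)$ (output of a new channel $y$, bound in $P$) $\mid x.\mathsf{in}_i.P$ ($i\in\{0,1\}$). Structural pre-congruence includes commutativity and (side-condition-restricted) associativity of composition and unfolding of invocations into their definitions. Reduction $\to$: $(x)(\mathsf{close}\,x \mid \mathsf{wait}\,x.P) \to P$; $(x)(x[y](P\mid Q) \mid x(y).R) \to (y)(P \mid (x)(Q\mid R))$; $(x)(x.\mathsf{in}_i.P \mid \mathsf{case}\,x\{Q_0,Q_1\}) \to (x)(P \mid Q_i)$; closed under composition and structural pre-congruence. $P$ is stuck if it has no reduction. Types are closed, guarded propositions of $\mu\mathsf{MALL}^\infty$ (constants $\mathbf{0},\mathbf{1},\bot,\top$, connectives $\otimes,⅋,\&,\oplus$, fixed points $\mu X.A$, $\nu X.A$) with the usual duality. Subtyping $A \leqslant B$ is given by coinductive rules $\mathbf{0}\leqslant A$, $A\leqslant\top$, $\kappa\leqslant\kappa$ for constants, congruence for each connective, and unfolding of a fixed point on either side, where moreover every infinite branch $(A_i\leqslant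 B_i)$ must satisfy: the sub-formula-minimum of the types occurring infinitely often on the left is a $\mu$-type, or that on the right is a $\nu$-type. Typing judgments $\vdash P :: \Gamma$ ($\Gamma$ a finite map from channels to types) use the $\mu\mathsf{MALL}^\infty$ proof rules read on processes, a rule typing an invocation like its definition, and a composition rule: $\vdash (x)(P\mid Q) :: \Gamma,\Delta$ if $\vdash P :: \Gamma, x:A$, $\vdash Q :: \Delta, x:B$ and $A \leqslant \overline{B}$. Rules are read coinductively, and a derivation is required to be valid: every infinite branch has a thread (sequence of channels following the same session) whose sub-formula-minimal infinitely recurring type is a $\nu$-type and along which $\nu$-unfolding is applied infinitely often. A run of $P$ is a finite or infinite sequence $(P_0,P_1,\dots)$ with $P_0=P$ and $P_i\to P_{i+1}$; it is maximal if infinite or ending in a stuck process. $P$ is terminating if every maximal run of $P$ is finite. *)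

(* Defs.v *)
From Stdlib Require Import List Arith.
Import ListNotations.

Inductive ty : Type :=
| TV    (n : nat)
| T0 | T1 | TBot | TTop
| TTens (A B : ty)
| TPar  (A B : ty)
| TWith (A B : ty)
| TPlus (A B : ty)
| TMu   (A : ty)              (* mu X. A  (X = index 0 in A) *)
| TNu   (A : ty).

Fixpoint tclosed_at (k : nat) (A : ty) : Prop :=
  match A with
  | TV n => n < k
  | T0 | T1 | TBot | TTop => True
  | TTens A B | TPar A B | TWith A B | TPlus A B => tclosed_at k A /\ tclosed_at k B
  | TMu A | TNu A => tclosed_at (S k) A
  end.

Fixpoint unguarded (k : nat) (A : ty) : Prop :=
  match A with
  | TV n => n = k
  | TMu B | TNu B => unguarded (S k) B
  | _ => False
  end.

Fixpoint guarded (A : ty) : Prop :=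
  match A with
  | TMu B | TNu B => ~ unguarded 0 B /\ guarded B
  | TTens A B | TPar A B | TWith A B | TPlus A B => guarded A /\ guarded B
  | _ => True
  end.

Definition is_ty (A : ty) : Prop := tclosed_at 0 A /\ guarded A.

Fixpoint dual (A : ty) : ty :=
  match A with
  | TV n => TV n
  | T0 => TTop | TTop => T0 | T1 => TBot | TBot => T1
  | TTens A B => TPar (dual A) (dual B)
  | TPar A B => TTens (dual A) (dual B)
  | TWith A B => TPlus (dual A) (dual B)
  | TPlus A B => TWith (dual A) (dual B)
  | TMu A => TNu (dual A)
  | TNu A => TMu (dual A)
  end.

(** [tsub k u A]: substitute the (closed) type [u] for variable [k] in [A]
    (variables above [k] are lowered, as the binder disappears). *)
Fixpoint tsub (k : nat) (u : ty) (A : ty) : ty :=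
  match A with
  | TV n => if Nat.eqb n k then u else if Nat.ltb k n then TV (pred n) else TV n
  | T0 => T0 | T1 => T1 | TBot => TBot | TTop => TTop
  | TTens A B => TTens (tsub k u A) (tsub k u B)
  | TPar A B => TPar (tsub k u A) (tsub k u B)
  | TWith A B => TWith (tsub k u A) (tsub k u B)
  | TPlus A B => TPlus (tsub k u A) (tsub k u B)
  | TMu A => TMu (tsub (S k) u A)
  | TNu A => TNu (tsub (S k) u A)
  end.

Definition unfold_mu (A : ty) : ty := tsub 0 (TMu A) A.
Definition unfold_nu (A : ty) : ty := tsub 0 (TNu A) A.

Definition is_mu (A : ty) : Prop := exists B, A = TMu B.
Definition is_nu (A : ty) : Prop := exists B, A = TNu B.

Inductive subformula : ty -> ty -> Prop :=
| sf_refl A : subformula A A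
| sf_tens_l C A B : subformula C A -> subformula C (TTens A B)
| sf_tens_r C A B : subformula C B -> subformula C (TTens A B)
| sf_par_l C A B : subformula C A -> subformula C (TPar A B)
| sf_par_r C A B : subformula C B -> subformula C (TPar A B)
| sf_with_l C A B : subformula C A -> subformula C (TWith A B)
| sf_with_r C A B : subformula C B -> subformula C (TWith A B)
| sf_plus_l C A B : subformula C A -> subformula C (TPlus A B)
| sf_plus_r C A B : subformula C B -> subformula C (TPlus A B)
| sf_mu C A : subformula C A -> subformula C (TMu A)
| sf_nu C A : subformula C A -> subformula C (TNu A).

Definition inf_often {X : Type} (g : nat -> X) (C : X) : Prop :=
  forall n, exists m, n <= m /\ g m = C.

Definition inf_min_is (Q : ty -> Prop) (g : nat -> ty) : Prop :=
  exists C, inf_often g C /\ Q C /\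
    forall D, inf_often g D -> subformula C D.

CoInductive tree (L : Type) : Type :=
| Node : L -> list (tree L) -> tree L.
Arguments Node {L} _ _.

Definition label {L} (t : tree L) : L := match t with Node l _ => l end.
Definition kids {L} (t : tree L) : list (tree L) := match t with Node _ ks => ks end.

Inductive reach {L} (t : tree L) : tree L -> Prop :=
| reach_root : reach t t
| reach_kid u v : reach t u -> In v (kids u) -> reach t v.

Definition locally_correct {L} (R : L -> list L -> Prop) (t : tree L) : Prop :=
  forall u, reach t u -> R (label u) (map label (kids u)).

Definition branch {L} (t : tree L) (f : nat -> tree L) (p : nat -> nat) : Prop :=
  f 0 = t /\ forall n, nth_error (kids (f n)) (p n) = Some (f (S n)).

Inductive srule_tag := SAx | SUnfL | SUnfR.
Definition slabel : Type := (ty * ty * srule_tag)%type.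

Inductive srule : slabel -> list slabel -> Prop :=
| s_zero B : srule (T0, B, SAx) []
| s_top A : srule (A, TTop, SAx) []
| s_const k : In k [T0; T1; TBot; TTop] -> srule (k, k, SAx) []
| s_tens A1 A2 B1 B2 r1 r2 :
    srule (TTens A1 A2, TTens B1 B2, SAx) [(A1, B1, r1); (A2, B2, r2)]
| s_par A1 A2 B1 B2 r1 r2 :
    srule (TPar A1 A2, TPar B1 B2, SAx) [(A1, B1, r1); (A2, B2, r2)]
| s_with A1 A2 B1 B2 r1 r2 :
    srule (TWith A1 A2, TWith B1 B2, SAx) [(A1, B1, r1); (A2, B2, r2)]
| s_plus A1 A2 B1 B2 r1 r2 :
    srule (TPlus A1 A2, TPlus B1 B2, SAx) [(A1, B1, r1); (A2, B2, r2)]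
| s_mu_l A B r : srule (TMu A, B, SUnfL) [(unfold_mu A, B, r)]
| s_nu_l A B r : srule (TNu A, B, SUnfL) [(unfold_nu A, B, r)]
| s_mu_r A B r : srule (A, TMu B, SUnfR) [(A, unfold_mu B, r)]
| s_nu_r A B r : srule (A, TNu B, SUnfR) [(A, unfold_nu B, r)].

Definition sleft (l : slabel) : ty := match l with (A, _, _) => A end.
Definition sright (l : slabel) : ty := match l with (_, B, _) => B end.

Definition subtype (A B : ty) : Prop :=
  exists t : tree slabel,
    fst (label t) = (A, B) /\
    locally_correct srule t /\
    forall f p, branch t f p ->
      inf_min_is is_mu (fun n => sleft (label (f n))) \/
      inf_min_is is_nu (fun n => sright (label (f n))).

Inductive proc : Type :=
| PCall  (a : nat) (xs : list nat)
| PWait  (x : nat) (P : proc)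
| PIn    (x : nat) (P : proc)          (* x(y).P ; y = index 0 in P *)
| PCase  (x : nat) (P Q : proc)
| PCut   (P Q : proc)                  (* (x)(P | Q) ; x = index 0 in P and Q *)
| PFail  (x : nat)
| PClose (x : nat)
| POut   (x : nat) (P Q : proc)        (* x[y](P | Q) ; y = index 0 in P only *)
| PSel   (x : nat) (i : bool) (P : proc). (* x.in_i.P ; false = in_0, true = in_1 *)

Definition up (r : nat -> nat) : nat -> nat :=
  fun k => match k with 0 => 0 | S k => S (r k) end.

Fixpoint ren (r : nat -> nat) (P : proc) : proc :=
  match P with
  | PCall a xs => PCall a (map r xs)
  | PWait x P => PWait (r x) (ren r P)
  | PIn x P => PIn (r x) (ren (up r) P)
  | PCase x P Q => PCase (r x) (ren r P) (ren r Q)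
  | PCut P Q => PCut (ren (up r) P) (ren (up r) Q)
  | PFail x => PFail (r x)
  | PClose x => PClose (r x)
  | POut x P Q => POut (r x) (ren (up r) P) (ren r Q)
  | PSel x i P => PSel (r x) i (ren r P)
  end.

Fixpoint free_in (z : nat) (P : proc) : Prop :=
  match P with
  | PCall _ xs => In z xs
  | PWait x P => z = x \/ free_in z P
  | PIn x P => z = x \/ free_in (S z) P
  | PCase x P Q => z = x \/ free_in z P \/ free_in z Q
  | PCut P Q => free_in (S z) P \/ free_in (S z) Q
  | PFail x | PClose x => z = x
  | POut x P Q => z = x \/ free_in (S z) P \/ free_in z Q
  | PSel x _ P => z = x \/ free_in z P
  end.

(** global definitions: process name [a] is defined by [A(x_0..x_{n-1}) = body]
    where [env a = (n, body)], the parameters being the indices [0..n-1] *)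
Definition env : Type := nat -> (nat * proc).

Definition env_wf (E : env) : Prop :=
  forall a z, free_in z (snd (E a)) -> z < fst (E a).

Definition instantiate (E : env) (a : nat) (xs : list nat) : proc :=
  ren (fun k => nth k xs 0) (snd (E a)).

Definition ctx : Type := nat -> option ty.

Definition upd (G : ctx) (x : nat) (o : option ty) : ctx :=
  fun k => if Nat.eqb k x then o else G k.

Definition scons (o : option ty) (G : ctx) : ctx :=
  fun k => match k with 0 => o | S k => G k end.

Definition disj_union (G G1 G2 : ctx) : Prop :=
  forall k, (G1 k = None /\ G k = G2 k) \/ (G2 k = None /\ G k = G1 k).

Definition ctx_finite (G : ctx) : Prop := exists N, forall k, N <= k -> G k = None.

Definition ctx_ok (G : ctx) : Prop :=
  ctx_finite G /\ forall k A, G k = Some A -> is_ty A.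

(** rule tags: [RAx] = the rule determined by the head of the process
    (including the invocation rule); [RFix x] = fixed-point unfolding of channel x *)
Inductive trule_tag := RAx | RFix (x : nat).
Definition tlabel : Type := (proc * ctx * trule_tag)%type.

Inductive trule (E : env) : tlabel -> list tlabel -> Prop :=
| t_close x G :
    G x = Some T1 -> (forall k, k <> x -> G k = None) ->
    trule E (PClose x, G, RAx) []
| t_wait x P G r :
    G x = Some TBot ->
    trule E (PWait x P, G, RAx) [(P, upd G x None, r)]
| t_in x P G A B r :
    G x = Some (TPar A B) ->
    trule E (PIn x P, G, RAx) [(P, scons (Some A) (upd G x (Some B)), r)]
| t_out x P Q G G1 G2 A B r1 r2 :
    G x = Some (TTens A B) -> disj_union (upd G x None) G1 G2 ->
    trule E (POut x P Q, G, RAx)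
      [(P, scons (Some A) G1, r1); (Q, upd G2 x (Some B), r2)]
| t_case x P Q G A B r1 r2 :
    G x = Some (TWith A B) ->
    trule E (PCase x P Q, G, RAx)
      [(P, upd G x (Some A), r1); (Q, upd G x (Some B), r2)]
| t_sel x i P G A0 A1 r :
    G x = Some (TPlus A0 A1) ->
    trule E (PSel x i P, G, RAx) [(P, upd G x (Some (if i then A1 else A0)), r)]
| t_fail x G :
    G x = Some TTop -> trule E (PFail x, G, RAx) []
| t_cut P Q G G1 G2 A B r1 r2 :
    is_ty A -> is_ty B -> disj_union G G1 G2 -> subtype A (dual B) ->
    trule E (PCut P Q, G, RAx)
      [(P, scons (Some A) G1, r1); (Q, scons (Some B) G2, r2)]
| t_mu P G x A r :
    G x = Some (TMu A) ->
    trule E (P, G, RFix x) [(P, upd G x (Some (unfold_mu A)), r)]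
| t_nu P G x A r :
    G x = Some (TNu A) ->
    trule E (P, G, RFix x) [(P, upd G x (Some (unfold_nu A)), r)]
| t_call a xs G r :
    length xs = fst (E a) ->
    trule E (PCall a xs, G, RAx) [(instantiate E a xs, G, r)].

Definition tproc (l : tlabel) : proc := match l with (P, _, _) => P end.
Definition tctx (l : tlabel) : ctx := match l with (_, G, _) => G end.
Definition ttag (l : tlabel) : trule_tag := match l with (_, _, r) => r end.

(** how a channel of the conclusion is named in the [i]-th premise
    (the same session; premises binding a new channel shift indices) *)
Definition cshift (l : tlabel) (i : nat) : nat -> nat :=
  match ttag l with
  | RFix _ => fun z => z
  | RAx =>
      match tproc l with
      | PIn _ _ | PCut _ _ => S
      | POut _ _ _ => if Nat.eqb i 0 then S else fun z => z
      | _ => fun z => z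
      end
  end.

Definition type_or_0 (o : option ty) : ty := match o with Some A => A | None => T0 end.

Definition valid_thread (f : nat -> tree tlabel) (p : nat -> nat) : Prop :=
  exists (n0 : nat) (x : nat -> nat),
    (forall i, n0 <= i -> tctx (label (f i)) (x i) <> None) /\
    (forall i, n0 <= i -> x (S i) = cshift (label (f i)) (p i) (x i)) /\
    inf_min_is is_nu (fun i => type_or_0 (tctx (label (f i)) (x i))) /\
    (forall n, exists m, n0 <= m /\ n <= m /\
       ttag (label (f m)) = RFix (x m) /\ is_nu (type_or_0 (tctx (label (f m)) (x m)))).

Definition typed (E : env) (P : proc) (G : ctx) : Prop :=
  exists t : tree tlabel,
    tproc (label t) = P /\ tctx (label t) = G /\
    locally_correct (trule E) t /\
    forall f p, branch t f p -> valid_thread f p.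

Definition swap01 : nat -> nat :=
  fun k => match k with 0 => 1 | 1 => 0 | k => k end.

Inductive spc (E : env) : proc -> proc -> Prop :=
| spc_refl P : spc E P P
| spc_trans P Q R : spc E P Q -> spc E Q R -> spc E P R
| spc_comm P Q : spc E (PCut P Q) (PCut Q P)
(* (x)(P | (y)(Q | R)) <= (y)((x)(P | Q) | R)  provided x not free in R *)
| spc_assoc P Q R :
    spc E (PCut P (PCut Q (ren (up S) R)))
          (PCut (PCut (ren (up S) P) (ren swap01 Q)) R)
| spc_unfold a xs :
    length xs = fst (E a) -> spc E (PCall a xs) (instantiate E a xs)
| spc_wait x P P' : spc E P P' -> spc E (PWait x P) (PWait x P')
| spc_in x P P' : spc E P P' -> spc E (PIn x P) (PIn x P')
| spc_case_l x P P' Q : spc E P P' -> spc E (PCase x P Q) (PCase x P' Q)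
| spc_case_r x P Q Q' : spc E Q Q' -> spc E (PCase x P Q) (PCase x P Q')
| spc_cut_l P P' Q : spc E P P' -> spc E (PCut P Q) (PCut P' Q)
| spc_cut_r P Q Q' : spc E Q Q' -> spc E (PCut P Q) (PCut P Q')
| spc_out_l x P P' Q : spc E P P' -> spc E (POut x P Q) (POut x P' Q)
| spc_out_r x P Q Q' : spc E Q Q' -> spc E (POut x P Q) (POut x P Q')
| spc_sel x i P P' : spc E P P' -> spc E (PSel x i P) (PSel x i P').

Inductive red (E : env) : proc -> proc -> Prop :=
| red_close P :
    red E (PCut (PClose 0) (PWait 0 (ren S P))) P
(* (x)(x[y](P | Q) | x(y).R) -> (y)(P | (x)(Q | R)) *)
| red_comm P Q R :
    red E (PCut (POut 0 (ren (up S) P) Q) (PIn 0 R))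
          (PCut P (PCut (ren (up S) Q) (ren swap01 R)))
| red_sel i P Q0 Q1 :
    red E (PCut (PSel 0 i P) (PCase 0 Q0 Q1)) (PCut P (if i then Q1 else Q0))
| red_cut_l P P' Q : red E P P' -> red E (PCut P Q) (PCut P' Q)
| red_cut_r P Q Q' : red E Q Q' -> red E (PCut P Q) (PCut P Q')
| red_spc P P' Q' Q : spc E P P' -> red E P' Q' -> spc E Q' Q -> red E P Q.

Definition stuck (E : env) (P : proc) : Prop := forall Q, ~ red E P Q.

Inductive run : Type :=
| FinRun (P0 : proc) (rest : list proc)
| InfRun (s : nat -> proc).

Fixpoint chain (E : env) (P : proc) (l : list proc) : Prop :=
  match l with
  | [] => True
  | Q :: l' => red E P Q /\ chain E Q l'
  end.

Definition is_run_of (E : env) (P : proc) (r : run) : Prop :=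
  match r with
  | FinRun P0 rest => P0 = P /\ chain E P0 rest
  | InfRun s => s 0 = P /\ forall n, red E (s n) (s (S n))
  end.

Definition maximal (E : env) (r : run) : Prop :=
  match r with
  | FinRun P0 rest => stuck E (last rest P0)
  | InfRun _ => True
  end.

Definition is_finite_run (r : run) : Prop :=
  match r with FinRun _ _ => True | InfRun _ => False end.

Definition terminating (E : env) (P : proc) : Prop :=
  forall r, is_run_of E P r -> maximal E r -> is_finite_run r.

(* Main.v *)
(** A typed process runs as a net of nodes of its typing derivation, linked by
    sessions; the net is always a tree. Fix an infinite run of the net, fair or not. A
    compactness argument chooses for every session that is never used a side where the
    activity keeps coming back; the endpoint on that side is declared false, the other one
    true, so a component that is idle forever has a true channel, namely the one through
    which the activity is reached. Reading types as least and greatest fixed points over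
    the sessions of the run, the two sides of a session are never both true, for dual
    types and hence, by the validity of subtyping derivations, for the types of any cut.
    The channels of the root are external and false. From a component with only false
    channels one can always pass to a premise with only false channels, and this draws an
    infinite branch of the derivation. Annotating greatest fixed points with ordinals that
    bound the stage at which a formula becomes false, every unfolding of a greatest fixed
    point decreases its annotation, which contradicts the valid thread of that branch. *)
Require Import Defs.
From Stdlib Require Import List Arith Lia Classical ClassicalEpsilon
  FunctionalExtensionality Permutation.
Import ListNotations.

(** The derivation is never rewritten. Subject reduction would rebuild derivations along reductions
    that regroup cuts and work under prefixes, and would have to carry validity along, which is a
    property of whole infinite branches. A net only visits nodes of the given derivation, so the
    branch drawn at the end belongs to a derivation whose validity is assumed; the price is that
    processes of the run and of the net agree only up to pre-congruence. Falsity, not truth, is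
    followed along the branch because it is what carries a well-founded measure: not belonging to a
    greatest fixed point is witnessed by a stage of its approximation. A plain type does not
    determine that stage, hence annotated formulas; and since unfolding duplicates them, all copies
    of the minimal formula of a thread have to be shown to carry the same annotation. *)

(** * Substitution, closedness and guardedness of types *)

Lemma tclosed_mono A : forall m n, tclosed_at m A -> m <= n -> tclosed_at n A.
Proof.
  induction A; simpl; intros m n' H Hle; auto; try lia;
    try (destruct H; split; eauto; fail); eapply IHA; eauto; lia.
Qed.

Lemma tsub_closed u A : forall m k, tclosed_at m A -> m <= k -> tsub k u A = A.
Proof.
  induction A; simpl; intros m k H Hle; auto;
    try (destruct H; erewrite IHA1, IHA2; eauto; fail);
    try (erewrite IHA; eauto; lia).
  destruct (Nat.eqb_spec n k); [lia|]. destruct (Nat.ltb_spec k n); [lia|auto].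
Qed.

Lemma tclosed_tsub u A : tclosed_at 0 u ->
  forall m k, tclosed_at (S m) A -> k <= m -> tclosed_at m (tsub k u A).
Proof.
  intros Hu. induction A; simpl; intros m k H Hle; auto;
    try (destruct H; split; auto; fail);
    try (apply IHA; auto; lia).
  destruct (Nat.eqb_spec n k).
  - eapply tclosed_mono; eauto; lia.
  - destruct (Nat.ltb_spec k n); simpl; lia.
Qed.

Lemma unguarded_closed A : forall m j, tclosed_at m A -> unguarded j A -> j < m.
Proof.
  induction A; simpl; intros m j H U; try tauto; try lia;
    specialize (IHA _ _ H U); lia.
Qed.

Lemma unguarded_tsub u A : tclosed_at 0 u ->
  forall j k, j < k -> unguarded j (tsub k u A) -> unguarded j A.
Proof.
  intros Hu. induction A; simpl; intros j k Hlt U; auto.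
  - destruct (Nat.eqb_spec n k).
    + apply unguarded_closed with (m := 0) in U; auto; lia.
    + destruct (Nat.ltb_spec k n); simpl in *; lia.
  - apply IHA in U; auto; lia.
  - apply IHA in U; auto; lia.
Qed.

Lemma guarded_tsub u A : tclosed_at 0 u -> guarded u ->
  forall k, guarded A -> guarded (tsub k u A).
Proof.
  intros Hu Gu. induction A; simpl; intros k G; auto;
    try (destruct G; split; auto; fail).
  - destruct (Nat.eqb n k); auto. destruct (Nat.ltb k n); simpl; auto.
  - destruct G as [G1 G2]; split; auto.
    intros U; apply G1; eapply unguarded_tsub; [| |apply U]; auto; lia.
  - destruct G as [G1 G2]; split; auto.
    intros U; apply G1; eapply unguarded_tsub; [| |apply U]; auto; lia.
Qed.

Inductive tstep : ty -> ty -> Prop :=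
| ts_tens_l A B : tstep (TTens A B) A
| ts_tens_r A B : tstep (TTens A B) B
| ts_par_l A B : tstep (TPar A B) A
| ts_par_r A B : tstep (TPar A B) B
| ts_with_l A B : tstep (TWith A B) A
| ts_with_r A B : tstep (TWith A B) B
| ts_plus_l A B : tstep (TPlus A B) A
| ts_plus_r A B : tstep (TPlus A B) B
| ts_mu A : tstep (TMu A) (unfold_mu A)
| ts_nu A : tstep (TNu A) (unfold_nu A).

Lemma is_ty_tstep A B : tstep A B -> is_ty A -> is_ty B.
Proof.
  intros St [C G]; destruct St; simpl in *; try (split; tauto).
  - destruct G as [G1 G2]. split.
    + apply tclosed_tsub; simpl; auto.
    + apply guarded_tsub; simpl; auto.
  - destruct G as [G1 G2]. split.
    + apply tclosed_tsub; simpl; auto.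
    + apply guarded_tsub; simpl; auto.
Qed.

Lemma tclosed_tstep A B : tstep A B -> tclosed_at 0 A -> tclosed_at 0 B.
Proof.
  intros St C; destruct St; simpl in *; try tauto;
    apply tclosed_tsub; simpl; auto.
Qed.

(** Counts the fixed-point binders in front of a type. In a guarded type none of their variables
    stands directly behind them, so an unfolding removes one binder and adds none: unfoldings alone
    must soon expose a constant or a connective. *)
Fixpoint lead (A : ty) : nat :=
  match A with TMu B | TNu B => S (lead B) | _ => 0 end.

Lemma lead_tsub u A : forall k, ~ unguarded k A -> lead (tsub k u A) = lead A.
Proof.
  induction A; simpl; intros k U; auto.
  destruct (Nat.eqb_spec n k); [tauto|]. destruct (Nat.ltb k n); auto.
Qed.

Lemma lead_unfold_mu A : is_ty (TMu A) -> lead (unfold_mu A) < lead (TMu A).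
Proof.
  intros [_ [G _]]. unfold unfold_mu. rewrite lead_tsub; simpl; auto.
Qed.

Lemma lead_unfold_nu A : is_ty (TNu A) -> lead (unfold_nu A) < lead (TNu A).
Proof.
  intros [_ [G _]]. unfold unfold_nu. rewrite lead_tsub; simpl; auto.
Qed.

(** * Finiteness of the Fischer-Ladner closure *)

(** Simultaneous substitution for the variables from [k] on. The entries of [th] are meant to be
    closed, so nothing is shifted under binders; a variable beyond [th] gets the closed default
    [T0], which spares [tsub_msub] any bound on the variables of [A]. *)
Fixpoint msub (k : nat) (th : list ty) (A : ty) : ty :=
  match A with
  | TV n => if Nat.ltb n k then TV n else nth (n - k) th T0
  | T0 => T0 | T1 => T1 | TBot => TBot | TTop => TTop
  | TTens A B => TTens (msub k th A) (msub k th B)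
  | TPar A B => TPar (msub k th A) (msub k th B)
  | TWith A B => TWith (msub k th A) (msub k th B)
  | TPlus A B => TPlus (msub k th A) (msub k th B)
  | TMu A => TMu (msub (S k) th A)
  | TNu A => TNu (msub (S k) th A)
  end.

Lemma tsub_msub u th A : (forall B, In B th -> tclosed_at 0 B) ->
  forall k, tsub k u (msub (S k) th A) = msub k (u :: th) A.
Proof.
  intros Hth. induction A; intros k; simpl; try congruence.
  destruct (Nat.ltb_spec n (S k)); simpl.
  - destruct (Nat.eqb_spec n k).
    + subst. rewrite Nat.ltb_irrefl, Nat.sub_diag. auto.
    + destruct (Nat.ltb_spec k n); [lia|].
      destruct (Nat.ltb_spec n k); [auto|lia].
  - destruct (Nat.ltb_spec n k); [lia|].
    replace (n - k) with (S (n - S k)) by lia. simpl.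
    destruct (Nat.lt_ge_cases (n - S k) (length th)).
    + eapply tsub_closed; [apply Hth, nth_In; auto|lia].
    + rewrite nth_overflow; auto.
Qed.

Lemma msub_nil A : forall k, tclosed_at k A -> msub k [] A = A.
Proof.
  induction A; simpl; intros k H; auto; try (destruct H; f_equal; auto; fail);
    try (f_equal; auto; fail).
  destruct (Nat.ltb_spec n k); auto; lia.
Qed.

Lemma tclosed_msub th A : (forall B, In B th -> tclosed_at 0 B) ->
  forall k, tclosed_at (length th + k) A -> tclosed_at k (msub k th A).
Proof.
  intros Hth. induction A; simpl; intros k H; auto;
    try (destruct H; split; auto; fail).
  - destruct (Nat.ltb_spec n k); simpl; auto.
    eapply tclosed_mono; [apply Hth, nth_In; lia|lia].
  - apply IHA. rewrite Nat.add_succ_r. auto.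
  - apply IHA. rewrite Nat.add_succ_r. auto.
Qed.

(** The members of [th] stand for the fixed points whose binders have been
    crossed; variables contribute nothing, as their images are already listed. *)
Fixpoint fl (A : ty) (th : list ty) : list ty :=
  match A with
  | TV _ => []
  | T0 => [T0] | T1 => [T1] | TBot => [TBot] | TTop => [TTop]
  | TTens B C | TPar B C | TWith B C | TPlus B C =>
      msub 0 th A :: fl B th ++ fl C th
  | TMu B | TNu B => msub 0 th A :: fl B (msub 0 th A :: th)
  end.

(** The target set [W] is kept abstract so that the induction can pass a binder: there the fixed
    point just crossed is pushed onto [th], and its unfolding is exactly the body under the extended
    substitution. *)
Lemma fl_closed W A : forall th,
  tclosed_at (length th) A -> (forall B, In B th -> tclosed_at 0 B) ->
  incl th W -> incl (fl A th) W ->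
  In (msub 0 th A) W /\
  forall B B', In B (fl A th) -> tstep B B' -> In B' W.
Proof.
  induction A; intros th HA Hth HW Hfl.
  1:{ simpl in *. split; [|tauto]. apply HW. rewrite Nat.sub_0_r. apply nth_In; auto. }
  1-4: split; [apply Hfl; simpl; auto | simpl; intros B B' [<-|[]] St; inversion St].
  1-4: destruct HA as [HA1 HA2];
    destruct (IHA1 th HA1 Hth HW) as [I1 S1];
    [intros X HX; apply Hfl; right; apply in_or_app; auto|];
    destruct (IHA2 th HA2 Hth HW) as [I2 S2];
    [intros X HX; apply Hfl; right; apply in_or_app; auto|];
    (split; [apply Hfl; left; auto|]);
    intros B B' [<-|HB] St;
    [ simpl in St; inversion St; subst; auto
    | apply in_app_or in HB; destruct HB; eauto ].
  - assert (C0 : tclosed_at 0 (msub 0 th (TMu A))).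
    { apply tclosed_msub; auto. rewrite Nat.add_0_r. auto. }
    assert (I0 : In (msub 0 th (TMu A)) W) by (apply Hfl; left; auto).
    destruct (IHA (msub 0 th (TMu A) :: th)) as [I1 S1]; auto.
    { intros B [<-|HB]; auto. }
    { intros B [<-|HB]; auto. }
    { intros B HB; apply Hfl; right; auto. }
    split; auto. intros B B' [<-|HB] St; eauto.
    simpl in St; inversion St; subst. unfold unfold_mu.
    rewrite tsub_msub; auto.
  - assert (C0 : tclosed_at 0 (msub 0 th (TNu A))).
    { apply tclosed_msub; auto. rewrite Nat.add_0_r. auto. }
    assert (I0 : In (msub 0 th (TNu A)) W) by (apply Hfl; left; auto).
    destruct (IHA (msub 0 th (TNu A) :: th)) as [I1 S1]; auto.
    { intros B [<-|HB]; auto. }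
    { intros B [<-|HB]; auto. }
    { intros B HB; apply Hfl; right; auto. }
    split; auto. intros B B' [<-|HB] St; eauto.
    simpl in St; inversion St; subst. unfold unfold_nu.
    rewrite tsub_msub; auto.
Qed.

Lemma fischer_ladner_finite A : tclosed_at 0 A ->
  exists l, In A l /\ forall B B', In B l -> tstep B B' -> In B' l.
Proof.
  intros C. exists (fl A []).
  destruct (fl_closed (fl A []) A []) as [I S]; simpl; auto; try easy.
  rewrite msub_nil in I; auto.
Qed.

(** * Recurrent values and sizes of formulas *)

(** A value of the list that is not recurrent is absent from some index on; the maximum of these
    finitely many indices serves as [N]. *)
Lemma eventually_recurrent {X : Type} (g : nat -> X) (l : list X) :
  exists N, forall i, N <= i -> In (g i) l -> inf_often g (g i).
Proof.
  induction l as [|D l [N HN]].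
  - exists 0. intros i _ [].
  - destruct (classic (inf_often g D)) as [HD|HD].
    + exists N. intros i Hi [E|H]; auto. rewrite <- E; auto.
    + apply not_all_ex_not in HD as [M HM].
      exists (max N M). intros i Hi [E|H].
      * exfalso; apply HM. exists i. split; [lia|auto].
      * apply HN; auto; lia.
Qed.

Fixpoint tsize (A : ty) : nat :=
  match A with
  | TV _ | T0 | T1 | TBot | TTop => 1
  | TTens A B | TPar A B | TWith A B | TPlus A B => S (tsize A + tsize B)
  | TMu A | TNu A => S (tsize A)
  end.

Lemma subformula_size C D : subformula C D -> C = D \/ tsize C < tsize D.
Proof.
  induction 1; simpl; auto; right; destruct IHsubformula; subst; lia.
Qed.

(** * Types with ordinal annotations on greatest fixed points *)

(** Well-founded trees, used as ordinals: a tree is above its immediate subtrees. *)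
Inductive ord : Type := olim : forall J : Type, (J -> ord) -> ord.

(** The annotation [None] stands for the greatest fixed point itself. *)
Definition alt (x y : option ord) : Prop :=
  match y with
  | None => exists o, x = Some o
  | Some (olim J f) => exists i, x = Some (f i)
  end.

Lemma alt_wf : well_founded alt.
Proof.
  assert (H : forall o, Acc alt (Some o)).
  { induction o as [J f IH]. constructor. intros y [i ->]. auto. }
  intros [o|]; auto. constructor. intros y [o ->]; auto.
Qed.

Inductive cst := c0 | c1 | cbot | ctop.
Inductive bop := btens | bpar | bwith | bplus.

Inductive aty : Type :=
| AV (n : nat)
| ACst (c : cst)
| ABin (o : bop) (A B : aty)
| AMu (A : aty)
| ANu (a : option ord) (A : aty).

Definition ecst (c : cst) : ty :=
  match c with c0 => T0 | c1 => T1 | cbot => TBot | ctop => TTop end.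
Definition ebop (o : bop) : ty -> ty -> ty :=
  match o with btens => TTens | bpar => TPar | bwith => TWith | bplus => TPlus end.

Fixpoint erase (A : aty) : ty :=
  match A with
  | AV n => TV n
  | ACst c => ecst c
  | ABin o A B => ebop o (erase A) (erase B)
  | AMu A => TMu (erase A)
  | ANu _ A => TNu (erase A)
  end.

Fixpoint inj (A : ty) : aty :=
  match A with
  | TV n => AV n
  | T0 => ACst c0 | T1 => ACst c1 | TBot => ACst cbot | TTop => ACst ctop
  | TTens A B => ABin btens (inj A) (inj B)
  | TPar A B => ABin bpar (inj A) (inj B)
  | TWith A B => ABin bwith (inj A) (inj B)
  | TPlus A B => ABin bplus (inj A) (inj B)
  | TMu A => AMu (inj A)
  | TNu A => ANu None (inj A)
  end.

Lemma erase_inj A : erase (inj A) = A.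
Proof. induction A; simpl; congruence. Qed.

Fixpoint asub (k : nat) (u : aty) (A : aty) : aty :=
  match A with
  | AV n => if Nat.eqb n k then u else if Nat.ltb k n then AV (pred n) else AV n
  | ACst c => ACst c
  | ABin o A B => ABin o (asub k u A) (asub k u B)
  | AMu A => AMu (asub (S k) u A)
  | ANu a A => ANu a (asub (S k) u A)
  end.

Lemma erase_asub u A : forall k, erase (asub k u A) = tsub k (erase u) (erase A).
Proof.
  induction A; intros k; simpl.
  - destruct (Nat.eqb n k); auto. destruct (Nat.ltb k n); auto.
  - destruct c; auto.
  - rewrite IHA1, IHA2. destruct o; auto.
  - rewrite IHA; auto.
  - rewrite IHA; auto.
Qed.

Inductive astep : aty -> aty -> Prop :=
| as_l o A B : astep (ABin o A B) A
| as_r o A B : astep (ABin o A B) B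
| as_mu A : astep (AMu A) (asub 0 (AMu A) A)
| as_nu a' a A : alt a' a -> astep (ANu a A) (asub 0 (ANu a' A) A).

Lemma astep_tstep A B : astep A B -> tstep (erase A) (erase B).
Proof.
  destruct 1; simpl; try (destruct o; constructor);
    rewrite erase_asub; constructor.
Qed.

(** * Subformulas of unfoldings, and descent of annotations along a thread *)

Inductive asubf : aty -> aty -> Prop :=
| af_refl A : asubf A A
| af_l c o A B : asubf c A -> asubf c (ABin o A B)
| af_r c o A B : asubf c B -> asubf c (ABin o A B)
| af_mu c A : asubf c A -> asubf c (AMu A)
| af_nu c a A : asubf c A -> asubf c (ANu a A).
#[local] Hint Constructors asubf : core.

Lemma asubf_size c d : asubf c d -> c = d \/ tsize (erase c) < tsize (erase d).
Proof.
  induction 1; simpl; auto; right; destruct IHasubf; subst; try lia;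
    destruct o; simpl; lia.
Qed.

Lemma asubf_subformula c d : asubf c d -> subformula (erase c) (erase d).
Proof.
  induction 1; simpl; try destruct o; try (constructor; auto; fail); apply sf_refl.
Qed.

Lemma tclosed_ebop m o A B :
  tclosed_at m (ebop o A B) <-> tclosed_at m A /\ tclosed_at m B.
Proof. destruct o; simpl; tauto. Qed.

(** If [u] does not show up in the result, variable [k] was never replaced; and a variable above
    [k], once lowered, would still be at least [k] and so out of the range allowed by [m]. *)
Lemma closed_asub_inv u A : forall m k, m <= k -> ~ asubf u (asub k u A) ->
  tclosed_at m (erase (asub k u A)) -> asub k u A = A.
Proof.
  induction A; simpl; intros m k Hle N C; auto.
  - destruct (Nat.eqb_spec n k).
    + exfalso; apply N; auto.
    + destruct (Nat.ltb_spec k n); simpl in *; auto; lia.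
  - apply tclosed_ebop in C as [Ca Cb].
    rewrite (IHA1 m k), (IHA2 m k); auto.
  - rewrite (IHA (S m) (S k)); auto; lia.
  - rewrite (IHA (S m) (S k)); auto; lia.
Qed.

(** When [c] is the whole substituted term and does not contain [u], closedness shows that the
    substitution changed nothing. Otherwise [c] sits in an argument of the head, where the induction
    applies, or in a copy of [u]. *)
Lemma asubf_asub c u A : tclosed_at 0 (erase c) ->
  forall k, asubf c (asub k u A) -> asubf c A \/ asubf c u \/ asubf u c.
Proof.
  intros C. induction A; intros k H.
  all: match type of H with asubf _ ?t => destruct (classic (c = t)) as [E|E] end;
    [ destruct (classic (asubf u c)) as [?|N]; auto;
      rewrite E in C, N |- *; left;
      rewrite (closed_asub_inv _ _ 0 k); auto; lia |].
  - simpl in H. destruct (Nat.eqb n k); auto.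
    destruct (Nat.ltb k n); inversion H; subst; simpl in C; lia.
  - simpl in H. inversion H; subst; auto.
  - simpl in H, E. inversion H; subst; [congruence| |];
      match goal with
      | H' : asubf c (asub _ _ A1) |- _ => destruct (IHA1 _ H') as [?|?]; auto
      | H' : asubf c (asub _ _ A2) |- _ => destruct (IHA2 _ H') as [?|?]; auto
      end.
  - simpl in H, E. inversion H; subst; [congruence|].
    match goal with
    | H' : asubf c (asub _ _ A) |- _ => destruct (IHA _ H') as [?|?]; auto
    end.
  - simpl in H, E. inversion H; subst; [congruence|].
    match goal with
    | H' : asubf c (asub _ _ A) |- _ => destruct (IHA _ H') as [?|?]; auto
    end.
Qed.

Lemma first_progress (g : nat -> aty) i :
  (forall i, g (S i) = g i \/ astep (g i) (g (S i))) ->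
  (exists m, i <= m /\ astep (g m) (g (S m))) ->
  exists m, i <= m /\ g m = g i /\ astep (g i) (g (S m)).
Proof.
  intros St [m [Hm Am]].
  replace m with (i + (m - i)) in Am by lia. clear Hm.
  generalize (m - i) Am. clear Am. intros d. revert i.
  induction d as [|d IH]; intros i Am.
  - rewrite Nat.add_0_r in Am. exists i; auto.
  - destruct (St i) as [E|A]; [|exists i; auto].
    destruct (IH (S i)) as [m' [H1 [H2 H3]]].
    { rewrite Nat.add_succ_r in Am. exact Am. }
    exists m'. rewrite <- E. split; [lia|auto].
Qed.

(** Erasure does not determine annotations, and unfolding copies formulas. The descent must know
    that whichever copy of the minimal formula is met next carries the annotation that was lowered
    last. *)
Definition uniform (c d : aty) : Prop :=
  forall c', asubf c' d -> erase c' = erase c -> c' = c.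

(** With [c] a proper subformula of the fixed point being unfolded, a copy of [c] in the result
    comes from the body or from the inside of the substituted fixed point, hence already from [d]; a
    copy that contained the fixed point would be too large. *)
Lemma uniform_astep c d d' : tclosed_at 0 (erase c) ->
  subformula (erase c) (erase d) -> erase d <> erase c ->
  uniform c d -> astep d d' -> uniform c d'.
Proof.
  intros C Sf Ne U St c' Hc E. destruct St; auto.
  - apply asubf_asub in Hc; [|rewrite E; auto].
    destruct Hc as [H|[H|H]]; auto.
    apply asubf_subformula in H. rewrite E in H.
    apply subformula_size in H. apply subformula_size in Sf.
    destruct H; [congruence|]. destruct Sf; [congruence|]. lia.
  - apply asubf_asub in Hc; [|rewrite E; auto].
    destruct Hc as [H'|[H'|H']]; auto.
    + inversion H'; subst; auto. simpl in *; congruence.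
    + apply asubf_subformula in H'. rewrite E in H'. simpl in H', Sf, Ne.
      apply subformula_size in H'. apply subformula_size in Sf.
      destruct H'; [congruence|]. destruct Sf; [congruence|]. lia.
Qed.

(** By size: a formula with the erasure of the fixed point does not fit into the body, and inside or
    around the substituted copy it can only be that copy. *)
Lemma uniform_unfold a a' A : tclosed_at 0 (erase (ANu a A)) ->
  uniform (ANu a' A) (asub 0 (ANu a' A) A).
Proof.
  intros C c' Hc E. apply asubf_asub in Hc; [|rewrite E; auto].
  destruct Hc as [H|[H|H]].
  - apply asubf_size in H. destruct H as [<-|H].
    + exfalso. apply f_equal with (f := tsize) in E. simpl in E. lia.
    + rewrite E in H. simpl in H. lia.
  - apply asubf_size in H. rewrite E in H. destruct H; auto; lia.
  - apply asubf_size in H. rewrite E in H. destruct H; auto; lia.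
Qed.

(** A thread whose minimal recurrent formula is a greatest fixed point, and that
    keeps moving, would decrease the annotation of that formula forever. *)
Lemma no_nu_thread (g : nat -> aty) :
  tclosed_at 0 (erase (g 0)) ->
  (forall i, g (S i) = g i \/ astep (g i) (g (S i))) ->
  (forall n, exists m, n <= m /\ astep (g m) (g (S m))) ->
  inf_min_is is_nu (fun i => erase (g i)) -> False.
Proof.
  intros C0 St Prog [C [IO [[B EB] Min]]].
  assert (CC : forall i, tclosed_at 0 (erase (g i))).
  { induction i; auto. destruct (St i) as [->|A]; auto.
    eapply tclosed_tstep; [apply astep_tstep; eauto|auto]. }
  destruct (fischer_ladner_finite _ C0) as [l [I0 HS]].
  assert (Il : forall i, In (erase (g i)) l).
  { induction i; auto. destruct (St i) as [->|A]; auto.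
    eapply HS; [apply IHi|]. apply astep_tstep; auto. }
  destruct (eventually_recurrent (fun i => erase (g i)) l) as [N HN].
  (* All formulas of the thread lie in a finite closure, so from [N] on only recurrent ones occur,
     and minimality of [C] applies to each of them. *)
  assert (Sf : forall i, N <= i -> subformula C (erase (g i))).
  { intros i Hi. apply Min. apply HN; auto. }
  (* Well-founded induction on the annotation shared by all copies of [C]: uniformity survives until
     [C] is met again, and the step that leaves [C] lowers the annotation in every new copy at
     once. *)
  assert (Main : forall a A i, N <= i -> erase (ANu a A) = C ->
    uniform (ANu a A) (g i) -> False).
  { intros a. induction a as [a IH] using (well_founded_induction alt_wf).
    intros A i Hi EC U.
    assert (Hj : exists j, i <= j /\ g j = ANu a A).
    { destruct (IO i) as [j [Hj Ej]].
      replace j with (i + (j - i)) in Ej by lia. clear Hj.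
      generalize (j - i) Ej. clear Ej. intros d. revert i Hi U.
      induction d as [|d IHd]; intros i Hi U Ej.
      - rewrite Nat.add_0_r in Ej. exists i. split; auto.
        apply U; auto. congruence.
      - destruct (classic (erase (g i) = C)) as [E|E].
        + exists i. split; auto. apply U; auto. congruence.
        + destruct (IHd (S i)) as [j' [H1 H2]]; auto.
          * destruct (St i) as [->|A']; auto.
            eapply uniform_astep; [| | | |apply A']; auto.
            -- rewrite EC. destruct (IO 0) as [m [_ <-]]; auto.
            -- rewrite EC. auto.
            -- congruence.
          * rewrite Nat.add_succ_r in Ej. exact Ej.
          * exists j'. split; auto; lia. }
    destruct Hj as [j [Hij Ej]].
    destruct (first_progress g j St (Prog j)) as [m [Hm [_ Sm]]].
    rewrite Ej in Sm. inversion Sm as [| | |a' a0 A0 Ha E1 E2]; subst a0 A0.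
    eapply (IH a') with (A := A) (i := S m); auto; try lia.
    rewrite <- E2. eapply uniform_unfold with (a := a). rewrite <- Ej; auto. }
  destruct (IO N) as [i [Hi Ei]].
  assert (exists a A, g i = ANu a A) as [a [A Eg]].
  { rewrite EB in Ei. destruct (g i); simpl in Ei; try discriminate; eauto.
    - destruct c; discriminate.
    - destruct o; discriminate. }
  eapply (Main a A i); auto.
  - rewrite <- Eg; auto.
  - rewrite Eg. intros c' H E. apply asubf_size in H. rewrite E in H.
    destruct H; auto; lia.
Qed.

(** * Truth of types at sessions *)

(** How a session is eventually used: never ([KFin b], with all later activity on
    side [b]), by a channel output creating sessions for the payload and the
    continuation, by a selection, or by a closing. *)
Inductive kind :=
| KFin (b : bool)
| KTen (s0 s1 : nat)
| KSel (i : bool) (s1 : nat)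
| KEnd.

Definition pset := nat -> Prop.
Definition lfp (F : pset -> pset) : pset :=
  fun s => forall S : pset, (forall t, F S t -> S t) -> S s.
Definition gfp (F : pset -> pset) : pset :=
  fun s => exists S : pset, (forall t, S t -> F S t) /\ S s.
(** The stages descending from the full set: a tree without children gives the full set, and any
    tree the intersection of [F] applied to the stages of its children. *)
Fixpoint approx (F : pset -> pset) (o : ord) : pset :=
  match o with olim J f => fun s => forall j : J, F (approx F (f j)) s end.

Definition monotone (F : pset -> pset) : Prop :=
  forall X Y : pset, (forall s, X s -> Y s) -> forall s, F X s -> F Y s.

Lemma lfp_fold F : monotone F -> forall s, F (lfp F) s -> lfp F s.
Proof.
  intros M s H S HS. apply HS. revert s H. apply M. intros t Ht. apply Ht; auto.
Qed.

Lemma gfp_fold F : monotone F -> forall s, F (gfp F) s -> gfp F s.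
Proof.
  intros M s H. exists (F (gfp F)). split; auto.
  apply M. intros t [S [HS St]]. apply (M S); auto.
  intros u Su. exists S; auto.
Qed.

Lemma gfp_unfold F : monotone F -> forall s, gfp F s -> F (gfp F) s.
Proof.
  intros M s [S [HS Ss]]. apply (M S); auto. intros t St. exists S; auto.
Qed.

Lemma lfp_unfold F : monotone F -> forall s, lfp F s -> F (lfp F) s.
Proof.
  intros M s H. apply H. apply M. apply lfp_fold; auto.
Qed.

(* Pick for each session outside the intersection a tree excluding it: the tree
   with all the children of the picked ones is already below the intersection. *)
Lemma approx_gfp F : monotone F -> forall s, (forall o, approx F o s) -> gfp F s.
Proof.
  intros M s Hs. exists (fun t => forall o, approx F o t). split; auto.
  clear s Hs. intros t Ht.
  assert (C : forall t', exists o, (forall o', approx F o' t') \/ ~ approx F o t').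
  { intros t'. destruct (classic (forall o', approx F o' t')) as [H|H].
    - exists (olim Empty_set (fun e => match e with end)); auto.
    - apply not_all_ex_not in H as [o Ho]. exists o; auto. }
  set (pick t' := proj1_sig (constructive_indefinite_description _ (C t'))).
  assert (Hp : forall t', (forall o', approx F o' t') \/ ~ approx F (pick t') t').
  { intros t'. unfold pick. apply proj2_sig. }
  set (idx o := match o with olim J f => J end).
  set (chd o := match o return idx o -> ord with olim J f => f end).
  pose (big := olim {t' : nat & idx (pick t')} (fun p => chd _ (projT2 p))).
  assert (Hb : forall t', approx F big t' -> forall o, approx F o t').
  { intros t' H. destruct (Hp t') as [?|N]; auto. exfalso; apply N.
    assert (H' : forall j, F (approx F (chd (pick t') j)) t').
    { intros j. exact (H (existT _ t' j)). }
    clear - H'. destruct (pick t') as [J f]. exact H'. }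
  apply (M (approx F big)); auto.
  exact (Ht (olim unit (fun _ => big)) tt).
Qed.

(** With [1] true and [⊥] false, a component that closes a session never has only false channels,
    while the waiting one merely loses a false channel. *)
Definition cval (c : cst) : Prop :=
  match c with c0 | cbot => False | c1 | ctop => True end.

Definition pcons (X : pset) (r : nat -> pset) : nat -> pset :=
  fun n => match n with 0 => X | S m => r m end.
Definition pemp : nat -> pset := fun _ _ => False.
Definition pins (k : nat) (X : pset) (r : nat -> pset) : nat -> pset :=
  fun n => if Nat.eqb n k then X else if Nat.ltb k n then r (pred n) else r n.

(* The values on kinds that do not match the connective are irrelevant, but they
   have to be dual to each other. *)
Definition bval (o : bop) (k : kind) (X Y : pset) : Prop :=
  match o, k with
  | btens, KTen s0 s1 => X s0 /\ Y s1
  | bpar, KTen s0 s1 => X s0 \/ Y s1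
  | bplus, KSel i s1 | bwith, KSel i s1 => if i then Y s1 else X s1
  | btens, _ | bplus, _ => False
  | bpar, _ | bwith, _ => True
  end.

Section Truth.
Variable sk : nat -> kind.

Definition at_final (b : bool) (s : nat) (Q : Prop) : Prop :=
  match sk s with KFin b' => b' <> b | _ => Q end.

(** The sessions whose endpoint on side [b] satisfies [A]. An annotated greatest fixed point is read
    as a stage of its approximation, so being false at an annotation says more than being false of
    the fixed point. *)
Fixpoint V (b : bool) (A : aty) (r : nat -> pset) {struct A} : pset :=
  match A with
  | AV n => r n
  | ACst c => fun s => at_final b s (cval c)
  | ABin o A B => fun s => at_final b s (bval o (sk s) (V b A r) (V b B r))
  | AMu A => lfp (fun X => V b A (pcons X r))
  | ANu None A => gfp (fun X => V b A (pcons X r))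
  | ANu (Some o) A => approx (fun X => V b A (pcons X r)) o
  end.

Lemma bval_mono o k (X X' Y Y' : pset) : (forall s, X s -> X' s) ->
  (forall s, Y s -> Y' s) -> bval o k X Y -> bval o k X' Y'.
Proof.
  intros HX HY. destruct o, k; simpl; auto.
  - intros []; auto.
  - intros []; auto.
  - destruct i; auto.
  - destruct i; auto.
Qed.

Lemma V_mono b A : forall r r' : nat -> pset, (forall n s, r n s -> r' n s) ->
  forall s, V b A r s -> V b A r' s.
Proof.
  induction A; intros r r' H s; simpl; auto.
  - unfold at_final. destruct (sk s); auto; apply bval_mono; eauto.
  - intros L S HS. apply L. intros t Ht. apply HS. revert Ht. apply IHA.
    intros [|m]; simpl; auto.
  - destruct a as [o|].
    + revert s. induction o as [J f IH]. simpl. intros s L j.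
      generalize (L j). apply IHA. intros [|m]; simpl; auto.
    + intros [S [HS Ss]]. exists S. split; auto. intros t St.
      generalize (HS t St). apply IHA. intros [|m]; simpl; auto.
Qed.

Lemma V_monotone b A r : monotone (fun X => V b A (pcons X r)).
Proof.
  intros X Y H. apply V_mono. intros [|m]; simpl; auto.
Qed.

Lemma V_closed b A : forall m r r', tclosed_at m (erase A) ->
  (forall n, n < m -> r n = r' n) -> V b A r = V b A r'.
Proof.
  induction A; intros m r r' C H; simpl in *; auto.
  - apply tclosed_ebop in C as [Ca Cb].
    rewrite (IHA1 m r r'), (IHA2 m r r'); auto.
  - f_equal. extensionality X. apply (IHA (S m)); auto.
    intros [|n] Hn; simpl; auto. apply H; lia.
  - replace (fun X => V b A (pcons X r')) with (fun X => V b A (pcons X r)); auto.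
    extensionality X. apply (IHA (S m)); auto.
    intros [|n] Hn; simpl; auto. apply H; lia.
Qed.

Lemma pcons_pins Y k X r : pcons Y (pins k X r) = pins (S k) X (pcons Y r).
Proof.
  extensionality n. destruct n as [|n]; auto.
  unfold pins; simpl. change (Nat.ltb (S k) (S n)) with (Nat.ltb k n).
  destruct (Nat.eqb n k); auto.
  destruct (Nat.ltb_spec k n); auto. destruct n; [lia|auto].
Qed.

Lemma V_asub b u A : tclosed_at 0 (erase u) ->
  forall k r, V b (asub k u A) r = V b A (pins k (V b u pemp) r).
Proof.
  intros Cu. induction A; intros k r; simpl; auto.
  - unfold pins. destruct (Nat.eqb n k).
    + apply (V_closed b u 0); auto; lia.
    + destruct (Nat.ltb k n); auto.
  - rewrite IHA1, IHA2; auto.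
  - f_equal. extensionality X. rewrite IHA, pcons_pins; auto.
  - replace (fun X => V b (asub (S k) u A) (pcons X r))
      with (fun X => V b A (pcons X (pins k (V b u pemp) r))); auto.
    extensionality X. rewrite IHA, pcons_pins; auto.
Qed.

Lemma V_asub0 b u A : tclosed_at 0 (erase u) ->
  V b (asub 0 u A) pemp = V b A (pcons (V b u pemp) pemp).
Proof.
  intros C. rewrite V_asub; auto. f_equal. extensionality n.
  destruct n; auto.
Qed.

Definition fls (b : bool) (A : aty) (s : nat) : Prop := ~ V b A pemp s.

Lemma fls_mu b A s : tclosed_at 0 (erase (AMu A)) -> fls b (AMu A) s ->
  fls b (asub 0 (AMu A) A) s.
Proof.
  intros C H. unfold fls in *. rewrite V_asub0; auto.
  intros H'. apply H. apply lfp_fold; [apply V_monotone|exact H'].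
Qed.

Lemma fls_nu b a A s : tclosed_at 0 (erase (ANu a A)) -> fls b (ANu a A) s ->
  exists a', alt a' a /\ fls b (asub 0 (ANu a' A) A) s.
Proof.
  intros C H. unfold fls in *.
  assert (K : exists o, alt (Some o) a /\
              ~ V b A (pcons (V b (ANu (Some o) A) pemp) pemp) s).
  { assert (L : forall o, ~ V b (ANu (Some o) A) pemp s ->
      exists o', alt (Some o') (Some o) /\
              ~ V b A (pcons (V b (ANu (Some o') A) pemp) pemp) s).
    { intros [J f] Ho. simpl in Ho. apply not_all_ex_not in Ho as [j Hj].
      exists (f j). split; simpl; eauto. }
    destruct a as [o|].
    - apply L; auto.
    - destruct (classic (forall o, V b (ANu (Some o) A) pemp s)) as [Ho|Ho].
      + exfalso. apply H. simpl. apply approx_gfp; auto. apply V_monotone.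
      + apply not_all_ex_not in Ho as [o Ho].
        destruct (L o Ho) as [o' [_ H']]. exists o'. split; simpl; eauto. }
  destruct K as [o [Ho K]]. exists (Some o). split; auto.
  rewrite V_asub0; auto.
Qed.

Lemma V_final_true b b' A s : sk s = KFin b' -> b' <> b ->
  (forall k, ~ unguarded k (erase A)) -> guarded (erase A) ->
  forall r, V b A r s.
Proof.
  intros E N. induction A; intros U G r; simpl in *.
  - exfalso. eapply U; eauto.
  - unfold at_final. rewrite E; auto.
  - unfold at_final. rewrite E; auto.
  - apply lfp_fold; [apply V_monotone|]. destruct G.
    apply IHA; auto. intros [|k]; auto.
  - destruct G as [G1 G2].
    assert (H : forall r, V b A r s) by (apply IHA; auto; intros [|k]; auto).
    destruct a as [[J f]|].
    + intros j. apply H.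
    + apply gfp_fold; [apply V_monotone|]. apply H.
Qed.

Lemma V_final_false b A s : sk s = KFin b ->
  (forall k, ~ unguarded k A) -> guarded A ->
  forall r, ~ V b (inj A) r s.
Proof.
  intros E. induction A; intros U G r; simpl in *;
    try (unfold at_final; rewrite E; congruence).
  - exfalso. eapply U; eauto.
  - intros H. apply (lfp_unfold _ (V_monotone b (inj A) r)) in H. destruct G.
    revert H. apply IHA; auto. intros [|k]; auto.
  - intros H. apply (gfp_unfold _ (V_monotone b (inj A) r)) in H. destruct G.
    revert H. apply IHA; auto. intros [|k]; auto.
Qed.

Lemma is_ty_not_unguarded A : is_ty A -> forall k, ~ unguarded k A.
Proof. intros [C _] k U. eapply unguarded_closed in U; eauto. lia. Qed.

Lemma fls_final b b' A s : is_ty (erase A) -> sk s = KFin b' -> fls b A s -> b' = b.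
Proof.
  intros T E F. apply NNPP. intros N. apply F.
  eapply V_final_true; eauto; [apply is_ty_not_unguarded; auto|apply T].
Qed.

Lemma fls_final_inj b A s : is_ty A -> sk s = KFin b -> fls b (inj A) s.
Proof.
  intros T E. apply V_final_false; auto; [apply is_ty_not_unguarded; auto|apply T].
Qed.

Lemma V_dual b A : forall r r' : nat -> pset,
  (forall n s, r n s -> r' n s -> False) ->
  forall s, V b (inj A) r s -> V (negb b) (inj (dual A)) r' s -> False.
Proof.
  induction A; intros r r' H s; simpl; unfold at_final;
    try (destruct (sk s), b; simpl; try destruct b0; congruence || tauto).
  - eauto.
  - destruct (sk s); simpl; try tauto.
    + destruct b, b0; simpl; congruence.
    + intros [H1 H2] [H3|H3]; eauto.
  - destruct (sk s); simpl; try tauto.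
    + destruct b, b0; simpl; congruence.
    + intros [H1|H1] [H2 H3]; eauto.
  - destruct (sk s); simpl; try tauto.
    + destruct b, b0; simpl; congruence.
    + destruct i; eauto.
  - destruct (sk s); simpl; try tauto.
    + destruct b, b0; simpl; congruence.
    + destruct i; eauto.
  - intros L [S [HS Ss]]. apply (L (fun t => ~ S t)); auto.
    intros t Ht St. eapply IHA; [|exact Ht|apply HS; auto].
    intros [|m]; simpl; eauto.
  - intros [S [HS Ss]] L. apply (L (fun t => ~ S t)); auto.
    intros t Ht St. eapply IHA; [|apply HS; apply St|exact Ht].
    intros [|m]; simpl; eauto.
Qed.

End Truth.

(** * Choice, duality, and inversion of false formulas *)

Lemma dependent_choice {X : Type} (P : X -> Prop) (R : X -> X -> Prop) :
  (forall x, P x -> exists y, P y /\ R x y) ->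
  forall x0, P x0 ->
  exists f : nat -> X, f 0 = x0 /\ forall n, P (f n) /\ R (f n) (f (S n)).
Proof.
  intros H x0 P0.
  set (step := fun x : {x | P x} =>
    let w := constructive_indefinite_description _ (H (proj1_sig x) (proj2_sig x)) in
    exist P (proj1_sig w) (proj1 (proj2_sig w))).
  set (g := fix g n := match n with 0 => exist P x0 P0 | S n => step (g n) end).
  exists (fun n => proj1_sig (g n)). split; auto.
  intros n. split; [apply proj2_sig|]. simpl.
  destruct constructive_indefinite_description as [y [Py Ry]]; auto.
Qed.

Lemma countable_choice {Y : Type} (R : nat -> Y -> Prop) :
  (forall n, exists y, R n y) -> exists f, forall n, R n (f n).
Proof.
  intros H.
  exists (fun n => proj1_sig (constructive_indefinite_description _ (H n))).
  intros n. apply proj2_sig.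
Qed.

Lemma no_infinite_descent (h : nat -> nat) N :
  ~ (forall i, N <= i -> h (S i) < h i).
Proof.
  intros H.
  assert (K : forall d, h (N + d) + d <= h N).
  { induction d.
    - rewrite !Nat.add_0_r; lia.
    - replace (N + S d) with (S (N + d)) by lia.
      assert (h (S (N + d)) < h (N + d)) by (apply H; lia). lia. }
  specialize (K (S (h N))). lia.
Qed.

Lemma dual_dual A : dual (dual A) = A.
Proof. induction A; simpl; congruence. Qed.

Lemma tclosed_dual A : forall m, tclosed_at m A -> tclosed_at m (dual A).
Proof. induction A; simpl; intros m H; auto; destruct H; auto. Qed.

Lemma unguarded_dual A : forall k, unguarded k (dual A) -> unguarded k A.
Proof. induction A; simpl; auto. Qed.

Lemma guarded_dual A : guarded A -> guarded (dual A).
Proof.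
  induction A; simpl; intros H; auto; destruct H; split; auto;
    intros U; apply unguarded_dual in U; auto.
Qed.

Lemma is_ty_dual A : is_ty A -> is_ty (dual A).
Proof. intros []; split; [apply tclosed_dual|apply guarded_dual]; auto. Qed.

Lemma dual_tsub u A : forall k, dual (tsub k u A) = tsub k (dual u) (dual A).
Proof.
  induction A; intros k; simpl; try congruence.
  destruct (Nat.eqb n k); auto. destruct (Nat.ltb k n); auto.
Qed.

Lemma subformula_dual C D : subformula C D -> subformula (dual C) (dual D).
Proof. induction 1; simpl; solve [apply sf_refl | constructor; assumption]. Qed.

Lemma inf_min_is_dual (g : nat -> ty) :
  inf_min_is is_mu g -> inf_min_is is_nu (fun n => dual (g n)).
Proof.
  intros [C [IO [[B ->] Min]]]. exists (TNu (dual B)). split; [|split].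
  - intros n. destruct (IO n) as [m [Hm E]]. exists m. rewrite E. auto.
  - exists (dual B); auto.
  - intros D HD. rewrite <- (dual_dual D).
    apply (subformula_dual (TMu B)). apply Min.
    intros n. destruct (HD n) as [m [Hm E]]. exists m. split; auto.
    rewrite <- E, dual_dual. auto.
Qed.

Lemma erase_bin_inv x o A B : erase x = ebop o A B ->
  exists a b, x = ABin o a b /\ erase a = A /\ erase b = B.
Proof.
  destruct x; simpl; intros E;
    try (destruct o; discriminate).
  - destruct c, o; discriminate.
  - destruct o, o0; try discriminate; injection E as <- <-; eauto.
Qed.

Lemma erase_mu_inv x A : erase x = TMu A -> exists a, x = AMu a /\ erase a = A.
Proof.
  destruct x; simpl; intros E; try discriminate.
  - destruct c; discriminate.
  - destruct o; discriminate.
  - injection E; eauto.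
Qed.

Lemma erase_nu_inv x A : erase x = TNu A -> exists o a, x = ANu o a /\ erase a = A.
Proof.
  destruct x; simpl; intros E; try discriminate.
  - destruct c; discriminate.
  - destruct o; discriminate.
  - injection E; eauto.
Qed.

Lemma erase_cst_inv x c : erase x = ecst c -> x = ACst c.
Proof.
  destruct x as [n|k|o A B|A|a A]; simpl; intros E; try (destruct c; discriminate).
  - destruct c, k; congruence || discriminate.
  - destruct o, c; discriminate.
Qed.

Lemma fls_unfold_mu sk b x A s : is_ty (TMu A) -> erase x = TMu A -> fls sk b x s ->
  exists x', erase x' = unfold_mu A /\ fls sk b x' s /\ astep x x'.
Proof.
  intros T E F. destruct (erase_mu_inv _ _ E) as [a [-> Ea]].
  exists (asub 0 (AMu a) a). split; [|split].
  - rewrite erase_asub. simpl. rewrite Ea. auto.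
  - apply fls_mu; auto. rewrite E; apply T.
  - constructor.
Qed.

Lemma fls_unfold_nu sk b x A s : is_ty (TNu A) -> erase x = TNu A -> fls sk b x s ->
  exists x', erase x' = unfold_nu A /\ fls sk b x' s /\ astep x x'.
Proof.
  intros T E F. destruct (erase_nu_inv _ _ E) as [o [a [-> Ea]]].
  apply fls_nu in F; [|rewrite E; apply T]. destruct F as [a' [Ha F]].
  exists (asub 0 (ANu a' a) a). split; [|split]; auto.
  - rewrite erase_asub. simpl. rewrite Ea. auto.
  - constructor; auto.
Qed.

Lemma fls_bin sk b o x y s : fls sk b (ABin o x y) s ->
  (forall b', sk s <> KFin b') ->
  ~ bval o (sk s) (V sk b x pemp) (V sk b y pemp).
Proof.
  intros F N H. apply F. simpl. unfold at_final.
  destruct (sk s); auto. edestruct N; eauto.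
Qed.

(** * Subtyping derivations against truth values *)

Section Subtyping.
Variable sk : nat -> kind.

(** Both sides of a node of a subtyping derivation read as false formulas, of one
    and the same session: the left type is dualized. *)
Record sstate := { snode : tree slabel; slf : aty; srt : aty; sses : nat }.

Record sstate_ok (b : bool) (x : sstate) : Prop := {
  sok_tree : locally_correct srule (snode x);
  sok_l : erase (slf x) = dual (sleft (label (snode x)));
  sok_r : erase (srt x) = sright (label (snode x));
  sok_tl : is_ty (erase (slf x));
  sok_tr : is_ty (erase (srt x));
  sok_fl : fls sk (negb b) (slf x) (sses x);
  sok_fr : fls sk b (srt x) (sses x) }.

(** A side that rests is paid for by the other: a rule that touches only one side unfolds a fixed
    point there and lowers its [lead]. Hence neither side can rest forever, and both give threads
    with infinitely many steps. *)
Definition moves (a a' c c' : aty) : Prop :=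
  astep a a' \/ (a' = a /\ lead (erase c') < lead (erase c)).

Definition sstate_step (x y : sstate) : Prop :=
  (exists p, nth_error (kids (snode x)) p = Some (snode y)) /\
  moves (slf x) (slf y) (srt x) (srt y) /\ moves (srt x) (srt y) (slf x) (slf y).

Lemma locally_correct_kid {L} (R : L -> list L -> Prop) t u :
  locally_correct R t -> In u (kids t) -> locally_correct R u.
Proof.
  intros H I v Hv. apply H. revert I. clear H.
  induction Hv; intros I.
  - eapply reach_kid; eauto. constructor.
  - eapply reach_kid; eauto.
Qed.

Lemma kids_of_labels {L} (t : tree L) i l : nth_error (map label (kids t)) i = Some l ->
  exists u, nth_error (kids t) i = Some u /\ label u = l.
Proof.
  rewrite nth_error_map. destruct (nth_error (kids t) i) as [u|]; simpl; try discriminate.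
  intros E; injection E; eauto.
Qed.

Lemma sstate_next_bin b x o1 o2 a1 a2 e1 e2 A1 A2 B1 B2 r1 r2 (i : bool) s' :
  locally_correct srule (snode x) ->
  map label (kids (snode x)) = [(A1, B1, r1); (A2, B2, r2)] ->
  slf x = ABin o1 a1 a2 -> srt x = ABin o2 e1 e2 ->
  is_ty (erase (slf x)) -> is_ty (erase (srt x)) ->
  erase a1 = dual A1 -> erase a2 = dual A2 -> erase e1 = B1 -> erase e2 = B2 ->
  fls sk (negb b) (if i then a2 else a1) s' -> fls sk b (if i then e2 else e1) s' ->
  exists y, sstate_ok b y /\ sstate_step x y.
Proof.
  intros LC K El Er Tl Tr E1 E2 E3 E4 Fl Fr.
  destruct (kids_of_labels (snode x) (if i then 1 else 0)
    (if i then (A2, B2, r2) else (A1, B1, r1))) as [u [Hu Lu]].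
  { rewrite K. destruct i; auto. }
  assert (Sl : astep (slf x) (if i then a2 else a1)).
  { rewrite El. destruct i; constructor. }
  assert (Sr : astep (srt x) (if i then e2 else e1)).
  { rewrite Er. destruct i; constructor. }
  exists {| snode := u; slf := if i then a2 else a1; srt := if i then e2 else e1;
            sses := s' |}.
  split.
  - constructor; simpl; auto.
    + eapply locally_correct_kid; eauto. eapply nth_error_In; eauto.
    + rewrite Lu. destruct i; auto.
    + rewrite Lu. destruct i; auto.
    + eapply is_ty_tstep; [apply astep_tstep, Sl|auto].
    + eapply is_ty_tstep; [apply astep_tstep, Sr|auto].
  - split; [eauto|]. split; left; auto.
Qed.

Lemma sstate_next_left b x y : sstate_ok b x ->
  fls sk (negb b) y (sses x) -> astep (slf x) y ->
  lead (erase y) < lead (erase (slf x)) ->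
  (exists u, (exists p, nth_error (kids (snode x)) p = Some u) /\
     erase y = dual (sleft (label u)) /\ erase (srt x) = sright (label u)) ->
  exists z, sstate_ok b z /\ sstate_step x z.
Proof.
  intros [LC El Er Tl Tr Fl Fr] F S L [u [[p Hp] [E1 E2]]].
  exists {| snode := u; slf := y; srt := srt x; sses := sses x |}. split.
  - constructor; simpl; auto.
    + eapply locally_correct_kid; eauto. eapply nth_error_In; eauto.
    + eapply is_ty_tstep; [apply astep_tstep, S|auto].
  - split; simpl; [eauto|]. split; [left|right]; auto.
Qed.

Lemma sstate_next_right b x y : sstate_ok b x ->
  fls sk b y (sses x) -> astep (srt x) y ->
  lead (erase y) < lead (erase (srt x)) ->
  (exists u, (exists p, nth_error (kids (snode x)) p = Some u) /\
     erase (slf x) = dual (sleft (label u)) /\ erase y = sright (label u)) ->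
  exists z, sstate_ok b z /\ sstate_step x z.
Proof.
  intros [LC El Er Tl Tr Fl Fr] F S L [u [[p Hp] [E1 E2]]].
  exists {| snode := u; slf := slf x; srt := y; sses := sses x |}. split.
  - constructor; simpl; auto.
    + eapply locally_correct_kid; eauto. eapply nth_error_In; eauto.
    + eapply is_ty_tstep; [apply astep_tstep, S|auto].
  - split; simpl; [eauto|]. split; [right|left]; auto.
Qed.

(** Axioms are excluded, as one of a constant and its dual is true at a used session. Otherwise the
    kind of the session selects the premise: a false par has both parts false, a false tensor at
    least one, which is followed; for with and plus it is the selected part. *)
Lemma sstate_progress b x : sstate_ok b x -> exists y, sstate_ok b y /\ sstate_step x y.
Proof.
  intros OK. assert (OK' := OK). destruct OK' as [LC El Er Tl Tr Fl Fr].
  assert (NF : forall b', sk (sses x) <> KFin b').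
  { intros b' E. pose proof (fls_final _ _ _ _ _ Tl E Fl).
    pose proof (fls_final _ _ _ _ _ Tr E Fr). subst; destruct b; discriminate. }
  assert (Rl := LC (snode x) (reach_root _)).
  destruct (label (snode x)) as [[A B] r] eqn:El'. simpl in El, Er.
  assert (CST : forall c1 c2, slf x = ACst c1 -> srt x = ACst c2 ->
            (cval c1 -> False) /\ (cval c2 -> False)).
  { intros k1 k2 H1 H2. rewrite H1 in Fl. rewrite H2 in Fr.
    unfold fls in Fl, Fr; simpl in Fl, Fr. unfold at_final in Fl, Fr.
    destruct (sk (sses x)); auto. edestruct NF; eauto. }
  remember (A, B, r) as l eqn:Hl. remember (map label (kids (snode x))) as ks eqn:Hk.
  symmetry in Hk.
  destruct Rl; injection Hl as <- <- <-; simpl in El.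
  - apply (erase_cst_inv _ ctop) in El. rewrite El in Fl.
    exfalso; apply Fl. simpl. unfold at_final.
    destruct (sk (sses x)); simpl; auto. edestruct NF; eauto.
  - apply (erase_cst_inv _ ctop) in Er. rewrite Er in Fr.
    exfalso; apply Fr. simpl. unfold at_final.
    destruct (sk (sses x)); simpl; auto. edestruct NF; eauto.
  - exfalso. destruct H as [<-|[<-|[<-|[<-|[]]]]]; simpl in El.
    + apply (erase_cst_inv _ ctop) in El. apply (erase_cst_inv _ c0) in Er.
      destruct (CST _ _ El Er) as [K1 K2]; apply K1; exact I.
    + apply (erase_cst_inv _ cbot) in El. apply (erase_cst_inv _ c1) in Er.
      destruct (CST _ _ El Er) as [K1 K2]; apply K2; exact I.
    + apply (erase_cst_inv _ c1) in El. apply (erase_cst_inv _ cbot) in Er.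
      destruct (CST _ _ El Er) as [K1 K2]; apply K1; exact I.
    + apply (erase_cst_inv _ c0) in El. apply (erase_cst_inv _ ctop) in Er.
      destruct (CST _ _ El Er) as [K1 K2]; apply K2; exact I.
  - apply (erase_bin_inv _ bpar) in El as [a1 [a2 [Ea [Ea1 Ea2]]]].
    apply (erase_bin_inv _ btens) in Er as [e1 [e2 [Ee [Ee1 Ee2]]]].
    assert (Fl' := Fl). assert (Fr' := Fr). rewrite Ea in Fl'. rewrite Ee in Fr'.
    apply fls_bin in Fl'; auto. apply fls_bin in Fr'; auto.
    clear CST. destruct (sk (sses x)) as [b'|s0 s1|j s1|]; simpl in Fl', Fr'; try tauto;
      try (edestruct NF; reflexivity).
    destruct (classic (V sk b e1 pemp s0)) as [H1|H1].
    + eapply sstate_next_bin with (i := true) (s' := s1); eauto; unfold fls; tauto.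
    + eapply sstate_next_bin with (i := false) (s' := s0); eauto; unfold fls; tauto.
  - apply (erase_bin_inv _ btens) in El as [a1 [a2 [Ea [Ea1 Ea2]]]].
    apply (erase_bin_inv _ bpar) in Er as [e1 [e2 [Ee [Ee1 Ee2]]]].
    assert (Fl' := Fl). assert (Fr' := Fr). rewrite Ea in Fl'. rewrite Ee in Fr'.
    apply fls_bin in Fl'; auto. apply fls_bin in Fr'; auto.
    clear CST. destruct (sk (sses x)) as [b'|s0 s1|j s1|]; simpl in Fl', Fr'; try tauto;
      try (edestruct NF; reflexivity).
    destruct (classic (V sk (negb b) a1 pemp s0)) as [H1|H1].
    + eapply sstate_next_bin with (i := true) (s' := s1); eauto; unfold fls; tauto.
    + eapply sstate_next_bin with (i := false) (s' := s0); eauto; unfold fls; tauto.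
  - apply (erase_bin_inv _ bplus) in El as [a1 [a2 [Ea [Ea1 Ea2]]]].
    apply (erase_bin_inv _ bwith) in Er as [e1 [e2 [Ee [Ee1 Ee2]]]].
    assert (Fl' := Fl). assert (Fr' := Fr). rewrite Ea in Fl'. rewrite Ee in Fr'.
    apply fls_bin in Fl'; auto. apply fls_bin in Fr'; auto.
    clear CST. destruct (sk (sses x)) as [b'|s0 s1|j s1|]; simpl in Fl', Fr'; try tauto;
      try (edestruct NF; reflexivity).
    eapply sstate_next_bin with (i := j) (s' := s1); eauto; destruct j; auto.
  - apply (erase_bin_inv _ bwith) in El as [a1 [a2 [Ea [Ea1 Ea2]]]].
    apply (erase_bin_inv _ bplus) in Er as [e1 [e2 [Ee [Ee1 Ee2]]]].
    assert (Fl' := Fl). assert (Fr' := Fr). rewrite Ea in Fl'. rewrite Ee in Fr'.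
    apply fls_bin in Fl'; auto. apply fls_bin in Fr'; auto.
    clear CST. destruct (sk (sses x)) as [b'|s0 s1|j s1|]; simpl in Fl', Fr'; try tauto;
      try (edestruct NF; reflexivity).
    eapply sstate_next_bin with (i := j) (s' := s1); eauto; destruct j; auto.
  - assert (Tl' := Tl). rewrite El in Tl'.
    destruct (fls_unfold_nu sk _ _ _ _ Tl' El Fl) as [y [Ey [Fy Sy]]].
    apply (sstate_next_left b x y); auto.
    + rewrite Ey, El. apply lead_unfold_nu; auto.
    + destruct (kids_of_labels (snode x) 0 (unfold_mu A0, B0, r0)) as [u [Hu Lu]];
        [rewrite Hk; auto|].
      exists u. rewrite Lu. simpl. split; [eauto|]. split; auto.
      rewrite Ey. unfold unfold_mu, unfold_nu. rewrite dual_tsub. auto.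
  - assert (Tl' := Tl). rewrite El in Tl'.
    destruct (fls_unfold_mu sk _ _ _ _ Tl' El Fl) as [y [Ey [Fy Sy]]].
    apply (sstate_next_left b x y); auto.
    + rewrite Ey, El. apply lead_unfold_mu; auto.
    + destruct (kids_of_labels (snode x) 0 (unfold_nu A0, B0, r0)) as [u [Hu Lu]];
        [rewrite Hk; auto|].
      exists u. rewrite Lu. simpl. split; [eauto|]. split; auto.
      rewrite Ey. unfold unfold_mu, unfold_nu. rewrite dual_tsub. auto.
  - assert (Tr' := Tr). rewrite Er in Tr'.
    destruct (fls_unfold_mu sk _ _ _ _ Tr' Er Fr) as [y [Ey [Fy Sy]]].
    apply (sstate_next_right b x y); auto.
    + rewrite Ey, Er. apply lead_unfold_mu; auto.
    + destruct (kids_of_labels (snode x) 0 (A0, unfold_mu B0, r0)) as [u [Hu Lu]];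
        [rewrite Hk; auto|].
      exists u. rewrite Lu. simpl. split; [eauto|]. split; auto.
  - assert (Tr' := Tr). rewrite Er in Tr'.
    destruct (fls_unfold_nu sk _ _ _ _ Tr' Er Fr) as [y [Ey [Fy Sy]]].
    apply (sstate_next_right b x y); auto.
    + rewrite Ey, Er. apply lead_unfold_nu; auto.
    + destruct (kids_of_labels (snode x) 0 (A0, unfold_nu B0, r0)) as [u [Hu Lu]];
        [rewrite Hk; auto|].
      exists u. rewrite Lu. simpl. split; [eauto|]. split; auto.
Qed.

(** Iterated progress draws an infinite branch of the subtyping derivation. Dualization turns the
    [is_mu] condition on the left into an [is_nu] condition, so either alternative of validity
    yields a thread excluded by [no_nu_thread]. *)
Lemma no_false_subtype b A B s : is_ty A -> is_ty B -> subtype A B ->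
  fls sk (negb b) (inj (dual A)) s -> fls sk b (inj B) s -> False.
Proof.
  intros TA TB [t [Et [LC Val]]] FA FB.
  set (x0 := {| snode := t; slf := inj (dual A); srt := inj B; sses := s |}).
  destruct (dependent_choice (sstate_ok b) sstate_step (sstate_progress b) x0)
    as [f [E0 Hf]].
  { destruct (label t) as [[A' B'] r] eqn:El. simpl in Et. injection Et as -> ->.
    constructor; simpl; auto; rewrite ?erase_inj, ?El; auto. apply is_ty_dual; auto. }
  destruct (countable_choice (fun n p =>
    nth_error (kids (snode (f n))) p = Some (snode (f (S n))))) as [p Hp].
  { intros n. apply (Hf n). }
  destruct (Val (fun n => snode (f n)) p) as [M|M].
  - split; auto. rewrite E0; auto.
  - apply inf_min_is_dual in M.
    replace (fun n => dual (sleft (label (snode (f n)))))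
      with (fun n => erase (slf (f n))) in M
      by (extensionality n; apply (sok_l b); apply Hf).
    apply (no_nu_thread (fun n => slf (f n))); auto.
    + eapply sok_tl; apply Hf.
    + intros i. destruct (Hf i) as [_ [_ [[H|[H _]] _]]]; auto.
    + intros n. apply NNPP. intros N.
      apply (no_infinite_descent (fun i => lead (erase (srt (f i)))) n).
      intros i Hi. destruct (Hf i) as [_ [_ [[H|[_ H]] _]]]; auto.
      exfalso; apply N; eauto.
  - replace (fun n => sright (label (snode (f n))))
      with (fun n => erase (srt (f n))) in M
      by (extensionality n; apply (sok_r b); apply Hf).
    apply (no_nu_thread (fun n => srt (f n))); auto.
    + eapply sok_tr; apply Hf.
    + intros i. destruct (Hf i) as [_ [_ [_ [H|[H _]]]]]; auto.
    + intros n. apply NNPP. intros N.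
      apply (no_infinite_descent (fun i => lead (erase (slf (f i)))) n).
      intros i Hi. destruct (Hf i) as [_ [_ [_ [H|[_ H]]]]]; auto.
      exfalso; apply N; eauto.
Qed.

(** Were both types true, [V_dual] would make both duals false, and these are the two formulas that
    [no_false_subtype] forbids for [A] and [dual B]. *)
Lemma cut_one_false b A B s : is_ty A -> is_ty B -> subtype A (dual B) ->
  fls sk b (inj A) s \/ fls sk (negb b) (inj B) s.
Proof.
  intros TA TB Sub. apply NNPP. intros N. apply not_or_and in N as [N1 N2].
  apply NNPP in N1. apply NNPP in N2.
  apply (no_false_subtype b A (dual B) s); auto.
  - apply is_ty_dual; auto.
  - intros H. apply (V_dual sk b A pemp pemp) with (s := s); auto.
  - intros H. apply (V_dual sk (negb b) B pemp pemp) with (s := s); auto.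
    rewrite Bool.negb_involutive. exact H.
Qed.

End Subtyping.

(** * Typing derivations *)

Inductive unfolds : ty -> ty -> Prop :=
| unf_mu A : unfolds (TMu A) (unfold_mu A)
| unf_nu A : unfolds (TNu A) (unfold_nu A).

Lemma unfolds_tstep A B : unfolds A B -> tstep A B.
Proof. destruct 1; constructor. Qed.

Lemma lead_unfolds A B : is_ty A -> unfolds A B -> lead B < lead A.
Proof. intros T U. destruct U; [apply lead_unfold_mu|apply lead_unfold_nu]; auto. Qed.

Definition nproc (t : tree tlabel) : proc := tproc (label t).
Definition nctx (t : tree tlabel) : ctx := tctx (label t).
Definition ntag (t : tree tlabel) : trule_tag := ttag (label t).

Lemma one_kid {L} (t : tree L) l : map label (kids t) = [l] ->
  exists u, kids t = [u] /\ label u = l.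
Proof.
  destruct (kids t) as [|u [|]]; simpl; intros E; try discriminate.
  injection E as <-. eauto.
Qed.

Lemma two_kids {L} (t : tree L) l1 l2 : map label (kids t) = [l1; l2] ->
  exists u1 u2, kids t = [u1; u2] /\ label u1 = l1 /\ label u2 = l2.
Proof.
  destruct (kids t) as [|u1 [|u2 [|]]]; simpl; intros E; try discriminate.
  injection E as <- <-. eauto 6.
Qed.

Section Derivations.
Variable E : env.

Definition node_ok (t : tree tlabel) : Prop :=
  trule E (label t) (map label (kids t)).

Ltac start :=
  unfold node_ok, nproc, nctx, ntag; intros R;
  match type of R with trule _ (label ?t) _ =>
    destruct (label t) as [[P0 G0] r0]; simpl in * end;
  intros; subst; inversion R; subst;
  repeat match goal with
  | H : [_] = map label _ |- _ =>
      symmetry in H; apply one_kid in H; destruct H as [?u [? ?El]]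
  | H : [_; _] = map label _ |- _ =>
      symmetry in H; apply two_kids in H; destruct H as [?u [?u [? [?El ?El]]]]
  | H : [] = map label _ |- _ =>
      symmetry in H; apply map_eq_nil in H
  end.

Lemma fix_inv t x : node_ok t -> ntag t = RFix x ->
  exists u A B, kids t = [u] /\ nctx t x = Some A /\ unfolds A B /\
    nproc u = nproc t /\ nctx u = upd (nctx t) x (Some B).
Proof.
  start.
  - exists u, (TMu A), (unfold_mu A). rewrite El; simpl. repeat split; auto. constructor.
  - exists u, (TNu A), (unfold_nu A). rewrite El; simpl. repeat split; auto. constructor.
Qed.

Lemma call_inv t a xs : node_ok t -> ntag t = RAx -> nproc t = PCall a xs ->
  exists u, kids t = [u] /\ length xs = fst (E a) /\
    nproc u = instantiate E a xs /\ nctx u = nctx t.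
Proof. start. exists u. rewrite El; simpl. auto. Qed.

Lemma cut_inv t P Q : node_ok t -> ntag t = RAx -> nproc t = PCut P Q ->
  exists u1 u2 G1 G2 A B, kids t = [u1; u2] /\ is_ty A /\ is_ty B /\
    disj_union (nctx t) G1 G2 /\ subtype A (dual B) /\
    nproc u1 = P /\ nctx u1 = scons (Some A) G1 /\
    nproc u2 = Q /\ nctx u2 = scons (Some B) G2.
Proof.
  start. exists u, u0, G1, G2, A, B. rewrite El, El0; simpl. auto 10.
Qed.

Lemma close_inv t x : node_ok t -> ntag t = RAx -> nproc t = PClose x ->
  nctx t x = Some T1 /\ forall k, k <> x -> nctx t k = None.
Proof. start. auto. Qed.

Lemma wait_inv t x P : node_ok t -> ntag t = RAx -> nproc t = PWait x P ->
  exists u, kids t = [u] /\ nctx t x = Some TBot /\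
    nproc u = P /\ nctx u = upd (nctx t) x None.
Proof. start. exists u. rewrite El; simpl. auto. Qed.

Lemma in_inv t x P : node_ok t -> ntag t = RAx -> nproc t = PIn x P ->
  exists u A B, kids t = [u] /\ nctx t x = Some (TPar A B) /\
    nproc u = P /\ nctx u = scons (Some A) (upd (nctx t) x (Some B)).
Proof. start. exists u, A, B. rewrite El; simpl. auto. Qed.

Lemma out_inv t x P Q : node_ok t -> ntag t = RAx -> nproc t = POut x P Q ->
  exists u1 u2 G1 G2 A B, kids t = [u1; u2] /\ nctx t x = Some (TTens A B) /\
    disj_union (upd (nctx t) x None) G1 G2 /\
    nproc u1 = P /\ nctx u1 = scons (Some A) G1 /\
    nproc u2 = Q /\ nctx u2 = upd G2 x (Some B).
Proof. start. exists u, u0, G1, G2, A, B. rewrite El, El0; simpl. auto 10. Qed.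

Lemma case_inv t x P Q : node_ok t -> ntag t = RAx -> nproc t = PCase x P Q ->
  exists u1 u2 A B, kids t = [u1; u2] /\ nctx t x = Some (TWith A B) /\
    nproc u1 = P /\ nctx u1 = upd (nctx t) x (Some A) /\
    nproc u2 = Q /\ nctx u2 = upd (nctx t) x (Some B).
Proof. start. exists u, u0, A, B. rewrite El, El0; simpl. auto 10. Qed.

Lemma sel_inv t x i P : node_ok t -> ntag t = RAx -> nproc t = PSel x i P ->
  exists u A0 A1, kids t = [u] /\ nctx t x = Some (TPlus A0 A1) /\
    nproc u = P /\ nctx u = upd (nctx t) x (Some (if i then A1 else A0)).
Proof. start. exists u, A0, A1. rewrite El; simpl. auto. Qed.

Definition types_ok (G : ctx) : Prop := forall k A, G k = Some A -> is_ty A.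

Lemma types_ok_upd G x o : types_ok G -> (forall A, o = Some A -> is_ty A) ->
  types_ok (upd G x o).
Proof. intros H Ho k A. unfold upd. destruct (Nat.eqb k x); eauto. Qed.

Lemma types_ok_scons G A : types_ok G -> is_ty A -> types_ok (scons (Some A) G).
Proof. intros H HA [|k] B; simpl; eauto. intros Eq; injection Eq as <-; auto. Qed.

Lemma types_ok_disj G G1 G2 : disj_union G G1 G2 -> types_ok G ->
  types_ok G1 /\ types_ok G2.
Proof.
  intros D H. split; intros k A Hk; destruct (D k) as [[D1 D2]|[D1 D2]]; try congruence;
    apply (H k); congruence.
Qed.

Lemma types_ok_kid t u : node_ok t -> In u (kids t) -> types_ok (nctx t) ->
  types_ok (nctx u).
Proof.
  intros R I H.
  assert (HS : forall A B, tstep A B -> is_ty A -> is_ty B) by apply is_ty_tstep.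
  assert (Some_inj : forall A B : ty, Some A = Some B -> A = B) by congruence.
  destruct (ntag t) as [|x] eqn:Et.
  - destruct (nproc t) eqn:Ep.
    + destruct (call_inv t _ _ R Et Ep) as [v [K [_ [_ C]]]].
      rewrite K in I. destruct I as [<-|[]]. rewrite C; auto.
    + destruct (wait_inv t _ _ R Et Ep) as [v [K [_ [_ C]]]].
      rewrite K in I. destruct I as [<-|[]]. rewrite C.
      apply types_ok_upd; auto; discriminate.
    + destruct (in_inv t _ _ R Et Ep) as [v [A [B [K [X [_ C]]]]]].
      rewrite K in I. destruct I as [<-|[]]. rewrite C. apply H in X.
      apply types_ok_scons; [apply types_ok_upd; auto; intros A' EA;
        apply Some_inj in EA; subst|]; eapply HS; try apply X; constructor.
    + destruct (case_inv t _ _ _ R Et Ep) as [v [w [A [B [K [X [_ [C1 [_ C2]]]]]]]]].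
      rewrite K in I. apply H in X. destruct I as [<-|[<-|[]]]; rewrite ?C1, ?C2;
        apply types_ok_upd; auto; intros A' EA;
        apply Some_inj in EA; subst; eapply HS; try apply X; constructor.
    + destruct (cut_inv t _ _ R Et Ep) as
        [v [w [G1 [G2 [A [B [K [TA [TB [D [_ [_ [C1 [_ C2]]]]]]]]]]]]]].
      rewrite K in I. apply types_ok_disj in D as [D1 D2]; auto.
      destruct I as [<-|[<-|[]]]; rewrite ?C1, ?C2; apply types_ok_scons; auto.
    + exfalso. unfold node_ok in R. unfold nproc, ntag in *.
      destruct (label t) as [[P0 G0] r0]; simpl in *; subst.
      inversion R; subst. destruct (kids t); try discriminate; auto.
    + exfalso. unfold node_ok in R. unfold nproc, ntag in *.
      destruct (label t) as [[P0 G0] r0]; simpl in *; subst.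
      inversion R; subst. destruct (kids t); try discriminate; auto.
    + destruct (out_inv t _ _ _ R Et Ep) as
        [v [w [G1 [G2 [A [B [K [X [D [_ [C1 [_ C2]]]]]]]]]]]].
      rewrite K in I. apply types_ok_disj in D as [D1 D2];
        [|apply types_ok_upd; auto; discriminate]. apply H in X.
      destruct I as [<-|[<-|[]]]; rewrite ?C1, ?C2;
        [apply types_ok_scons|apply types_ok_upd]; auto; intros;
        repeat match goal with EA : Some _ = Some _ |- _ =>
          apply Some_inj in EA; subst end; eapply HS; try apply X; constructor.
    + destruct (sel_inv t _ _ _ R Et Ep) as [v [A [B [K [X [_ C]]]]]].
      rewrite K in I. destruct I as [<-|[]]. rewrite C. apply H in X.
      apply types_ok_upd; auto. intros A' EA. apply Some_inj in EA. subst.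
      eapply HS; try apply X. destruct i; constructor.
  - destruct (fix_inv t x R Et) as [v [A [B [K [X [U [_ C]]]]]]].
    rewrite K in I. destruct I as [<-|[]]. rewrite C. apply types_ok_upd; auto.
    intros A' EA. apply Some_inj in EA. subst. apply H in X.
    eapply HS; [apply unfolds_tstep, U|auto].
Qed.

Definition valid (t : tree tlabel) : Prop :=
  forall f p, branch t f p -> valid_thread f p.

Record tree_ok (t : tree tlabel) : Prop := {
  ok_local : locally_correct (trule E) t;
  ok_valid : valid t;
  ok_types : types_ok (nctx t) }.

Lemma tree_ok_node t : tree_ok t -> node_ok t.
Proof. intros [L _ _]. apply L. constructor. Qed.

Lemma inf_often_shift {X} (g : nat -> X) C :
  inf_often (fun i => g (S i)) C <-> inf_often g C.
Proof.
  split; intros H n.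
  - destruct (H n) as [m [Hm Em]]. exists (S m). split; [lia|auto].
  - destruct (H (S n)) as [[|m] [Hm Em]]; [lia|]. exists m. split; [lia|auto].
Qed.

Lemma inf_min_is_shift Q g : inf_min_is Q g -> inf_min_is Q (fun i => g (S i)).
Proof.
  intros [C [IO [HQ Min]]]. exists C. split; [|split]; auto.
  - apply inf_often_shift; auto.
  - intros D HD. apply Min. apply inf_often_shift; auto.
Qed.

Lemma valid_kid t i u : nth_error (kids t) i = Some u -> valid t -> valid u.
Proof.
  intros Hi Hv f p [B0 B].
  set (f' n := match n with 0 => t | S n => f n end).
  set (p' n := match n with 0 => i | S n => p n end).
  destruct (Hv f' p') as [n0 [x [T1 [T2 [T3 T4]]]]].
  { split; auto. intros [|n]; simpl; auto. rewrite B0; auto. }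
  exists (pred n0), (fun n => x (S n)). split; [|split; [|split]].
  - intros n Hn. apply (T1 (S n)). lia.
  - intros n Hn. apply (T2 (S n)). lia.
  - apply inf_min_is_shift in T3. exact T3.
  - intros n. destruct (T4 (S n)) as [[|m] [H1 [H2 H3]]]; [lia|].
    exists m. split; [lia|split; [lia|exact H3]].
Qed.

Lemma tree_ok_kid t i u : nth_error (kids t) i = Some u -> tree_ok t -> tree_ok u.
Proof.
  intros Hi T. destruct T as [L Va Ty]. assert (I := nth_error_In _ _ Hi).
  constructor.
  - eapply locally_correct_kid; eauto.
  - eapply valid_kid; eauto.
  - eapply types_ok_kid; eauto. apply L. constructor.
Qed.

Inductive fixes : tree tlabel -> tree tlabel -> Prop :=
| fixes_refl t : fixes t t
| fixes_step t u v x : ntag t = RFix x -> kids t = [u] -> fixes u v -> fixes t v.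

Lemma no_slow_descent (h : nat -> nat) N :
  (forall i, N <= i -> h (S i) <= h i) ->
  (forall n, exists m, n <= m /\ N <= m /\ h (S m) < h m) -> False.
Proof.
  intros Hle Hlt.
  assert (K : forall v i, N <= i -> h i <= v -> False); [|eapply (K (h N) N); auto].
  assert (Mono : forall i d, N <= i -> h (i + d) <= h i).
  { intros i d Hi. induction d.
    - rewrite Nat.add_0_r; auto.
    - replace (i + S d) with (S (i + d)) by lia.
      specialize (Hle (i + d)). lia. }
  induction v; intros i Hi Hv; destruct (Hlt i) as [m [Hm [Hm' L]]];
    pose proof (Mono i (m - i) Hi) as M; replace (i + (m - i)) with m in M by lia.
  - lia.
  - apply (IHv (S m)); lia.
Qed.

(** An endless chain of unfolding rules would be a branch whose valid thread stays on one channel.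
    Unfoldings of that channel lower its [lead], since types are guarded, and unfoldings of other
    channels leave it alone; yet the thread is unfolded infinitely often. *)
Lemma fixes_terminate t : tree_ok t -> exists v, fixes t v /\ ntag v = RAx.
Proof.
  intros T. apply NNPP. intros N.
  set (bad u := tree_ok u /\ ~ exists v, fixes u v /\ ntag v = RAx).
  set (next u v := kids u = [v] /\ exists x A B, ntag u = RFix x /\
    nctx u x = Some A /\ unfolds A B /\ nctx v = upd (nctx u) x (Some B)).
  destruct (dependent_choice bad next) with (x0 := t) as [f [E0 Hf]].
  - intros u [Tu Nu]. destruct (ntag u) as [|x] eqn:Eu.
    + exfalso; apply Nu. exists u. split; auto. constructor.
    + destruct (fix_inv u x) as [v [A [B [K [X [U [_ C]]]]]]]; auto.
      { apply tree_ok_node; auto. }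
      exists v. split.
      * split.
        -- eapply (tree_ok_kid u 0); auto. rewrite K; auto.
        -- intros [w [Fw Tw]]. apply Nu. exists w. split; auto.
           eapply fixes_step; eauto.
      * split; auto. exists x, A, B. auto.
  - split; auto.
  - destruct (ok_valid _ T f (fun _ => 0)) as [n0 [x [T1 [T2 [_ T4]]]]].
    { split; auto. intros n. destruct (Hf n) as [_ [K _]]. rewrite K; auto. }
    assert (Cx : forall i, n0 <= i -> x (S i) = x i).
    { intros i Hi. rewrite T2; auto. destruct (Hf i) as [_ [_ [y [A [B [Ty _]]]]]].
      unfold cshift. unfold ntag in Ty. rewrite Ty. auto. }
    apply (no_slow_descent (fun i => lead (type_or_0 (nctx (f i) (x i)))) n0).
    + intros i Hi. rewrite Cx; auto.
      destruct (Hf i) as [[Ti _] [K [y [A [B [Ty [X [U C]]]]]]]].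
      rewrite C. unfold upd. destruct (Nat.eqb_spec (x i) y); auto.
      subst y. rewrite X. simpl. apply Nat.lt_le_incl, lead_unfolds; auto.
      eapply (ok_types _ Ti); eauto.
    + intros n. destruct (T4 n) as [m [H1 [H2 [H3 _]]]].
      exists m. split; auto. split; auto. rewrite Cx; auto.
      destruct (Hf m) as [[Tm _] [K [y [A [B [Ty [X [U C]]]]]]]].
      assert (x m = y) by (unfold ntag in Ty; rewrite H3 in Ty; congruence). subst y.
      rewrite C. unfold upd. rewrite Nat.eqb_refl, X. simpl.
      apply lead_unfolds; auto. eapply (ok_types _ Tm); eauto.
Qed.

End Derivations.

(** * Nets of session endpoints *)

(** An endpoint is a session identifier with one of its two sides; a node of a net
    is the set of endpoints it owns. *)
Definition eps := nat -> bool -> Prop.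

Definition apart (X Y : eps) : Prop := forall s b, X s b -> Y s b -> False.
Definition bounded (nx : nat) (X : eps) : Prop := forall s b, X s b -> s < nx.

Fixpoint pairwise {T} (R : T -> T -> Prop) (l : list T) : Prop :=
  match l with
  | [] => True
  | x :: l => (forall y, In y l -> R x y) /\ pairwise R l
  end.

Lemma pairwise_app {T} (R : T -> T -> Prop) l1 l2 :
  pairwise R (l1 ++ l2) <->
  pairwise R l1 /\ pairwise R l2 /\ forall x y, In x l1 -> In y l2 -> R x y.
Proof.
  induction l1 as [|a l1 IH]; simpl.
  - split; [intros H; repeat split; tauto|tauto].
  - rewrite IH. split.
    + intros [H [H1 [H2 H3]]]. repeat split; auto.
      * intros y Hy. apply H. apply in_or_app; auto.
      * intros x y [<-|Hx] Hy; auto. apply H. apply in_or_app; auto.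
    + intros [[H H1] [H2 H3]]. repeat split; auto.
      intros y Hy. apply in_app_or in Hy as [Hy|Hy]; auto.
Qed.

Lemma pairwise_perm {T} (R : T -> T -> Prop) l l' :
  (forall x y, R x y -> R y x) -> Permutation l l' -> pairwise R l -> pairwise R l'.
Proof.
  intros Sym P. induction P; simpl; auto.
  - intros [H H1]. split; auto. intros y Hy. apply H.
    eapply Permutation_in; [symmetry|]; eauto.
  - intros [H [H1 H2]]. repeat split; auto.
    intros z [<-|Hz]; auto.
Qed.

(** Local changes of a net; the last two arguments are the session that is used up
    and the next free identifier. *)
Inductive eact (nx : nat) : list eps -> list eps -> option nat -> nat -> Prop :=
| ea_same X Y : (forall s b, Y s b <-> X s b) -> eact nx [X] [Y] None nx
| ea_cut X X1 X2 Y1 Y2 :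
    (forall s b, X s b <-> X1 s b \/ X2 s b) -> apart X1 X2 ->
    (forall s b, Y1 s b <-> (s = nx /\ b = true) \/ X1 s b) ->
    (forall s b, Y2 s b <-> (s = nx /\ b = false) \/ X2 s b) ->
    eact nx [X] [Y1; Y2] None (S nx)
| ea_close s0 b0 X1 X2 Y :
    (forall s b, X1 s b <-> s = s0 /\ b = b0) -> X2 s0 (negb b0) ->
    (forall s b, Y s b <-> X2 s b /\ s <> s0) ->
    eact nx [X1; X2] [Y] (Some s0) nx
| ea_comm s0 b0 X1 X2 Z1 Z2 Y1 Y2 Y3 :
    (forall s b, X1 s b <-> (s = s0 /\ b = b0) \/ Z1 s b \/ Z2 s b) ->
    apart Z1 Z2 -> (forall b, ~ Z1 s0 b /\ ~ Z2 s0 b) -> X2 s0 (negb b0) ->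
    (forall s b, Y1 s b <-> (s = nx /\ b = b0) \/ Z1 s b) ->
    (forall s b, Y2 s b <-> (s = S nx /\ b = b0) \/ Z2 s b) ->
    (forall s b, Y3 s b <-> ((s = nx \/ s = S nx) /\ b = negb b0) \/ (X2 s b /\ s <> s0)) ->
    eact nx [X1; X2] [Y1; Y2; Y3] (Some s0) (S (S nx))
| ea_sel s0 b0 X1 X2 Y1 Y2 :
    X1 s0 b0 -> X2 s0 (negb b0) ->
    (forall s b, Y1 s b <-> (s = nx /\ b = b0) \/ (X1 s b /\ s <> s0)) ->
    (forall s b, Y2 s b <-> (s = nx /\ b = negb b0) \/ (X2 s b /\ s <> s0)) ->
    eact nx [X1; X2] [Y1; Y2] (Some s0) (S nx).

Lemma eact_next nx a b ev nx' : eact nx a b ev nx' -> nx <= nx'.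
Proof. destruct 1; auto. Qed.

Lemma eact_origin nx a b ev nx' Y s bb : eact nx a b ev nx' -> In Y b -> Y s bb ->
  (exists X, In X a /\ X s bb /\ ev <> Some s) \/ (nx <= s < nx').
Proof.
  destruct 1; simpl; intros I HY; repeat (destruct I as [<-|I]); try tauto;
    match goal with
    | H : forall s b, ?Y s b <-> _, HY : ?Y _ _ |- _ => apply H in HY
    end.
  - left. exists X. split; auto. split; auto. discriminate.
  - destruct HY as [[-> _]|HY]; [right; lia|].
    left. exists X. split; auto. split; [apply H; auto|discriminate].
  - destruct HY as [[-> _]|HY]; [right; lia|].
    left. exists X. split; auto. split; [apply H; auto|discriminate].
  - left. exists X2. split; [auto|]. split; [tauto|]. intros E; injection E. intuition.
  - destruct HY as [[-> _]|HY]; [right; lia|]. left. exists X1.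
    split; auto. split; [apply H; auto|]. intros E; injection E as ->.
    destruct (H1 bb); auto.
  - destruct HY as [[-> _]|HY]; [right; lia|]. left. exists X1.
    split; auto. split; [apply H; auto|]. intros E; injection E as ->.
    destruct (H1 bb); auto.
  - destruct HY as [[? _]|[HY N]]; [right; lia|]. left. exists X2.
    split; auto. split; auto. intros E; injection E; auto.
  - destruct HY as [[-> _]|[HY N]]; [right; lia|]. left. exists X1.
    split; auto. split; auto. intros E; injection E; auto.
  - destruct HY as [[-> _]|[HY N]]; [right; lia|]. left. exists X2.
    split; auto. split; auto. intros E; injection E; auto.
Qed.

Lemma eact_apart nx a b ev nx' : eact nx a b ev nx' ->
  (forall X, In X a -> bounded nx X) -> pairwise apart a -> pairwise apart b.
Proof.
  destruct 1; simpl; intros Bd Ap; repeat split; try tauto;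
    intros Y' I; repeat (destruct I as [<-|I]); try tauto; intros s b' HX HY.
  - assert (BX := Bd X (or_introl eq_refl)).
    assert (B1 : X1 s b' -> s < nx) by (intros; apply (BX s b'), H; auto).
    assert (B2 : X2 s b' -> s < nx) by (intros; apply (BX s b'), H; auto).
    apply H1 in HX. apply H2 in HY.
    destruct HX as [[-> ->]|HX], HY as [[Es Eb]|HY]; try subst s; try congruence;
      [apply B2 in HY; lia|apply B1 in HX; lia|eapply H0; eauto].
  - assert (BX := Bd X1 (or_introl eq_refl)).
    assert (B1 : Z1 s b' -> s < nx) by (intros; apply (BX s b'), H; auto).
    assert (B2 : Z2 s b' -> s < nx) by (intros; apply (BX s b'), H; auto).
    apply H3 in HX. apply H4 in HY.
    destruct HX as [[-> ->]|HX], HY as [[Es Eb]|HY]; try subst s; try lia;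
      [apply B2 in HY; lia|apply B1 in HX; lia|eapply H0; eauto].
  - assert (BX := Bd X1 (or_introl eq_refl)).
    assert (B1 : Z1 s b' -> s < nx) by (intros; apply (BX s b'), H; auto).
    assert (B2 := Bd X2 (or_intror (or_introl eq_refl)) s b').
    apply H3 in HX. apply H5 in HY.
    destruct HX as [[-> ->]|HX], HY as [[Es Eb]|[HY N]]; try (destruct b0; discriminate);
      [apply B2 in HY; lia|apply B1 in HX; lia|].
    destruct Ap as [Ap _]. apply (Ap X2 (or_introl eq_refl) s b'); auto. apply H; auto.
  - assert (BX := Bd X1 (or_introl eq_refl)).
    assert (B1 : Z2 s b' -> s < nx) by (intros; apply (BX s b'), H; auto).
    assert (B2 := Bd X2 (or_intror (or_introl eq_refl)) s b').
    apply H4 in HX. apply H5 in HY.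
    destruct HX as [[-> ->]|HX], HY as [[Es Eb]|[HY N]]; try (destruct b0; discriminate);
      [apply B2 in HY; lia|apply B1 in HX; lia|].
    destruct Ap as [Ap _]. apply (Ap X2 (or_introl eq_refl) s b'); auto. apply H; auto.
  - assert (B1 := Bd X1 (or_introl eq_refl) s b').
    assert (B2 := Bd X2 (or_intror (or_introl eq_refl)) s b').
    apply H1 in HX. apply H2 in HY.
    destruct HX as [[-> ->]|[HX M]], HY as [[Es Eb]|[HY N]];
      try (destruct b0; discriminate);
      [apply B2 in HY; lia|apply B1 in HX; lia|].
    destruct Ap as [Ap _]. apply (Ap X2 (or_introl eq_refl) s b'); auto.
Qed.

(** An orientation chooses for each session the side where some point of the net
    lies; [away O X]: that point is reached from [X] by leaving through an endpoint. *)
Definition away (O : nat -> bool) (X : eps) : Prop :=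
  exists s b, X s b /\ O s = negb b.

Definition oupd (O : nat -> bool) (s : nat) (b : bool) : nat -> bool :=
  fun t => if Nat.eqb t s then b else O t.

Lemma oupd_eq O s b : oupd O s b s = b.
Proof. unfold oupd. rewrite Nat.eqb_refl; auto. Qed.

Lemma oupd_lt O s b t : t < s -> oupd O s b t = O t.
Proof. unfold oupd. intros. destruct (Nat.eqb_spec t s); auto; lia. Qed.

Lemma away_oupd O s b (X : eps) c : X s c -> b = negb c -> away (oupd O s b) X.
Proof. intros HX ->. exists s, c. rewrite oupd_eq; auto. Qed.

Lemma away_oupd2 O s b b' (X : eps) c : X s c -> b = negb c ->
  away (oupd (oupd O s b) (S s) b') X.
Proof. intros HX ->. exists s, c. rewrite oupd_lt, oupd_eq; auto. Qed.

Lemma away_ext O O' (X : eps) : (forall s b, X s b -> O' s = O s) ->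
  away O X -> away O' X.
Proof. intros H [s [b [HX E]]]. exists s, b. rewrite (H s b); auto. Qed.

Lemma away_incl O (X Y : eps) : (forall s b, X s b -> Y s b) -> away O X -> away O Y.
Proof. intros H [s [b [HX E]]]. exists s, b. auto. Qed.

(** The results of an action are joined to each other by the sessions it creates, so it suffices to
    orient these toward the chosen result [d]. *)
Lemma eact_point_inside nx a b ev nx' : eact nx a b ev nx' ->
  forall l1 d l2, b = l1 ++ d :: l2 ->
  forall O, exists O', (forall s, s < nx -> O' s = O s) /\
    forall X, In X (l1 ++ l2) -> away O' X.
Proof.
  destruct 1; intros l1 d l2 E O;
    destruct l1 as [|? [|? [|? [|? ?]]]]; simpl in E; try discriminate; injection E; intros;
    subst; simpl.
  - exists O. split; auto; tauto.
  - exists (oupd O nx true).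
    split; [intros; apply oupd_lt; auto|].
    intros ? [<-|[]]. eapply away_oupd; [apply H2; auto|auto].
  - exists (oupd O nx false).
    split; [intros; apply oupd_lt; auto|].
    intros ? [<-|[]]. eapply away_oupd; [apply H1; auto|auto].
  - exists O. split; auto; tauto.
  - exists (oupd (oupd O nx b0) (S nx) (negb b0)).
    split; [intros; rewrite !oupd_lt; auto|].
    intros ? [<-|[<-|[]]].
    + eapply away_oupd; [apply H4; auto|auto].
    + eapply away_oupd2; [apply H5; auto|destruct b0; auto].
  - exists (oupd (oupd O nx (negb b0)) (S nx) b0).
    split; [intros; rewrite !oupd_lt; auto|].
    intros ? [<-|[<-|[]]].
    + eapply away_oupd2; [apply H3; auto|auto].
    + eapply away_oupd; [apply H5; auto|destruct b0; auto].
  - exists (oupd (oupd O nx (negb b0)) (S nx) (negb b0)).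
    split; [intros; rewrite !oupd_lt; auto|].
    intros ? [<-|[<-|[]]].
    + eapply away_oupd2; [apply H3; auto|auto].
    + eapply away_oupd; [apply H4; auto|auto].
  - exists (oupd O nx b0).
    split; [intros; rewrite !oupd_lt; auto|].
    intros ? [<-|[]]. eapply away_oupd; [apply H2; auto|destruct b0; auto].
  - exists (oupd O nx (negb b0)).
    split; [intros; rewrite !oupd_lt; auto|].
    intros ? [<-|[]]. eapply away_oupd; [apply H1; auto|destruct b0; auto].
Qed.

(** Two acting components cannot both leave through the session they share, so some old endpoint
    leads outside. The created sessions are oriented toward the result that inherits this
    endpoint. *)
Lemma eact_point_outside nx a b ev nx' : eact nx a b ev nx' ->
  (forall X, In X a -> bounded nx X) -> pairwise apart a ->
  forall O, (forall X, In X a -> away O X) ->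
  exists O', (forall s, s < nx -> O' s = O s) /\ forall X, In X b -> away O' X.
Proof.
  destruct 1; simpl; intros Bd Ap O Aw.
  - exists O. split; auto. intros ? [<-|[]].
    apply (away_incl _ X); [intros; apply H; auto|auto].
  - assert (BX := Bd X (or_introl eq_refl)).
    destruct (Aw X) as [s [b [HX E]]]; auto.
    assert (s < nx) by (eapply BX; eauto).
    apply H in HX as [HX|HX].
    + exists (oupd O nx true). split; [intros; apply oupd_lt; auto|].
      intros ? [<-|[<-|[]]].
      * exists s, b. rewrite oupd_lt; auto. split; auto. apply H1; auto.
      * eapply away_oupd; [apply H2; auto|auto].
    + exists (oupd O nx false). split; [intros; apply oupd_lt; auto|].
      intros ? [<-|[<-|[]]].
      * eapply away_oupd; [apply H1; auto|auto].
      * exists s, b. rewrite oupd_lt; auto. split; auto. apply H2; auto.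
  - exists O. split; auto. intros ? [<-|[]].
    destruct (Aw X1) as [s1 [b1 [HX1 E1]]]; auto. apply H in HX1 as [-> ->].
    destruct (Aw X2) as [s [b [HX E]]]; auto.
    exists s, b. split; auto. apply H1. split; auto. intros ->.
    destruct Ap as [Ap _].
    apply (Ap X2 (or_introl eq_refl) s0 b); auto.
    apply H. split; auto. destruct b, b0; simpl in *; congruence.
  - assert (BX1 := Bd X1 (or_introl eq_refl)).
    assert (BX2 := Bd X2 (or_intror (or_introl eq_refl))).
    assert (K1 := Aw X1 (or_introl eq_refl)).
    assert (K2 := Aw X2 (or_intror (or_introl eq_refl))).
    destruct K1 as [s [b [HX E]]].
    assert (s < nx) by (eapply BX1; eauto).
    apply H in HX as [[-> ->]|[HX|HX]].
    + exists (oupd (oupd O nx (negb b0)) (S nx) (negb b0)).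
      split; [intros; rewrite !oupd_lt; auto|].
      intros ? [<-|[<-|[<-|[]]]].
      * eapply away_oupd2; [apply H3; auto|auto].
      * eapply away_oupd; [apply H4; auto|auto].
      * destruct K2 as [s2 [b2 [HX2 E2]]].
        assert (s2 < nx) by (eapply BX2; eauto).
        exists s2, b2. rewrite !oupd_lt; auto. split; auto. apply H5. right.
        split; auto. intros ->. destruct Ap as [Ap _].
        apply (Ap X2 (or_introl eq_refl) s0 b2); auto.
        apply H. left. split; auto. destruct b2, b0; simpl in *; congruence.
    + exists (oupd (oupd O nx b0) (S nx) (negb b0)).
      split; [intros; rewrite !oupd_lt; auto|].
      intros ? [<-|[<-|[<-|[]]]].
      * exists s, b. rewrite !oupd_lt; auto. split; auto. apply H3; auto.
      * eapply away_oupd; [apply H4; auto|auto].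
      * eapply away_oupd2; [apply H5; auto|destruct b0; auto].
    + exists (oupd (oupd O nx (negb b0)) (S nx) b0).
      split; [intros; rewrite !oupd_lt; auto|].
      intros ? [<-|[<-|[<-|[]]]].
      * eapply away_oupd2; [apply H3; auto|auto].
      * exists s, b. rewrite !oupd_lt; auto. split; auto. apply H4; auto.
      * eapply away_oupd; [apply H5; auto|destruct b0; auto].
  - assert (BX1 := Bd X1 (or_introl eq_refl)).
    assert (BX2 := Bd X2 (or_intror (or_introl eq_refl))).
    assert (K1 := Aw X1 (or_introl eq_refl)).
    assert (K2 := Aw X2 (or_intror (or_introl eq_refl))).
    destruct K1 as [s [b [HX E]]].
    assert (s < nx) by (eapply BX1; eauto).
    destruct (Nat.eq_dec s s0) as [->|N].
    + exists (oupd O nx (negb b0)).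
      split; [intros; rewrite !oupd_lt; auto|].
      intros ? [<-|[<-|[]]].
      * eapply away_oupd; [apply H1; auto|auto].
      * destruct K2 as [s2 [b2 [HX2 E2]]].
        assert (s2 < nx) by (eapply BX2; eauto).
        exists s2, b2. rewrite !oupd_lt; auto. split; auto. apply H2. right.
        split; auto. intros ->. destruct Ap as [Ap _].
        apply (Ap X2 (or_introl eq_refl) s0 b2); auto.
        replace b2 with b; auto. destruct b, b2; simpl in *; congruence.
    + exists (oupd O nx b0).
      split; [intros; rewrite !oupd_lt; auto|].
      intros ? [<-|[<-|[]]].
      * exists s, b. rewrite !oupd_lt; auto. split; auto. apply H1; auto.
      * eapply away_oupd; [apply H2; auto|destruct b0; auto].
Qed.

(** * Nets of typing derivations *)

(** A component runs the process at a node of a typing derivation; its channels are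
    mapped to sessions and sides. *)
Record comp := { ct : tree tlabel; cn : nat -> nat; cs : nat -> bool }.

Definition owns (G : ctx) (f : nat -> nat) (g : nat -> bool) : eps :=
  fun s b => exists z, G z <> None /\ f z = s /\ g z = b.
Definition ceps (c : comp) : eps := owns (nctx (ct c)) (cn c) (cs c).

Definition sep (G : ctx) (f : nat -> nat) (g : nat -> bool) : Prop :=
  forall z1 z2, G z1 <> None -> G z2 <> None -> f z1 = f z2 -> g z1 = g z2 -> z1 = z2.

Definition fcons {X : Type} (x : X) (f : nat -> X) : nat -> X :=
  fun k => match k with 0 => x | S k => f k end.
(** Redirecting by session and not by channel makes this a renaming applied after [f], which is the
    form the simulation composes with. Among the channels of a context only the one in use is
    affected, by [partner_session]. *)
Definition rn (s s' : nat) (f : nat -> nat) : nat -> nat :=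
  fun z => if Nat.eqb (f z) s then s' else f z.

Lemma upd_eq G x o : upd G x o x = o.
Proof. unfold upd. rewrite Nat.eqb_refl; auto. Qed.

Lemma owns_scons A G s0 f b0 g s b :
  owns (scons (Some A) G) (fcons s0 f) (fcons b0 g) s b <->
  (s = s0 /\ b = b0) \/ owns G f g s b.
Proof.
  split.
  - intros [[|z] [H1 [H2 H3]]]; simpl in *; auto. right. exists z; auto.
  - intros [[-> ->]|[z [H1 [H2 H3]]]].
    + exists 0. simpl. repeat split; auto; discriminate.
    + exists (S z). auto.
Qed.

Lemma owns_same G G' f g s b : (forall z, G z <> None <-> G' z <> None) ->
  owns G f g s b <-> owns G' f g s b.
Proof. intros H. split; intros [z [H1 H2]]; exists z; split; auto; apply H; auto. Qed.

Lemma upd_some_dom G x A B : G x = Some A ->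
  forall z, upd G x (Some B) z <> None <-> G z <> None.
Proof.
  intros E z. unfold upd. destruct (Nat.eqb_spec z x); [subst|tauto].
  rewrite E. split; discriminate.
Qed.

Lemma owns_disj G G1 G2 f g s b : disj_union G G1 G2 ->
  owns G f g s b <-> owns G1 f g s b \/ owns G2 f g s b.
Proof.
  intros D. split.
  - intros [z [H1 H2]]. destruct (D z) as [[D1 D2]|[D1 D2]]; rewrite D2 in H1;
      [right|left]; exists z; auto.
  - intros [[z [H1 H2]]|[z [H1 H2]]]; exists z; split; auto;
      destruct (D z) as [[D1 D2]|[D1 D2]]; congruence.
Qed.

Lemma sep_disj_apart G G1 G2 f g : disj_union G G1 G2 -> sep G f g ->
  apart (owns G1 f g) (owns G2 f g).
Proof.
  intros D S s b [z1 [H1 [E1 F1]]] [z2 [H2 [E2 F2]]].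
  assert (z1 = z2).
  { apply S; try congruence;
      [destruct (D z1) as [[D1 D2]|[D1 D2]]|destruct (D z2) as [[D1 D2]|[D1 D2]]];
      congruence. }
  subst z2. destruct (D z1) as [[D1 D2]|[D1 D2]]; congruence.
Qed.

Lemma sep_incl G G' f g : (forall z, G' z <> None -> G z <> None) ->
  sep G f g -> sep G' f g.
Proof. intros H S z1 z2 H1 H2. apply S; auto. Qed.

Lemma sep_disj G G1 G2 f g : disj_union G G1 G2 -> sep G f g ->
  sep G1 f g /\ sep G2 f g.
Proof.
  intros D S. split; revert S; apply sep_incl; intros z Hz;
    destruct (D z) as [[D1 D2]|[D1 D2]]; congruence.
Qed.

Lemma sep_scons o G f g s0 b0 : (forall z, f z <> s0) -> sep G f g ->
  sep (scons o G) (fcons s0 f) (fcons b0 g).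
Proof.
  intros F S [|z1] [|z2]; simpl; intros H1 H2 E1 E2; auto.
  - exfalso; eapply F; eauto.
  - exfalso; eapply F; eauto.
Qed.

Lemma sep_upd_none G x f g : sep G f g -> sep (upd G x None) f g.
Proof.
  apply sep_incl. intros z. unfold upd. destruct (Nat.eqb z x); tauto.
Qed.

(* [G] is the context without the renamed channel [x]. *)
Lemma sep_rn G x o f g s' :
  G x = None -> (forall z, G z <> None -> f z <> f x) -> (forall z, f z <> s') ->
  sep G f g -> sep (upd G x o) (rn (f x) s' f) g.
Proof.
  intros N Ne F S z1 z2. unfold upd, rn.
  destruct (Nat.eqb_spec z1 x), (Nat.eqb_spec z2 x); intros H1 H2; try (intros; congruence).
  - subst z1. rewrite Nat.eqb_refl.
    destruct (Nat.eqb_spec (f z2) (f x)) as [e|e]; [exfalso; apply (Ne z2); auto|].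
    intros Eq; exfalso; apply (F z2); auto.
  - subst z2. rewrite Nat.eqb_refl.
    destruct (Nat.eqb_spec (f z1) (f x)) as [e|e]; [exfalso; apply (Ne z1); auto|].
    intros Eq; exfalso; apply (F z1); auto.
  - destruct (Nat.eqb_spec (f z1) (f x)) as [e|e]; [exfalso; apply (Ne z1); auto|].
    destruct (Nat.eqb_spec (f z2) (f x)) as [e'|e']; [exfalso; apply (Ne z2); auto|].
    apply S; auto.
Qed.

Lemma owns_rn G x A f g s' s b :
  G x = None -> (forall z, G z <> None -> f z <> f x) ->
  owns (upd G x (Some A)) (rn (f x) s' f) g s b <->
  (s = s' /\ b = g x) \/ owns G f g s b.
Proof.
  intros N Ne. split.
  - intros [z [H1 [H2 H3]]]. unfold upd, rn in *.
    destruct (Nat.eqb_spec z x).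
    + subst z. rewrite Nat.eqb_refl in H2. auto.
    + destruct (Nat.eqb_spec (f z) (f x)); [exfalso; apply (Ne z); auto|].
      right. exists z; auto.
  - intros [[-> ->]|[z [H1 [H2 H3]]]].
    + exists x. unfold upd, rn. rewrite !Nat.eqb_refl. repeat split; auto; discriminate.
    + exists z. unfold upd, rn. destruct (Nat.eqb_spec z x); [congruence|].
      destruct (Nat.eqb_spec (f z) (f x)); [exfalso; apply (Ne z); auto|]. auto.
Qed.

Lemma owns_upd_none G x f g s b :
  (forall z, G z <> None -> z <> x -> f z <> f x) ->
  owns (upd G x None) f g s b <-> owns G f g s b /\ s <> f x.
Proof.
  intros Ne. split.
  - intros [z [H1 [H2 H3]]]. unfold upd in H1.
    destruct (Nat.eqb_spec z x); [congruence|]. split.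
    + exists z; auto.
    + subst s. apply Ne; auto.
  - intros [[z [H1 [H2 H3]]] N]. exists z. unfold upd.
    destruct (Nat.eqb_spec z x); [congruence|auto].
Qed.

(** Communication and selection retire their session and go on with fresh identifiers. A session is
    thus used at most once, so that one [kind] describes its whole life; the new endpoints inherit
    the sides of the old ones. *)
Inductive act (nx : nat) : list comp -> list comp -> option (nat * kind) -> nat -> Prop :=
| act_fix c u x : ntag (ct c) = RFix x -> kids (ct c) = [u] ->
    act nx [c] [{| ct := u; cn := cn c; cs := cs c |}] None nx
| act_call c u a xs : ntag (ct c) = RAx -> nproc (ct c) = PCall a xs ->
    kids (ct c) = [u] ->
    act nx [c] [{| ct := u; cn := cn c; cs := cs c |}] None nx
| act_cut c u1 u2 P Q : ntag (ct c) = RAx -> nproc (ct c) = PCut P Q ->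
    kids (ct c) = [u1; u2] ->
    act nx [c] [{| ct := u1; cn := fcons nx (cn c); cs := fcons true (cs c) |};
                {| ct := u2; cn := fcons nx (cn c); cs := fcons false (cs c) |}]
      None (S nx)
| act_close c d x y P u :
    ntag (ct c) = RAx -> ntag (ct d) = RAx ->
    nproc (ct c) = PClose x -> nproc (ct d) = PWait y P -> kids (ct d) = [u] ->
    cn d y = cn c x -> cs d y = negb (cs c x) ->
    act nx [c; d] [{| ct := u; cn := cn d; cs := cs d |}] (Some (cn c x, KEnd)) nx
| act_comm c d x y P Q R u1 u2 u :
    ntag (ct c) = RAx -> ntag (ct d) = RAx ->
    nproc (ct c) = POut x P Q -> nproc (ct d) = PIn y R ->
    kids (ct c) = [u1; u2] -> kids (ct d) = [u] ->
    cn d y = cn c x -> cs d y = negb (cs c x) ->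
    act nx [c; d]
      [{| ct := u1; cn := fcons nx (cn c); cs := fcons (cs c x) (cs c) |};
       {| ct := u2; cn := rn (cn c x) (S nx) (cn c); cs := cs c |};
       {| ct := u; cn := fcons nx (rn (cn d y) (S nx) (cn d));
          cs := fcons (cs d y) (cs d) |}]
      (Some (cn c x, KTen nx (S nx))) (S (S nx))
| act_sel c d x y i P Q0 Q1 u u0 u1 :
    ntag (ct c) = RAx -> ntag (ct d) = RAx ->
    nproc (ct c) = PSel x i P -> nproc (ct d) = PCase y Q0 Q1 ->
    kids (ct c) = [u] -> kids (ct d) = [u0; u1] ->
    cn d y = cn c x -> cs d y = negb (cs c x) ->
    act nx [c; d]
      [{| ct := u; cn := rn (cn c x) nx (cn c); cs := cs c |};
       {| ct := if i then u1 else u0; cn := rn (cn d y) nx (cn d); cs := cs d |}]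
      (Some (cn c x, KSel i nx)) (S nx).

Section Nets.
Variable E : env.

Definition comp_ok (nx : nat) (c : comp) : Prop :=
  tree_ok E (ct c) /\ (forall z, cn c z < nx) /\ sep (nctx (ct c)) (cn c) (cs c).

Record net_ok (nx : nat) (L : list comp) (H : nat -> option kind) : Prop := {
  net_comp : forall c, In c L -> comp_ok nx c;
  net_apart : pairwise apart (map ceps L);
  net_alive : forall c s b, In c L -> ceps c s b -> H s = None;
  net_new : forall s, nx <= s -> H s = None }.

Lemma comp_ok_bounded nx c : comp_ok nx c -> bounded nx (ceps c).
Proof. intros [_ [B _]] s b [z [_ [<- _]]]. auto. Qed.

(** A second channel at the session in use would lie either on the same side, against [sep], or on
    the side owned by the partner, against [apart]. *)
Lemma partner_session c d x y nx : comp_ok nx c -> nctx (ct c) x <> None ->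
  nctx (ct d) y <> None -> apart (ceps c) (ceps d) ->
  cn d y = cn c x -> cs d y = negb (cs c x) ->
  forall z, nctx (ct c) z <> None -> z <> x -> cn c z <> cn c x.
Proof.
  intros [_ [_ S]] Hx Hy Ap En Es z Hz Nz Ez.
  destruct (Bool.bool_dec (cs c z) (cs c x)) as [Eb|Nb].
  - apply Nz. apply S; auto.
  - apply (Ap (cn c x) (negb (cs c x))).
    + exists z. repeat split; auto. destruct (cs c z), (cs c x); auto; congruence.
    + exists y. auto.
Qed.

Lemma apart_sym X Y : apart X Y -> apart Y X.
Proof. intros H s b HY HX. eapply H; eauto. Qed.

Ltac bnd :=
  intros z; unfold fcons, rn; try destruct z; simpl;
  repeat match goal with |- context [if ?b then _ else _] => destruct b end;
  try lia;
  match goal with H : forall z, cn ?c z < _ |- cn ?c ?z < _ => specialize (H z) end; lia.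

Lemma act_ok nx a b ev nx' : act nx a b ev nx' ->
  (forall c, In c a -> comp_ok nx c) -> pairwise apart (map ceps a) ->
  eact nx (map ceps a) (map ceps b) (option_map fst ev) nx' /\
  forall c, In c b -> comp_ok nx' c.
Proof.
  intros A Ok Ap. destruct A; simpl in Ok.
  - destruct (Ok c) as [T [B Sp]]; auto.
    destruct (fix_inv E (ct c) x) as [u' [A [B' [K [X [U [_ C]]]]]]]; auto.
    { apply tree_ok_node; auto. }
    assert (u' = u) by congruence. subst u'.
    split.
    + constructor. intros s b. unfold ceps; simpl. rewrite C.
      apply owns_same. eapply upd_some_dom; eauto.
    + intros d [<-|[]]. split; [|split]; simpl; auto.
      * apply (tree_ok_kid E (ct c) 0); auto. rewrite K; auto.
      * rewrite C. revert Sp. apply sep_incl. intros z. eapply upd_some_dom; eauto.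
  - destruct (Ok c) as [T [B Sp]]; auto.
    destruct (call_inv E (ct c) a xs) as [u' [K [_ [_ C]]]]; auto.
    { apply tree_ok_node; auto. }
    assert (u' = u) by congruence. subst u'.
    split.
    + constructor. intros s b. unfold ceps; simpl. rewrite C. tauto.
    + intros d [<-|[]]. split; [|split]; simpl; auto.
      * apply (tree_ok_kid E (ct c) 0); auto. rewrite K; auto.
      * rewrite C. auto.
  - destruct (Ok c) as [T [B Sp]]; auto.
    destruct (cut_inv E (ct c) P Q) as
      [v1 [v2 [G1 [G2 [A [A' [K [_ [_ [D [_ [_ [C1 [_ C2]]]]]]]]]]]]]]; auto.
    { apply tree_ok_node; auto. }
    assert (v1 = u1) by congruence. assert (v2 = u2) by congruence. subst v1 v2.
    split.
    + apply ea_cut with (X1 := owns G1 (cn c) (cs c)) (X2 := owns G2 (cn c) (cs c)).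
      * intros s b. apply owns_disj; auto.
      * eapply sep_disj_apart; eauto.
      * intros s b. unfold ceps; simpl. rewrite C1. apply owns_scons.
      * intros s b. unfold ceps; simpl. rewrite C2. apply owns_scons.
    + destruct (sep_disj _ _ _ _ _ D Sp) as [S1 S2].
      assert (F : forall z, cn c z <> nx) by (intros z; specialize (B z); lia).
      intros d [<-|[<-|[]]]; (split; [|split]); simpl; auto.
      * apply (tree_ok_kid E (ct c) 0); auto. rewrite K; auto.
      * bnd.
      * rewrite C1. apply sep_scons; auto.
      * apply (tree_ok_kid E (ct c) 1); auto. rewrite K; auto.
      * bnd.
      * rewrite C2. apply sep_scons; auto.
  - destruct (Ok c) as [T [B Sp]]; auto. destruct (Ok d) as [T' [B' S']]; auto.
    destruct (close_inv E (ct c) x) as [X C]; auto.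
    { apply tree_ok_node; auto. }
    destruct (wait_inv E (ct d) y P) as [u' [K [Y [_ C']]]]; auto.
    { apply tree_ok_node; auto. }
    assert (u' = u) by congruence. subst u'.
    destruct Ap as [Ap _]. specialize (Ap _ (or_introl eq_refl)).
    assert (Ne : forall z, nctx (ct d) z <> None -> z <> y -> cn d z <> cn d y).
    { apply (partner_session d c y x nx); auto; try congruence.
      - apply apart_sym; auto.
      - destruct (cs c x); rewrite H5; auto. }
    split.
    + apply ea_close with (b0 := cs c x).
      * intros s b. split.
        -- intros [z [Hz [E1 E2]]]. destruct (Nat.eq_dec z x) as [->|Nz]; auto.
           exfalso; auto.
        -- intros [-> ->]. exists x. repeat split; auto; congruence.
      * exists y. repeat split; auto; congruence.
      * intros s b. unfold ceps; simpl. rewrite C', <- H4. apply owns_upd_none; auto.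
    + intros e [<-|[]]. split; [|split]; simpl; auto.
      * apply (tree_ok_kid E (ct d) 0); auto. rewrite K; auto.
      * rewrite C'. apply sep_upd_none; auto.
  - destruct (Ok c) as [T [B Sp]]; auto. destruct (Ok d) as [T' [B' S']]; auto.
    destruct (out_inv E (ct c) x P Q) as
      [v1 [v2 [G1 [G2 [A1 [A2 [K [X [D [_ [C1 [_ C2]]]]]]]]]]]]; auto.
    { apply tree_ok_node; auto. }
    destruct (in_inv E (ct d) y R) as [v [A3 [A4 [K' [Y [_ C']]]]]]; auto.
    { apply tree_ok_node; auto. }
    assert (v1 = u1) by congruence. assert (v2 = u2) by congruence.
    assert (v = u) by congruence. subst v1 v2 v.
    destruct Ap as [Ap _]. specialize (Ap _ (or_introl eq_refl)).
    assert (Nc : forall z, nctx (ct c) z <> None -> z <> x -> cn c z <> cn c x).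
    { apply (partner_session c d x y nx); auto; congruence. }
    assert (Nd : forall z, nctx (ct d) z <> None -> z <> y -> cn d z <> cn d y).
    { apply (partner_session d c y x nx); auto; try congruence.
      - apply apart_sym; auto.
      - destruct (cs c x); rewrite H6; auto. }
    assert (S0 : sep (upd (nctx (ct c)) x None) (cn c) (cs c)) by (apply sep_upd_none; auto).
    destruct (sep_disj _ _ _ _ _ D S0) as [S1 S2].
    assert (Inc : forall z, G1 z <> None \/ G2 z <> None ->
                    nctx (ct c) z <> None /\ z <> x).
    { intros z Hz. assert (upd (nctx (ct c)) x None z <> None).
      { destruct (D z) as [[D1 D2]|[D1 D2]]; rewrite D2; tauto. }
      unfold upd in H7. destruct (Nat.eqb_spec z x); tauto. }
    assert (G2x : G2 x = None).
    { destruct (G2 x) eqn:Ex; auto. destruct (Inc x); [right; congruence|congruence]. }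
    split.
    + apply ea_comm with (b0 := cs c x)
        (Z1 := owns G1 (cn c) (cs c)) (Z2 := owns G2 (cn c) (cs c)).
      * intros s b. rewrite <- (owns_disj _ _ _ _ _ _ _ D).
        rewrite owns_upd_none; auto. split.
        -- intros Hs. destruct (Nat.eq_dec s (cn c x)); auto.
           destruct Hs as [z [Hz [Ez Fz]]]. left.
           destruct (Nat.eq_dec z x); [subst; auto|].
           exfalso; apply (Nc z); congruence.
        -- intros [[-> ->]|[Hs _]]; auto. exists x. repeat split; auto; congruence.
      * eapply sep_disj_apart; eauto.
      * intros b; split; intros [z [Hz [Ez _]]]; destruct (Inc z); auto;
          apply (Nc z); auto.
      * exists y. repeat split; auto; congruence.
      * intros s b. unfold ceps; simpl. rewrite C1. apply owns_scons.
      * intros s b. unfold ceps; simpl. rewrite C2. rewrite owns_rn; auto; [tauto|].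
        intros z Hz. destruct (Inc z); auto.
      * intros s b. unfold ceps; simpl. rewrite C', owns_scons.
        rewrite <- H5, <- H6.
        replace (upd (nctx (ct d)) y (Some A4)) with
          (upd (upd (nctx (ct d)) y None) y (Some A4)).
        2:{ extensionality k. unfold upd. destruct (Nat.eqb k y); auto. }
        rewrite owns_rn.
        -- fold (owns (nctx (ct d)) (cn d) (cs d) s b).
           rewrite owns_upd_none; auto. tauto.
        -- apply upd_eq.
        -- intros z Hz. unfold upd in Hz. destruct (Nat.eqb_spec z y); [congruence|].
           apply Nd; auto.
    + assert (F : forall z, cn c z <> nx) by (intros z; specialize (B z); lia).
      assert (F1 : forall z, cn c z <> S nx) by (intros z; specialize (B z); lia).
      assert (F' : forall z, cn d z <> nx) by (intros z; specialize (B' z); lia).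
      assert (F1' : forall z, cn d z <> S nx) by (intros z; specialize (B' z); lia).
      intros e [<-|[<-|[<-|[]]]]; (split; [|split]); simpl; auto.
      * apply (tree_ok_kid E (ct c) 0); auto. rewrite K; auto.
      * bnd.
      * rewrite C1. apply sep_scons; auto.
      * apply (tree_ok_kid E (ct c) 1); auto. rewrite K; auto.
      * bnd.
      * rewrite C2. apply sep_rn; auto. intros z Hz. destruct (Inc z); auto.
      * apply (tree_ok_kid E (ct d) 0); auto. rewrite K'; auto.
      * bnd.
      * rewrite C'.
        replace (upd (nctx (ct d)) y (Some A4)) with
          (upd (upd (nctx (ct d)) y None) y (Some A4)).
        2:{ extensionality k. unfold upd. destruct (Nat.eqb k y); auto. }
        apply sep_scons.
        -- intros z. unfold rn. destruct (Nat.eqb (cn d z) (cn d y)); auto.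
        -- apply sep_rn; auto.
           ++ apply upd_eq.
           ++ intros z Hz. unfold upd in Hz. destruct (Nat.eqb_spec z y); [congruence|].
              apply Nd; auto.
           ++ apply sep_upd_none; auto.
  - destruct (Ok c) as [T [B Sp]]; auto. destruct (Ok d) as [T' [B' S']]; auto.
    destruct (sel_inv E (ct c) x i P) as [v [A0 [A1 [K [X [_ C]]]]]]; auto.
    { apply tree_ok_node; auto. }
    destruct (case_inv E (ct d) y Q0 Q1) as
      [v0 [v1 [A2 [A3 [K' [Y [_ [C0 [_ C1]]]]]]]]]; auto.
    { apply tree_ok_node; auto. }
    assert (v = u) by congruence. assert (v0 = u0) by congruence.
    assert (v1 = u1) by congruence. subst v v0 v1.
    destruct Ap as [Ap _]. specialize (Ap _ (or_introl eq_refl)).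
    assert (Nc : forall z, nctx (ct c) z <> None -> z <> x -> cn c z <> cn c x).
    { apply (partner_session c d x y nx); auto; congruence. }
    assert (Nd : forall z, nctx (ct d) z <> None -> z <> y -> cn d z <> cn d y).
    { apply (partner_session d c y x nx); auto; try congruence.
      - apply apart_sym; auto.
      - destruct (cs c x); rewrite H6; auto. }
    (* The two participants of a selection are treated alike: each moves its channel to the fresh
       session and keeps its side. *)
    assert (Gen : forall c x o, (forall z, cn c z < nx) -> sep (nctx (ct c)) (cn c) (cs c) ->
      (forall z, nctx (ct c) z <> None -> z <> x -> cn c z <> cn c x) ->
      (forall A s b, owns (upd (nctx (ct c)) x (Some A)) (rn (cn c x) nx (cn c)) (cs c) s b <->
        (s = nx /\ b = cs c x) \/ (ceps c s b /\ s <> cn c x)) /\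
      sep (upd (nctx (ct c)) x o) (rn (cn c x) nx (cn c)) (cs c)).
    { clear. intros c x o B S N.
      assert (Eu : forall o, upd (nctx (ct c)) x o = upd (upd (nctx (ct c)) x None) x o).
      { intros o'. extensionality k. unfold upd. destruct (Nat.eqb k x); auto. }
      assert (N' : forall z, upd (nctx (ct c)) x None z <> None -> cn c z <> cn c x).
      { intros z Hz. unfold upd in Hz. destruct (Nat.eqb_spec z x); [congruence|].
        apply N; auto. }
      split.
      - intros A s b. rewrite Eu, owns_rn; auto; [|apply upd_eq].
        rewrite owns_upd_none; auto. tauto.
      - rewrite Eu. apply sep_rn; auto; [apply upd_eq| |apply sep_upd_none; auto].
        intros z. specialize (B z). lia. }
    destruct (Gen c x (Some (if i then A1 else A0)) B Sp Nc) as [O1 Sc].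
    destruct (Gen d y (Some (if i then A3 else A2)) B' S' Nd) as [O2 Sd].
    split.
    + apply ea_sel with (b0 := cs c x).
      * exists x. repeat split; auto; congruence.
      * exists y. repeat split; auto; congruence.
      * intros s b. unfold ceps at 1; simpl. rewrite C. apply O1.
      * intros s b. unfold ceps at 1; simpl. rewrite <- H5, <- H6.
        destruct i; rewrite ?C0, ?C1; apply O2.
    + intros e [<-|[<-|[]]]; (split; [|split]); simpl; auto.
      * apply (tree_ok_kid E (ct c) 0); auto. rewrite K; auto.
      * bnd.
      * rewrite C. auto.
      * apply (tree_ok_kid E (ct d) (if i then 1 else 0)); auto.
        rewrite K'. destruct i; auto.
      * bnd.
      * destruct i; rewrite ?C0, ?C1; auto.
Qed.
End Nets.

(** * Nets as states: steps and invariants *)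

Record net := Net { nnx : nat; ncs : list comp; nhist : nat -> option kind }.

Definition record_event (ev : option (nat * kind)) (H : nat -> option kind) :=
  match ev with
  | None => H
  | Some (s, k) => fun t => if Nat.eqb t s then Some k else H t
  end.

Definition net_act (N N' : net) (a b : list comp) (ev : option (nat * kind)) : Prop :=
  exists r, Permutation (ncs N) (a ++ r) /\ act (nnx N) a b ev (nnx N') /\
    Permutation (ncs N') (b ++ r) /\ nhist N' = record_event ev (nhist N).

Definition mstep (N N' : net) : Prop := exists a b ev, net_act N N' a b ev.

Inductive msteps : net -> net -> Prop :=
| ms_perm N N' : nnx N' = nnx N -> Permutation (ncs N) (ncs N') ->
    nhist N' = nhist N -> msteps N N'
| ms_step N1 N2 N3 : mstep N1 N2 -> msteps N2 N3 -> msteps N1 N3.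

Definition msteps1 (N N' : net) : Prop := exists N1, mstep N N1 /\ msteps N1 N'.

Lemma mstep_perm N1 N2 N3 : nnx N2 = nnx N1 -> Permutation (ncs N1) (ncs N2) ->
  nhist N2 = nhist N1 -> mstep N2 N3 -> mstep N1 N3.
Proof.
  intros E P H [a [b [ev [r [P1 [A [P2 H2]]]]]]]. exists a, b, ev, r.
  split; [|split; [|split]]; auto.
  - eapply perm_trans; eauto.
  - rewrite <- E; auto.
  - rewrite H2, H. auto.
Qed.

Lemma msteps_perm_l N1 N2 N3 : nnx N2 = nnx N1 -> Permutation (ncs N1) (ncs N2) ->
  nhist N2 = nhist N1 -> msteps N2 N3 -> msteps N1 N3.
Proof.
  intros E P H M. destruct M as [N N'|].
  - constructor; try congruence. eapply perm_trans; eauto.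
  - eapply ms_step; eauto. eapply mstep_perm; eauto.
Qed.

Lemma msteps_trans N1 N2 N3 : msteps N1 N2 -> msteps N2 N3 -> msteps N1 N3.
Proof.
  intros M M'. induction M.
  - eapply msteps_perm_l; eauto.
  - eapply ms_step; eauto.
Qed.

Lemma msteps1_l N1 N2 N3 : msteps N1 N2 -> msteps1 N2 N3 -> msteps1 N1 N3.
Proof.
  intros M [N2' [S M']]. destruct M as [N N'|A B C].
  - exists N2'. split; auto. eapply mstep_perm; eauto.
  - exists B. split; auto. eapply msteps_trans; eauto. eapply ms_step; eauto.
Qed.

Lemma msteps1_r N1 N2 N3 : msteps1 N1 N2 -> msteps N2 N3 -> msteps1 N1 N3.
Proof.
  intros [N [S M]] M'. exists N. split; auto. eapply msteps_trans; eauto.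
Qed.

Section Steps.
Variable E : env.

Definition good (N : net) : Prop := net_ok E (nnx N) (ncs N) (nhist N).

Lemma act_eact nx a r b ev nx' L H : net_ok E nx L H -> Permutation L (a ++ r) ->
  act nx a b ev nx' ->
  eact nx (map ceps a) (map ceps b) (option_map fst ev) nx' /\
  (forall c, In c b -> comp_ok E nx' c) /\
  (forall X, In X (map ceps a) -> bounded nx X) /\
  pairwise apart (map ceps a ++ map ceps r).
Proof.
  intros [C Ap Al Nw] P A.
  assert (Ap' : pairwise apart (map ceps a ++ map ceps r)).
  { rewrite <- map_app. eapply pairwise_perm; [apply apart_sym| |exact Ap].
    apply Permutation_map; auto. }
  assert (Ca : forall c, In c a -> comp_ok E nx c).
  { intros c Hc. apply C. eapply Permutation_in; [symmetry; eauto|].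
    apply in_or_app; auto. }
  assert (Ap2 := Ap'). apply pairwise_app in Ap2 as [Aa _].
  destruct (act_ok E nx a b ev nx' A Ca Aa) as [EA Cb].
  split; auto. split; auto. split; auto.
  intros X HX. apply in_map_iff in HX as [c [<- Hc]].
  apply (comp_ok_bounded E); auto.
Qed.

Lemma eact_fired nx a b s nx' : eact nx a b (Some s) nx' ->
  exists X bb, In X a /\ X s bb.
Proof.
  intros A. remember (Some s) as ev eqn:Ev.
  destruct A; try discriminate; injection Ev as ->; exists X1, b0; split; simpl; auto;
    apply H; auto.
Qed.

Lemma good_mstep N N' : good N -> mstep N N' -> good N'.
Proof.
  intros G [a [b [ev [r [P [A [P' Hh]]]]]]].
  destruct (act_eact _ _ _ _ _ _ _ _ G P A) as [EA [Cb [Bd Ap]]].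
  destruct G as [C _ Al Nw].
  apply pairwise_app in Ap as [Aa [Ar Aar]].
  assert (Le := eact_next _ _ _ _ _ EA).
  assert (Cr : forall c, In c r -> comp_ok E (nnx N) c).
  { intros c Hc. apply C. eapply Permutation_in; [symmetry; eauto|].
    apply in_or_app; auto. }
  assert (Inb : forall c, In c (ncs N') -> In c b \/ In c r).
  { intros c Hc. apply in_app_or. eapply Permutation_in; eauto. }
  assert (Fired : forall s k, ev = Some (s, k) -> s < nnx N).
  { intros s k ->. simpl in EA. destruct (eact_fired _ _ _ _ _ EA) as [X [bb [HX Xs]]].
    apply (Bd X HX s bb Xs). }
  constructor.
  - intros c Hc. destruct (Inb c Hc) as [Hb|Hr]; auto.
    destruct (Cr c Hr) as [T [B S]]. split; [|split]; auto.
    intros z. specialize (B z). lia.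
  - assert (Pm := Permutation_map ceps P'). rewrite map_app in Pm. symmetry in Pm.
    eapply pairwise_perm; [apply apart_sym|exact Pm|].
    apply pairwise_app. split; [|split]; auto.
    + eapply eact_apart; eauto.
    + intros X Y HX HY s bb Xs Ys.
      destruct (eact_origin _ _ _ _ _ _ _ _ EA HX Xs) as [[Z [HZ [Zs _]]]|[L1 _]].
      * apply (Aar Z Y HZ HY s bb); auto.
      * apply in_map_iff in HY as [c [<- Hc]].
        assert (s < nnx N) by (eapply (comp_ok_bounded E); eauto). lia.
  - intros c s bb Hc Hs. rewrite Hh.
    assert (Old : nhist N s = None /\ forall k, ev <> Some (s, k)).
    { destruct (Inb c Hc) as [Hb|Hr].
      - destruct (eact_origin _ _ _ _ _ _ _ _ EA (in_map ceps _ _ Hb) Hs)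
          as [[Z [HZ [Zs NE]]]|[L1 L2]].
        + apply in_map_iff in HZ as [c' [<- Hc']]. split.
          * eapply Al; [|exact Zs]. eapply Permutation_in; [symmetry; eauto|].
            apply in_or_app; auto.
          * intros k ->. apply NE; auto.
        + split; [apply Nw; auto|]. intros k Ek. apply Fired in Ek. lia.
      - split.
        + eapply Al; [|exact Hs]. eapply Permutation_in; [symmetry; eauto|].
          apply in_or_app; auto.
        + intros k ->. simpl in EA.
          (* Both endpoints of the retired session belong to acting components, so the rest of the
             net owns neither of them. *)
          assert (K : forall X, In X (map ceps a) -> forall bb', X s bb' ->
                    bb' = bb -> False).
          { intros X HX bb' Xs ->. apply (Aar X (ceps c) HX (in_map ceps _ _ Hr) s bb); auto. }
          clear - EA K. remember (Some s) as e eqn:Ee.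
          remember (map ceps a) as A. remember (map ceps b) as B.
          destruct EA; try discriminate; injection Ee as ->; simpl in K;
            (destruct (Bool.bool_dec b0 bb) as [Eb|Nb];
             [eapply (K X1); [auto| |exact Eb]; apply H; auto
             |eapply (K X2); [auto|eassumption|destruct b0, bb; simpl; congruence]]). }
    destruct Old as [O1 O2]. destruct ev as [[s' k]|]; simpl; auto.
    destruct (Nat.eqb_spec s s'); auto. subst. exfalso; eapply O2; eauto.
  - intros s Hs. rewrite Hh. destruct ev as [[s' k]|]; simpl.
    + destruct (Nat.eqb_spec s s').
      * subst. specialize (Fired _ _ eq_refl). lia.
      * apply Nw. lia.
    + apply Nw. lia.
Qed.

Lemma mstep_next N N' : good N -> mstep N N' -> nnx N <= nnx N'.
Proof.
  intros G [a [b [ev [r [P [A _]]]]]].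
  destruct (act_eact _ _ _ _ _ _ _ _ G P A) as [EA _]. eapply eact_next; eauto.
Qed.

Lemma mstep_hist N N' s k : good N -> mstep N N' -> nhist N s = Some k ->
  nhist N' s = Some k.
Proof.
  intros G [a [b [ev [r [P [A [_ Hh]]]]]]] Hs.
  destruct (act_eact _ _ _ _ _ _ _ _ G P A) as [EA _]. rewrite Hh.
  destruct ev as [[s' k']|]; simpl; auto. destruct (Nat.eqb_spec s s'); auto. subst s'.
  simpl in EA. destruct (eact_fired _ _ _ _ _ EA) as [X [bb [HX Xs]]].
  apply in_map_iff in HX as [c [<- Hc]].
  rewrite (net_alive _ _ _ _ G c s bb) in Hs; [discriminate| |auto].
  eapply Permutation_in; [symmetry; eauto|]. apply in_or_app; auto.
Qed.

Lemma good_msteps N N' : msteps N N' -> good N -> good N'.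
Proof.
  induction 1 as [N N' E1 P E2|N1 N2 N3 S M IH]; intros G.
  - destruct G as [C Ap Al Nw]. constructor; rewrite ?E1, ?E2; auto.
    + intros c Hc. apply C. eapply Permutation_in; [symmetry|]; eauto.
    + eapply pairwise_perm; [apply apart_sym|apply Permutation_map; eauto|auto].
    + intros c s b Hc. apply Al. eapply Permutation_in; [symmetry|]; eauto.
  - apply IH. eapply good_mstep; eauto.
Qed.

Lemma msteps_next N N' : msteps N N' -> good N -> nnx N <= nnx N'.
Proof.
  induction 1 as [N N' E1 P E2|N1 N2 N3 S M IH]; intros G.
  - lia.
  - assert (nnx N1 <= nnx N2) by (eapply mstep_next; eauto).
    assert (nnx N2 <= nnx N3) by (apply IH; eapply good_mstep; eauto). lia.
Qed.

(** The net is a tree: every component can be taken as the root. Sessions below [m]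
    are external, that is, with a missing second side. *)
Definition rootable (m : nat) (N : net) : Prop :=
  m <= nnx N /\
  forall c r, Permutation (ncs N) (c :: r) ->
  exists O, (forall s, s < m -> O s = true) /\ forall d, In d r -> away O (ceps d).

(** A root among the results borrows the orientation of the old net rooted at an acting component; a
    root in the rest keeps its own. In both cases only created sessions are reoriented, which the
    other components do not own. *)
Lemma rootable_mstep m N N' : good N -> mstep N N' -> rootable m N -> rootable m N'.
Proof.
  intros G S [Hm R]. split.
  { apply mstep_next in S; auto. lia. }
  destruct S as [a [b [ev [r0 [P [A [P' _]]]]]]].
  destruct (act_eact _ _ _ _ _ _ _ _ G P A) as [EA [_ [Bd Ap]]].
  apply pairwise_app in Ap as [Aa _].
  assert (Br : forall c, In c r0 -> bounded (nnx N) (ceps c)).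
  { intros c Hc. apply (comp_ok_bounded E). apply (net_comp _ _ _ _ G).
    eapply Permutation_in; [symmetry; eauto|]. apply in_or_app; auto. }
  intros c r Pc. assert (Pbr : Permutation (b ++ r0) (c :: r)).
  { eapply perm_trans; [symmetry|]; eauto. }
  assert (Hc : In c (b ++ r0)) by (eapply Permutation_in; [symmetry; eauto|left; auto]).
  apply in_app_or in Hc as [Hc|Hc]; apply in_split in Hc as [l1 [l2 ->]].
  - assert (Pr : Permutation ((l1 ++ l2) ++ r0) r).
    { apply Permutation_cons_inv with (a := c). rewrite <- Pbr.
      rewrite <- !app_assoc. simpl. apply Permutation_middle. }
    rewrite map_app in EA. simpl in EA.
    assert (exists c0 a', a = c0 :: a') as [c0' [a' Ea]].
    { destruct A; eauto. }
    destruct (R c0' (a' ++ r0)) as [O [HO HA]].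
    { rewrite P, Ea. auto. }
    destruct (eact_point_inside _ _ _ _ _ EA _ _ _ eq_refl O) as [O' [HO' HA']].
    exists O'. split.
    + intros s Hs. rewrite HO'; auto. lia.
    + intros d Hd. apply (Permutation_in _ (Permutation_sym Pr)) in Hd.
      apply in_app_or in Hd as [Hd|Hd].
      * apply HA'. rewrite <- map_app. apply in_map; auto.
      * apply (away_ext O); [|apply HA, in_or_app; auto].
        intros s bb Hs. apply HO'. eapply Br; eauto.
  - assert (Pr : Permutation (b ++ l1 ++ l2) r).
    { apply Permutation_cons_inv with (a := c). rewrite <- Pbr.
      rewrite !app_assoc. apply Permutation_middle. }
    destruct (R c (a ++ l1 ++ l2)) as [O [HO HA]].
    { rewrite P. symmetry. rewrite !app_assoc. apply Permutation_middle. }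
    destruct (eact_point_outside _ _ _ _ _ EA Bd Aa O) as [O' [HO' HA']].
    { intros X HX. apply in_map_iff in HX as [d [<- Hd]]. apply HA, in_or_app; auto. }
    exists O'. split.
    + intros s Hs. rewrite HO'; auto. lia.
    + intros d Hd. apply (Permutation_in _ (Permutation_sym Pr)) in Hd.
      apply in_app_or in Hd as [Hd|Hd].
      * apply HA'. apply in_map; auto.
      * apply (away_ext O); [|apply HA, in_or_app; auto].
        intros s bb Hs. apply HO'. apply (Br d) in Hs; auto.
        apply in_app_or in Hd. apply in_or_app. simpl. tauto.
Qed.
End Steps.

(** * Simulation of reductions by net steps *)

Lemma ren_ext P : forall r q, (forall z, free_in z P -> r z = q z) -> ren r P = ren q P.
Proof.
  assert (U : forall r q (B : nat -> Prop), (forall z, B (S z) -> r z = q z) ->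
    forall z, B z -> up r z = up q z).
  { intros r q B H [|z] Hz; simpl; auto. }
  induction P; intros r q H; simpl in *.
  - f_equal. apply map_ext_in. auto.
  - f_equal; auto.
  - f_equal; auto. apply IHP. apply U. auto.
  - f_equal; auto.
  - f_equal; [apply IHP1|apply IHP2]; apply U; auto.
  - f_equal; auto.
  - f_equal; auto.
  - f_equal; auto. apply IHP1. apply U. auto.
  - f_equal; auto.
Qed.

Lemma ren_ren P : forall r q, ren r (ren q P) = ren (fun z => r (q z)) P.
Proof.
  assert (U : forall r q, (fun z => up r (up q z)) = up (fun z => r (q z))).
  { intros r q. extensionality z. destruct z; auto. }
  induction P; intros r q; simpl; rewrite ?IHP, ?IHP1, ?IHP2, ?U; auto.
  rewrite map_map. auto.
Qed.

Section Simulation.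
Variable E : env.
Hypothesis Ewf : env_wf E.

(** By [env_wf] the free names of a body stay below the arity, where [nth] never returns its
    default; the default [0] would not commute with [r]. *)
Lemma ren_instantiate r a xs : length xs = fst (E a) ->
  ren r (instantiate E a xs) = instantiate E a (map r xs).
Proof.
  intros Hl. unfold instantiate. rewrite ren_ren. apply ren_ext.
  intros z Hz. apply Ewf in Hz. rewrite <- Hl in Hz.
  rewrite (nth_indep (map r xs) 0 (r 0)) by (rewrite length_map; auto).
  rewrite map_nth. auto.
Qed.

Lemma spc_ren P P' : spc E P P' -> forall r, spc E (ren r P) (ren r P').
Proof.
  induction 1; intros r; simpl; try (constructor; auto; fail).
  - eapply spc_trans; eauto.
  - assert (E1 : ren (up (up r)) (ren (up S) R) = ren (up S) (ren (up r) R)).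
    { rewrite !ren_ren. f_equal. extensionality k. destruct k; auto. }
    assert (E2 : ren (up (up r)) (ren (up S) P) = ren (up S) (ren (up r) P)).
    { rewrite !ren_ren. f_equal. extensionality k. destruct k; auto. }
    assert (E3 : ren (up (up r)) (ren swap01 Q) = ren swap01 (ren (up (up r)) Q)).
    { rewrite !ren_ren. f_equal. extensionality k. destruct k as [|[|k]]; auto. }
    rewrite E1, E2, E3. apply spc_assoc.
  - rewrite ren_instantiate; auto. apply spc_unfold. rewrite length_map; auto.
Qed.

(** The heads that pre-congruence cannot change, in contrast to cuts and invocations. *)
Definition prefix (P : proc) : Prop :=
  match P with PCut _ _ | PCall _ _ => False | _ => True end.

Lemma prefix_ren r P : prefix (ren r P) <-> prefix P.
Proof. destruct P; simpl; tauto. Qed.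

(** [rep P th L K]: under the map [th] from names to sessions, the cuts of [P] are the
    sessions [K] and its other parts are run by the components [L]. *)
Inductive rep : proc -> (nat -> nat) -> list comp -> list nat -> Prop :=
| rep_cut P Q th s L1 L2 L K1 K2 :
    rep P (fcons s th) L1 K1 -> rep Q (fcons s th) L2 K2 ->
    Permutation (L1 ++ L2) L -> rep (PCut P Q) th L (s :: K1 ++ K2)
| rep_prefix P th c : prefix P -> prefix (nproc (ct c)) ->
    spc E (ren (cn c) (nproc (ct c))) (ren th P) -> rep P th [c] []
| rep_call a xs ys th c : nproc (ct c) = PCall a ys ->
    map (cn c) ys = map th xs -> rep (PCall a xs) th [c] [].

Lemma fcons_up (s : nat) (th r : nat -> nat) :
  (fun k => fcons s th (up r k)) = fcons s (fun k => th (r k)).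
Proof. extensionality k. destruct k; auto. Qed.

Lemma rep_ren P : forall r th L K,
  rep (ren r P) th L K <-> rep P (fun k => th (r k)) L K.
Proof.
  assert (Pre : forall P r th L K, prefix P ->
    rep (ren r P) th L K <-> rep P (fun k => th (r k)) L K).
  { intros P0 r th L K Pr. split; intros R.
    - assert (Pr' := Pr). apply (prefix_ren r) in Pr'.
      inversion R as [P9 Q9 th9 s L1 L2 L9 K1 K2 RA RB Pm|P9 th9 c Pr1 Pr2 Sp|a9 xs9 ys th9 c Ec Em]; subst; try (simpl in Pr'; congruence || (rewrite <- H in Pr'; contradiction)).
      apply rep_prefix; auto. rewrite ren_ren in Sp. auto.
    - inversion R as [P9 Q9 th9 s L1 L2 L9 K1 K2 RA RB Pm|P9 th9 c Pr1 Pr2 Sp|a9 xs9 ys th9 c Ec Em]; subst; try contradiction.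
      apply rep_prefix; auto; [apply prefix_ren; auto|]. rewrite ren_ren. auto. }
  induction P; intros r th L K; try (apply Pre; exact I).
  - simpl. split; intros R; inversion R as [P9 Q9 th9 s L1 L2 L9 K1 K2 RA RB Pm|P9 th9 c Pr1 Pr2 Sp|a9 xs9 ys th9 c Ec Em]; subst; try contradiction.
    + eapply rep_call; eauto. rewrite Em, map_map. auto.
    + eapply rep_call; eauto. rewrite Em, map_map. auto.
  - simpl. split; intros R; inversion R as [P9 Q9 th9 s L1 L2 L9 K1 K2 RA RB Pm|P9 th9 c Pr1 Pr2 Sp|a9 xs9 ys th9 c Ec Em]; subst; try contradiction.
    + apply IHP1 in RA. apply IHP2 in RB. rewrite fcons_up in RA, RB.
      eapply rep_cut; eauto.
    + eapply rep_cut; eauto; [apply IHP1|apply IHP2]; rewrite fcons_up; auto.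
Qed.

(** When a session is retired, it is redirected to a new one throughout a component; the free names
    must not move with it, hence the separation of [K] from the range of [th]. *)
Definition fresh (nx : nat) (th : nat -> nat) (K : list nat) : Prop :=
  NoDup K /\ (forall s, In s K -> s < nx /\ forall k, th k <> s) /\ forall k, th k < nx.

Lemma NoDup_app_iff {X} (l1 l2 : list X) :
  NoDup (l1 ++ l2) <-> NoDup l1 /\ NoDup l2 /\ forall x, In x l1 -> ~ In x l2.
Proof.
  induction l1 as [|a l1 IH]; simpl.
  - split; [intros; repeat split; auto; constructor|tauto].
  - rewrite !NoDup_cons_iff, IH, in_app_iff. split.
    + intros [H [H1 [H2 H3]]]. repeat split; auto.
      intros x [<-|Hx]; auto.
    + intros [[H H1] [H2 H3]]. repeat split; auto.
      intros [H'|H']; auto. apply (H3 a); auto.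
Qed.

Lemma fresh_cut_iff nx th s K1 K2 : fresh nx th (s :: K1 ++ K2) <->
  s < nx /\ (forall k, th k <> s) /\ (forall k, th k < nx) /\
  fresh nx (fcons s th) K1 /\ fresh nx (fcons s th) K2 /\ forall x, In x K1 -> ~ In x K2.
Proof.
  unfold fresh. rewrite NoDup_cons_iff, NoDup_app_iff, in_app_iff. split.
  - intros [[H [H1 [H2 H3]]] [H4 H5]].
    destruct (H4 s) as [L1 L2]; [left; auto|].
    assert (B : forall k, fcons s th k < nx) by (intros [|k]; simpl; auto).
    assert (C : forall t, In t K1 \/ In t K2 -> t < nx /\ forall k, fcons s th k <> t).
    { intros t Ht. destruct (H4 t) as [M1 M2]; [right; apply in_or_app; auto|].
      split; auto. intros [|k]; simpl; auto. intros ->. auto. }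
    exact (conj L1 (conj L2 (conj H5 (conj
      (conj H1 (conj (fun t Ht => C t (or_introl Ht)) B)) (conj
      (conj H2 (conj (fun t Ht => C t (or_intror Ht)) B)) H3))))).
  - intros [L1 [L2 [L3 [[N1 [F1 B1]] [[N2 [F2 B2]] D]]]]].
    split; [split; [|auto]|split; [|auto]].
    + intros [Hs|Hs]; [apply F1 in Hs|apply F2 in Hs]; destruct Hs as [_ Hs];
        apply (Hs 0); auto.
    + intros t [<-|Ht]; auto. apply in_app_or in Ht as [Ht|Ht];
        [apply F1 in Ht|apply F2 in Ht]; destruct Ht as [Lt Ht];
        (split; [auto|intros k; apply (Ht (S k))]).
Qed.

Lemma fresh_mono nx nx' th K : nx <= nx' -> fresh nx th K -> fresh nx' th K.
Proof.
  intros L [N [F B]]. split; [|split]; auto.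
  - intros s Hs. destruct (F s Hs). split; auto; lia.
  - intros k. specialize (B k). lia.
Qed.

Lemma fresh_nil nx th : (forall k, th k < nx) -> fresh nx th [].
Proof. intros B. split; [constructor|]. split; auto. intros s []. Qed.

(** The frame [R] is left untouched and new cut sessions are taken from [nx] on, which lets
    evolutions of the two sides of a cut be combined. The parameter [steps] is [msteps] for
    pre-congruence and [msteps1] for reduction. *)
Definition evolves (steps : net -> net -> Prop) nx L R H (P : proc) th (K : list nat) : Prop :=
  exists nx' L' K' H', steps (Net nx (L ++ R) H) (Net nx' (L' ++ R) H') /\
    rep P th L' K' /\ fresh nx' th K' /\ (forall s, In s K' -> In s K \/ nx <= s).

Lemma fixes_msteps t v c R nx H : fixes t v -> ct c = t -> tree_ok E t ->
  msteps (Net nx (c :: R) H) (Net nx ({| ct := v; cn := cn c; cs := cs c |} :: R) H) /\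
  nproc v = nproc t /\ tree_ok E v.
Proof.
  intros F. revert c. induction F as [t|t u v x Tg K F IH]; intros c Ec T.
  - subst t. destruct c; simpl. split; [constructor; auto|auto].
  - assert (Tu : tree_ok E u) by (apply (tree_ok_kid E t 0); auto; rewrite K; auto).
    destruct (fix_inv E t x (tree_ok_node E t T) Tg) as [u' [A [B [K' [_ [_ [Pu _]]]]]]].
    assert (u' = u) by congruence. subst u'.
    destruct (IH {| ct := u; cn := cn c; cs := cs c |} eq_refl Tu) as [M [Pv Tv]].
    split; [|split; [congruence|auto]].
    eapply ms_step; [|exact M]. exists [c], [{| ct := u; cn := cn c; cs := cs c |}], None, R.
    simpl. repeat split; auto. apply act_fix with (x := x); congruence.
Qed.

Lemma reach_axiom_node c R nx H : good E (Net nx (c :: R) H) ->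
  exists v, ntag v = RAx /\ nproc v = nproc (ct c) /\ tree_ok E v /\
  msteps (Net nx (c :: R) H) (Net nx ({| ct := v; cn := cn c; cs := cs c |} :: R) H).
Proof.
  intros G. destruct (net_comp _ _ _ _ G c) as [T _]; [left; auto|].
  destruct (fixes_terminate E _ T) as [v [F Tg]].
  destruct (fixes_msteps _ _ c R nx H F eq_refl T) as [M [Pv Tv]].
  exists v. auto.
Qed.

Lemma ren_fcons_up n f P Q g : ren (up f) P = ren (up g) Q ->
  ren (fcons n f) P = ren (fcons n g) Q.
Proof.
  intros Eq. apply f_equal with (f := ren (fcons n (fun k => k))) in Eq.
  rewrite !ren_ren in Eq. rewrite !fcons_up in Eq. exact Eq.
Qed.

(** The sides evolve one after the other, each with the other in its frame. The second one meets a
    net changed by the first, whence its quantification over later nets. *)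
Lemma evolves_join nx L1 L2 R H P Q th s K1 K2 :
  good E (Net nx (L1 ++ L2 ++ R) H) -> s < nx -> (forall k, th k <> s) ->
  (forall k, th k < nx) -> (forall t, In t K2 -> t < nx) ->
  (forall t, In t K1 -> ~ In t K2) ->
  evolves msteps nx L1 (L2 ++ R) H P (fcons s th) K1 ->
  (forall nx' R' H', nx <= nx' -> good E (Net nx' (L2 ++ R') H') ->
    evolves msteps nx' L2 R' H' Q (fcons s th) K2) ->
  evolves msteps nx (L1 ++ L2) R H (PCut P Q) th (s :: K1 ++ K2).
Proof.
  intros G Ls Ns Bth B2 D [nx1 [L1' [K1' [H1 [M1 [R1 [F1 N1]]]]]]] Ev2.
  assert (G1 := good_msteps E _ _ M1 G).
  assert (Le1 := msteps_next E _ _ M1 G). simpl in Le1.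
  assert (Mp : msteps (Net nx1 (L1' ++ L2 ++ R) H1) (Net nx1 (L2 ++ L1' ++ R) H1)).
  { constructor; auto. simpl. rewrite !app_assoc.
    apply Permutation_app_tail, Permutation_app_comm. }
  assert (G2 := good_msteps E _ _ Mp G1).
  destruct (Ev2 nx1 (L1' ++ R) H1 Le1 G2) as [nx2 [L2' [K2' [H2 [M2 [R2 [F2 N2]]]]]]].
  assert (Le2 := msteps_next E _ _ M2 G2). simpl in Le2.
  exists nx2, (L1' ++ L2'), (s :: K1' ++ K2'), H2. split; [|split; [|split]].
  - rewrite <- app_assoc. eapply msteps_trans; [exact M1|].
    eapply msteps_trans; [exact Mp|]. eapply msteps_trans; [exact M2|].
    constructor; auto. simpl. rewrite !app_assoc.
    apply Permutation_app_tail, Permutation_app_comm.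
  - eapply rep_cut; eauto.
  - apply fresh_cut_iff. split; [lia|]. split; auto.
    split; [intros k; specialize (Bth k); lia|].
    split; [eapply fresh_mono; [|exact F1]; lia|]. split; auto.
    intros x Hx1 Hx2. assert (Lx := proj1 (proj1 (proj2 F1) x Hx1)).
    destruct (N2 x Hx2) as [I2|]; [|lia].
    destruct (N1 x Hx1) as [I1|]; [eapply D; eauto|]. apply B2 in I2. lia.
  - intros t [<-|Ht]; [left; left; auto|]. apply in_app_or in Ht as [Ht|Ht].
    + destruct (N1 t Ht); auto. left; right. apply in_or_app; auto.
    + destruct (N2 t Ht); [|right; lia]. left; right. apply in_or_app; auto.
Qed.

(** Performs all cuts at the top of a component, reaching each cut rule through the unfoldings above
    it. Structural recursion on [P] suffices because invocations are left folded. *)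
Lemma decompose P : forall th c R nx H,
  good E (Net nx (c :: R) H) -> (forall k, th k < nx) ->
  ren (cn c) (nproc (ct c)) = ren th P ->
  evolves msteps nx [c] R H P th [].
Proof.
  assert (Pre : forall P th c R nx H, prefix P -> (forall k, th k < nx) ->
    ren (cn c) (nproc (ct c)) = ren th P -> evolves msteps nx [c] R H P th []).
  { intros P0 th c R nx H Pr Bth Eq. exists nx, [c], [], H.
    split; [constructor; auto|]. split; [|split; [apply fresh_nil; auto|tauto]].
    apply rep_prefix; auto; [|rewrite Eq; constructor].
    apply (prefix_ren (cn c)). rewrite Eq. apply prefix_ren. auto. }
  induction P; intros th c R nx H G Bth Eq; try (apply Pre; auto; exact I); clear Pre.
  - exists nx, [c], [], H.
    split; [constructor; auto|]. split; [|split; [apply fresh_nil; auto|tauto]].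
    destruct (nproc (ct c)) eqn:Ep; try discriminate. simpl in Eq.
    injection Eq as -> Eq. eapply rep_call; eauto.
  - destruct (reach_axiom_node c R nx H G) as [v [Tg [Pv [Tv M]]]].
    destruct (nproc (ct c)) as [| | | |Q1 Q2| | | |] eqn:Ep; try discriminate.
    simpl in Eq. injection Eq as Eq1 Eq2.
    destruct (cut_inv E v Q1 Q2 (tree_ok_node E v Tv) Tg Pv) as
      [v1 [v2 [G1 [G2 [A [B [Kd [_ [_ [_ [_ [P1' [_ [P2' _]]]]]]]]]]]]]].
    set (d1 := {| ct := v1; cn := fcons nx (cn c); cs := fcons true (cs c) |}).
    set (d2 := {| ct := v2; cn := fcons nx (cn c); cs := fcons false (cs c) |}).
    assert (M1 : msteps (Net nx (c :: R) H) (Net (S nx) (d1 :: d2 :: R) H)).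
    { eapply msteps_trans; [exact M|].
      apply ms_step with (N2 := Net (S nx) (d1 :: d2 :: R) H).
      - exists [{| ct := v; cn := cn c; cs := cs c |}], [d1; d2], None, R.
        split; [|split; [|split]]; simpl; auto.
        apply (act_cut nx {| ct := v; cn := cn c; cs := cs c |} v1 v2 Q1 Q2); auto.
      - constructor; auto. }
    assert (G' := good_msteps E _ _ M1 G).
    destruct (evolves_join (S nx) [d1] [d2] R H P1 P2 th nx [] []) as
      [nx' [L' [K' [H' [M2 [R' [F' N']]]]]]]; auto.
    + intros k Hk. specialize (Bth k). lia.
    + intros k. specialize (Bth k). lia.
    + intros t [].
    + apply IHP1; auto.
      * intros [|k]; simpl; [lia|]. specialize (Bth k). lia.
      * simpl. rewrite P1'. apply ren_fcons_up; auto.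
    + intros nx' R' H' Le Gd. apply IHP2; auto.
      * intros [|k]; simpl; [lia|]. specialize (Bth k). lia.
      * simpl. rewrite P2'. apply ren_fcons_up; auto.
    + exists nx', L', K', H'. split; [eapply msteps_trans; [exact M1|exact M2]|].
      split; auto. split; auto. intros t Ht. right.
      destruct (N' t Ht) as [[<-|[]]|]; lia.
Qed.

(* A step of one side of a cut, the other side becoming part of the rest of the net. *)
Lemma evolves_cut_l steps nx L1 L2 L R H P Q th s K1 K2 :
  (forall N1 N2, steps N1 N2 -> good E N1 -> nnx N1 <= nnx N2) ->
  (forall N1 N2 N3, msteps N1 N2 -> steps N2 N3 -> steps N1 N3) ->
  (forall N1 N2 N3, steps N1 N2 -> msteps N2 N3 -> steps N1 N3) ->
  good E (Net nx (L ++ R) H) -> Permutation (L1 ++ L2) L ->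
  fresh nx th (s :: K1 ++ K2) -> rep Q (fcons s th) L2 K2 ->
  (good E (Net nx (L1 ++ L2 ++ R) H) -> fresh nx (fcons s th) K1 ->
   evolves steps nx L1 (L2 ++ R) H P (fcons s th) K1) ->
  evolves steps nx L R H (PCut P Q) th (s :: K1 ++ K2).
Proof.
  intros S0 S1 S2 G Pm F RQ IH.
  apply fresh_cut_iff in F as [F1 [F2 [F3 [F4 [F5 F6]]]]].
  assert (Mp : msteps (Net nx (L ++ R) H) (Net nx (L1 ++ L2 ++ R) H)).
  { constructor; auto. simpl. rewrite app_assoc. apply Permutation_app_tail.
    symmetry; auto. }
  assert (G1 := good_msteps E _ _ Mp G).
  destruct (IH G1 F4) as [nx' [L' [K' [H' [M [RP [F' N']]]]]]].
  assert (Le := S0 _ _ M G1). simpl in Le.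
  exists nx', (L' ++ L2), (s :: K' ++ K2), H'. split; [|split; [|split]].
  - eapply S1; [exact Mp|]. eapply S2; [exact M|]. constructor; auto. simpl.
    rewrite app_assoc. auto.
  - eapply rep_cut; eauto.
  - apply fresh_cut_iff. split; [lia|]. split; auto.
    split; [intros k; specialize (F3 k); lia|]. split; auto.
    split; [eapply fresh_mono; eauto|].
    intros x Hx Hx2. destruct (N' x Hx) as [?|?]; [eapply F6; eauto|].
    apply F5 in Hx2. lia.
  - intros t [<-|Ht]; [left; left; auto|]. apply in_app_or in Ht as [Ht|Ht].
    + destruct (N' t Ht); auto. left; right. apply in_or_app; auto.
    + left; right. apply in_or_app; auto.
Qed.

Lemma rep_comm P Q th L K : rep (PCut P Q) th L K ->
  exists K', rep (PCut Q P) th L K' /\ Permutation K K'.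
Proof.
  intros R. inversion R; subst; [|contradiction].
  exists (s :: K2 ++ K1). split.
  - eapply rep_cut; eauto. eapply perm_trans; [apply Permutation_app_comm|auto].
  - constructor. apply Permutation_app_comm.
Qed.

Lemma fresh_perm nx th K K' : Permutation K K' -> fresh nx th K -> fresh nx th K'.
Proof.
  intros P [N [F B]]. split; [|split]; auto.
  - eapply Permutation_NoDup; eauto.
  - intros s Hs. apply F. eapply Permutation_in; [symmetry|]; eauto.
Qed.

Lemma evolves_comm steps nx L R H P Q th K K0 : (forall s, In s K -> In s K0) ->
  evolves steps nx L R H (PCut P Q) th K ->
  evolves steps nx L R H (PCut Q P) th K0.
Proof.
  intros Inc [nx' [L' [K' [H' [M [R' [F N]]]]]]].
  destruct (rep_comm _ _ _ _ _ R') as [K2 [R2 P2]].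
  exists nx', L', K2, H'. split; auto. split; auto. split.
  - eapply fresh_perm; eauto.
  - intros s Hs. destruct (N s); auto. eapply Permutation_in; [symmetry|]; eauto.
Qed.

Lemma rep_prefix_inv P th L K : prefix P -> rep P th L K ->
  exists c, L = [c] /\ K = [] /\ prefix (nproc (ct c)) /\
    spc E (ren (cn c) (nproc (ct c))) (ren th P).
Proof.
  intros Pr R. inversion R; subst; simpl in Pr; try contradiction. eauto.
Qed.

Lemma evolves_prefix nx L R H P P' th K : prefix P -> prefix P' -> spc E P P' ->
  fresh nx th K -> rep P th L K -> evolves msteps nx L R H P' th K.
Proof.
  intros Pr Pr' S F Rp. destruct (rep_prefix_inv _ _ _ _ Pr Rp) as [c [-> [-> [Pc Sc]]]].
  exists nx, [c], [], H. split; [constructor; auto|]. split; [|split; auto].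
  apply rep_prefix; auto. eapply spc_trans; [exact Sc|]. apply spc_ren; auto.
Qed.

Lemma simulate_spc P P' : spc E P P' -> forall th L K R nx H,
  good E (Net nx (L ++ R) H) -> fresh nx th K -> rep P th L K ->
  evolves msteps nx L R H P' th K.
Proof.
  induction 1; intros th L K Rs nx Hs G F Rp;
    try (eapply evolves_prefix; [| | |exact F|exact Rp];
         [exact I|exact I|constructor; assumption]).
  - exists nx, L, K, Hs. split; [constructor; auto|]. auto.
  - destruct (IHspc1 _ _ _ _ _ _ G F Rp) as [nx1 [L1 [K1 [H1 [M1 [R1 [F1 N1]]]]]]].
    assert (G1 := good_msteps E _ _ M1 G).
    assert (Le := msteps_next E _ _ M1 G). simpl in Le.
    destruct (IHspc2 _ _ _ _ _ _ G1 F1 R1) as [nx2 [L2 [K2 [H2 [M2 [R2 [F2 N2]]]]]]].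
    exists nx2, L2, K2, H2. split; [eapply msteps_trans; eauto|]. split; auto. split; auto.
    intros s Hin. destruct (N2 s Hin) as [?|?]; [auto|right; lia].
  - eapply evolves_comm with (K := K); auto.
    exists nx, L, K, Hs. split; [constructor; auto|]. auto.
  - inversion Rp; subst; [|contradiction].
    match goal with H : rep (PCut Q _) _ _ _ |- _ => rename H into RQR end.
    match goal with H : rep P _ _ _ |- _ => rename H into RP end.
    inversion RQR; subst; [|contradiction].
    match goal with H : rep Q _ _ _ |- _ => rename H into RQ end.
    match goal with H : rep (ren _ R) _ _ _ |- _ => rename H into RR end.
    apply (rep_ren R (up S)) in RR.
    exists nx, L, (s0 :: (s :: K1 ++ K0) ++ K3), Hs.
    assert (Pk : Permutation (s :: K1 ++ s0 :: K0 ++ K3) (s0 :: (s :: K1 ++ K0) ++ K3)).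
    { simpl. rewrite perm_swap. constructor.
      rewrite <- Permutation_middle, app_assoc. auto. }
    split; [constructor; auto|]. split; [|split].
    + eapply rep_cut with (L1 := L1 ++ L0).
      * eapply rep_cut with (s := s); [| |reflexivity].
        -- apply rep_ren. replace (fun k => _) with (fcons s th); auto.
           extensionality k. destruct k; auto.
        -- apply rep_ren. replace (fun k => _) with (fcons s0 (fcons s th)); auto.
           extensionality k. destruct k as [|[|k]]; auto.
      * replace (fcons s0 th) with (fun k => fcons s0 (fcons s th) (up S k)); eauto.
        extensionality k. destruct k; auto.
      * rewrite <- app_assoc. etransitivity; [|eassumption].
        apply Permutation_app_head. auto.
    + eapply fresh_perm; [exact Pk|auto].
    + intros t Ht. left. eapply Permutation_in; [symmetry; exact Pk|auto].
  - inversion Rp as [|P9 th9 c Pr1|a9 xs9 ys th9 c Ec Em]; subst; [contradiction|].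
    destruct (reach_axiom_node c Rs nx Hs G) as [v [Tg [Pv [Tv M]]]].
    rewrite Ec in Pv.
    destruct (call_inv E v a ys (tree_ok_node E v Tv) Tg Pv) as [u [Kd [Hl [Pu _]]]].
    set (d := {| ct := u; cn := cn c; cs := cs c |}).
    assert (M1 : msteps (Net nx (c :: Rs) Hs) (Net nx (d :: Rs) Hs)).
    { eapply msteps_trans; [exact M|].
      apply ms_step with (N2 := Net nx (d :: Rs) Hs); [|constructor; auto].
      exists [{| ct := v; cn := cn c; cs := cs c |}], [d], None, Rs.
      split; [|split; [|split]]; simpl; auto.
      apply (act_call nx {| ct := v; cn := cn c; cs := cs c |} u a ys); auto. }
    destruct (decompose (instantiate E a xs) th d Rs nx Hs) as
      [nx' [L' [K' [H' [M2 [R2 [F2 N2]]]]]]].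
    + eapply good_msteps; eauto.
    + apply F.
    + simpl. rewrite Pu, !ren_instantiate; auto. congruence.
    + exists nx', L', K', H'. split; [|auto]. eapply msteps_trans; eauto.
  - inversion Rp; subst; [|contradiction].
    eapply evolves_cut_l; eauto; try apply msteps_trans.
    intros; apply (msteps_next E); auto.
  - inversion Rp; subst; [|contradiction].
    eapply evolves_comm with (K := s :: K2 ++ K1).
    { intros t [<-|Ht]; [left; auto|]. right. apply in_app_or in Ht. apply in_or_app. tauto. }
    eapply evolves_cut_l with (L1 := L2) (L2 := L1); eauto; try apply msteps_trans.
    + intros; apply (msteps_next E); auto.
    + eapply perm_trans; [apply Permutation_app_comm|auto].
    + eapply fresh_perm; [|exact F]. constructor. apply Permutation_app_comm.
Qed.

Definition same_head (X Y : proc) : Prop :=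
  match X with
  | PCall _ _ | PCut _ _ => True
  | PWait x P => exists P', Y = PWait x P' /\ spc E P P'
  | PIn x P => exists P', Y = PIn x P' /\ spc E P P'
  | PCase x P Q => exists P' Q', Y = PCase x P' Q' /\ spc E P P' /\ spc E Q Q'
  | PFail x => Y = PFail x
  | PClose x => Y = PClose x
  | POut x P Q => exists P' Q', Y = POut x P' Q' /\ spc E P P' /\ spc E Q Q'
  | PSel x i P => exists P', Y = PSel x i P' /\ spc E P P'
  end.

Lemma spc_same_head X Y : spc E X Y -> same_head X Y.
Proof.
  induction 1; simpl; auto; eauto 7 using spc_refl.
  - destruct P; simpl; eauto 7 using spc_refl.
  - destruct P; simpl in *; auto; subst; simpl in *; auto;
      repeat match goal with
      | H : exists _, _ |- _ => destruct H
      | H : _ /\ _ |- _ => destruct H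
      end; subst; simpl in *;
      repeat match goal with
      | H : exists _, _ |- _ => destruct H
      | H : _ /\ _ |- _ => destruct H
      end; subst; eauto 8 using spc_trans.
Qed.

Lemma spc_eq X Y X' Y' : X = X' -> Y = Y' -> spc E X Y -> spc E X' Y'.
Proof. intros -> ->; auto. Qed.

(** The component is decomposed along its own process, with sessions serving as names; the
    pre-congruence is then simulated on the result, and [rep_ren] returns to the names of [P]. *)
Lemma decompose_spc c P th R nx H : good E (Net nx (c :: R) H) ->
  (forall k, th k < nx) ->
  spc E (ren (cn c) (nproc (ct c))) (ren th P) -> evolves msteps nx [c] R H P th [].
Proof.
  intros G Bth S.
  assert (Bc : forall z, cn c z < nx).
  { apply (net_comp _ _ _ _ G c). left; auto. }
  (* The identity on existing sessions; above them it takes an arbitrary existing value, because a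
     naming map has to stay below [nx] everywhere. *)
  set (id := fun k => if Nat.ltb k nx then k else cn c 0).
  assert (Hid : forall k, k < nx -> id k = k).
  { intros k Hk. unfold id. destruct (Nat.ltb_spec k nx); auto; lia. }
  assert (Bid : forall k, id k < nx).
  { intros k. unfold id. destruct (Nat.ltb_spec k nx); auto. }
  destruct (decompose (ren (cn c) (nproc (ct c))) id c R nx H G Bid) as
    [nx1 [L1 [K1 [H1 [M1 [R1 [F1 N1]]]]]]].
  { rewrite ren_ren. apply ren_ext. intros z _. symmetry. apply Hid. auto. }
  assert (G1 := good_msteps E _ _ M1 G).
  assert (Le1 := msteps_next E _ _ M1 G). simpl in Le1.
  destruct (simulate_spc _ _ S id L1 K1 R nx1 H1 G1 F1 R1) as
    [nx2 [L2 [K2 [H2 [M2 [R2 [F2 N2]]]]]]].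
  assert (Le2 := msteps_next E _ _ M2 G1). simpl in Le2.
  apply (rep_ren P th) in R2.
  assert (Eq : (fun k => id (th k)) = th) by (extensionality k; auto).
  rewrite Eq in R2.
  exists nx2, L2, K2, H2. split; [eapply msteps_trans; eauto|]. split; auto. split.
  - destruct F2 as [Nd [Fr B]]. split; auto. split.
    + intros s Hs. destruct (Fr s Hs) as [Ls Ns]. split; auto.
      intros k Ek. apply (Ns (th k)). rewrite Hid; auto.
    + intros k. specialize (Bth k). lia.
  - intros s Hs. right. destruct (N2 s Hs) as [Hs1|]; [|lia].
    destruct (N1 s Hs1) as [[]|]; lia.
Qed.

Lemma reach_axiom_nodes c d R nx H : good E (Net nx (c :: d :: R) H) ->
  exists v w, ntag v = RAx /\ nproc v = nproc (ct c) /\ tree_ok E v /\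
    ntag w = RAx /\ nproc w = nproc (ct d) /\ tree_ok E w /\
  msteps (Net nx (c :: d :: R) H)
    (Net nx ({| ct := v; cn := cn c; cs := cs c |} ::
             {| ct := w; cn := cn d; cs := cs d |} :: R) H).
Proof.
  intros G. destruct (reach_axiom_node c (d :: R) nx H G) as [v [T1 [P1 [O1 M1]]]].
  set (c' := {| ct := v; cn := cn c; cs := cs c |}) in *.
  assert (Mp : msteps (Net nx (c' :: d :: R) H) (Net nx (d :: c' :: R) H)).
  { constructor; auto. apply perm_swap. }
  assert (G1 := good_msteps E _ _ M1 G). assert (G2 := good_msteps E _ _ Mp G1).
  destruct (reach_axiom_node d (c' :: R) nx H G2) as [w [T2 [P2 [O2 M2]]]].
  exists v, w. repeat (split; auto).
  eapply msteps_trans; [exact M1|]. eapply msteps_trans; [exact Mp|].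
  eapply msteps_trans; [exact M2|]. constructor; auto. apply perm_swap.
Qed.

Lemma opposite_sides c d R nx H x y : good E (Net nx (c :: d :: R) H) ->
  nctx (ct c) x <> None -> nctx (ct d) y <> None -> cn d y = cn c x ->
  cs d y = negb (cs c x).
Proof.
  intros G Hx Hy Eq. destruct (net_apart _ _ _ _ G) as [A _].
  specialize (A (ceps d) (or_introl eq_refl)).
  destruct (Bool.bool_dec (cs d y) (cs c x)) as [Eb|Nb].
  - exfalso. apply (A (cn c x) (cs c x)); [exists x; auto|exists y; auto].
  - destruct (cs d y), (cs c x); auto; congruence.
Qed.

Lemma evolves_after N1 nx L R H nx1 L1 R1 H1 P th K K1 :
  msteps (Net nx (L ++ R) H) N1 -> mstep N1 (Net nx1 (L1 ++ R) H1) ->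
  R1 = R -> nx <= nx1 -> (forall s, In s K1 -> nx <= s) ->
  evolves msteps nx1 L1 R1 H1 P th K1 ->
  evolves msteps1 nx L R H P th K.
Proof.
  intros M S -> Le HK [nx' [L' [K' [H' [M' [R' [F' N']]]]]]].
  exists nx', L', K', H'. split.
  - eapply msteps1_l; [exact M|]. exists (Net nx1 (L1 ++ R) H1). auto.
  - split; auto. split; auto. intros s Hs. right. destruct (N' s Hs); auto. lia.
Qed.

(** By [spc_same_head] both partners already show the heads of the redex, so after finitely many
    unfoldings they can act. Their continuations match those of the redex only up to pre-congruence,
    which [decompose_spc] takes care of. *)
Lemma simulate_red P P' : red E P P' -> forall th L K R nx H,
  good E (Net nx (L ++ R) H) -> fresh nx th K -> rep P th L K ->
  evolves msteps1 nx L R H P' th K.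
Proof.
  assert (Next1 : forall N1 N2, msteps1 N1 N2 -> good E N1 -> nnx N1 <= nnx N2).
  { intros N1 N2 [N [S M]] G. apply (msteps_next E); auto. eapply ms_step; eauto. }
  induction 1; intros th L K Rs nx Hs G F Rp.
  1-3: inversion Rp as [P9 Q9 th9 s L1 L2 L9 K1 K2 RA RB Pm|P9 th9 c Pr1|]; subst;
    [|contradiction];
    apply rep_prefix_inv in RA; [|exact I]; apply rep_prefix_inv in RB; [|exact I];
    destruct RA as [c [-> [-> [Pc Sc]]]]; destruct RB as [d [-> [-> [Pd Sd]]]];
    assert (Mp : msteps (Net nx (L ++ Rs) Hs) (Net nx (c :: d :: Rs) Hs))
      by (constructor; auto; symmetry; apply (Permutation_app_tail Rs Pm));
    assert (G0 := good_msteps E _ _ Mp G);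
    destruct (reach_axiom_nodes c d Rs nx Hs G0) as
      [v [w [Tv [Pv [Ov [Tw [Pw [Ow M]]]]]]]];
    assert (G1 := good_msteps E _ _ M G0);
    assert (M' := msteps_trans _ _ _ Mp M);
    assert (Ss := proj1 (proj2 F) s (or_introl eq_refl));
    destruct Ss as [Ls Ns];
    assert (Bth := proj2 (proj2 F));
    apply spc_same_head in Sc; apply spc_same_head in Sd;
    destruct (nproc (ct c)) eqn:Ec; try contradiction; simpl in Sc;
    repeat match goal with
    | H : exists _, _ |- _ => destruct H
    | H : _ /\ _ |- _ => destruct H
    end; try discriminate;
    destruct (nproc (ct d)) eqn:Ed; try contradiction; simpl in Sd;
    repeat match goal with
    | H : exists _, _ |- _ => destruct H
    | H : _ /\ _ |- _ => destruct H
    end; try discriminate.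
  1-3: set (c' := {| ct := v; cn := cn c; cs := cs c |}) in *;
    set (d' := {| ct := w; cn := cn d; cs := cs d |}) in *.
  - injection Sc as Es. injection H as Es' Ex. subst x1.
    destruct (close_inv E v x (tree_ok_node E v Ov) Tv Pv) as [Tx _].
    destruct (wait_inv E w x0 p (tree_ok_node E w Ow) Tw Pw) as [u [Ku [Ty [Pu _]]]].
    assert (Op := opposite_sides c' d' Rs nx Hs x x0 G1).
    simpl in Op. rewrite Tx, Ty in Op.
    set (d1 := {| ct := u; cn := cn d; cs := cs d |}).
    set (H1 := record_event (Some (cn c x, KEnd)) Hs).
    assert (St : mstep (Net nx (c' :: d' :: Rs) Hs) (Net nx ([d1] ++ Rs) H1)).
    { exists [c'; d'], [d1], (Some (cn c x, KEnd)), Rs. repeat (split; auto); simpl.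
      apply (act_close nx c' d' x x0 p u); auto; simpl; [congruence|].
      apply Op; congruence. }
    eapply evolves_after with (K1 := []); [exact M'|exact St|reflexivity|auto|intros t []|].
    apply decompose_spc; auto; [eapply good_mstep; eauto|]. simpl. rewrite Pu.
    rewrite ren_ren in H0. exact H0.
  - injection H as Es Ex0 Ex1. injection H2 as Es' Ex3. subst x0 x1 x3.
    destruct (out_inv E v x p1 p2 (tree_ok_node E v Ov) Tv Pv) as
      [u1 [u2 [G2 [G3 [A [B [Kv [Tx [_ [P1 [_ [P2 _]]]]]]]]]]]].
    destruct (in_inv E w x2 p (tree_ok_node E w Ow) Tw Pw) as
      [u [A' [B' [Kw [Ty [Pu _]]]]]].
    assert (Op := opposite_sides c' d' Rs nx Hs x x2 G1).
    simpl in Op. rewrite Tx, Ty in Op.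
    set (ev := Some (cn c x, KTen nx (S nx))).
    set (d1 := {| ct := u1; cn := fcons nx (cn c); cs := fcons (cs c x) (cs c) |}).
    set (d2 := {| ct := u2; cn := rn (cn c x) (S nx) (cn c); cs := cs c |}).
    set (d3 := {| ct := u; cn := fcons nx (rn (cn d x2) (S nx) (cn d));
                  cs := fcons (cs d x2) (cs d) |}).
    assert (St : mstep (Net nx (c' :: d' :: Rs) Hs)
                   (Net (S (S nx)) (([d1] ++ [d2; d3]) ++ Rs) (record_event ev Hs))).
    { exists [c'; d'], [d1; d2; d3], ev, Rs. repeat (split; auto); simpl.
      apply (act_comm nx c' d' x x2 p1 p2 p u1 u2 u); auto; simpl; [congruence|].
      apply Op; congruence. }
    assert (Gs := good_mstep E _ _ G1 St).
    (* Moves the retired session [s] to the session [S nx] of the continuation; freshness of [s]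
       leaves the free names in place. *)
    set (r := fun z => if Nat.eqb z s then S nx else z).
    assert (Rth : forall k, r (th k) = th k).
    { intros k. unfold r. destruct (Nat.eqb_spec (th k) s); auto. destruct (Ns k); auto. }
    assert (Rs' : r s = S nx) by (unfold r; rewrite Nat.eqb_refl; auto).
    assert (B1 : forall k, fcons nx th k < S (S nx)).
    { intros [|k]; simpl; [lia|]. specialize (Bth k). lia. }
    assert (B2 : forall k, fcons (S nx) (fcons nx th) k < S (S nx)).
    { intros [|k]; simpl; [lia|]. apply B1. }
    (* The outer cut of the reduct is the payload session [nx], the inner one the continuation
       [S nx]. *)
    eapply evolves_after with (K1 := nx :: [] ++ S nx :: [] ++ []);
      [exact M'|exact St|reflexivity|lia| |].
    { intros t [<-|[<-|[]]]; lia. }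
    apply evolves_join; auto; try (simpl; tauto).
    + intros k Hk. specialize (Bth k). lia.
    + intros k. specialize (Bth k). lia.
    + intros t [<-|[]]. lia.
    + apply decompose_spc; auto. simpl. rewrite P1.
      apply spc_ren with (r := fcons nx (fun k => k)) in H0; auto.
      rewrite !ren_ren in H0. revert H0. apply spc_eq; f_equal;
        extensionality k; destruct k; auto.
    + intros nx' R' H' Le Gd. apply (evolves_join nx' [d2] [d3]); auto; try (simpl; tauto).
      * intros [|k]; simpl; [lia|]. specialize (Bth k). lia.
      * intros k. specialize (B1 k). lia.
      * apply decompose_spc; auto; [intros k; specialize (B2 k); lia|].
        simpl. rewrite P2. apply spc_ren with (r := r) in H1; auto.
        rewrite !ren_ren in H1. rewrite ren_ren. revert H1. apply spc_eq; f_equal;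
          extensionality k; [unfold rn, r; rewrite Es; auto|].
        destruct k; simpl; auto.
      * intros nx2 R2 H4 Le2 G4. apply decompose_spc; auto.
        { intros k; specialize (B2 k); lia. }
        simpl. rewrite Pu. apply spc_ren with (r := fcons nx r) in H3; auto.
        rewrite !ren_ren in H3. rewrite ren_ren. revert H3. apply spc_eq; f_equal;
          extensionality k.
        -- destruct k; simpl; auto. unfold rn, r. rewrite Es'; auto.
        -- destruct k as [|[|k]]; simpl; auto.
  - injection H as Es Ei Ex0. injection H1 as Es' Ex2 Ex3. subst i0 x0 x2 x3.
    destruct (sel_inv E v x i p (tree_ok_node E v Ov) Tv Pv) as
      [u [A [B [Kv [Tx [Pu _]]]]]].
    destruct (case_inv E w x1 p0_1 p0_2 (tree_ok_node E w Ow) Tw Pw) as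
      [u0 [u1 [A' [B' [Kw [Ty [P0 [_ [P1 _]]]]]]]]].
    assert (Op := opposite_sides c' d' Rs nx Hs x x1 G1).
    simpl in Op. rewrite Tx, Ty in Op.
    set (ev := Some (cn c x, KSel i nx)).
    set (d1 := {| ct := u; cn := rn (cn c x) nx (cn c); cs := cs c |}).
    set (d2 := {| ct := if i then u1 else u0; cn := rn (cn d x1) nx (cn d); cs := cs d |}).
    assert (St : mstep (Net nx (c' :: d' :: Rs) Hs)
                   (Net (S nx) (([d1] ++ [d2]) ++ Rs) (record_event ev Hs))).
    { exists [c'; d'], [d1; d2], ev, Rs. repeat (split; auto); simpl.
      apply (act_sel nx c' d' x x1 i p p0_1 p0_2 u u0 u1); auto; simpl; [congruence|].
      apply Op; congruence. }
    assert (Gs := good_mstep E _ _ G1 St).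
    set (r := fun z => if Nat.eqb z s then nx else z).
    assert (Rth : (fun k => r (fcons s th k)) = fcons nx th).
    { extensionality k. unfold r. destruct k; simpl; [rewrite Nat.eqb_refl; auto|].
      destruct (Nat.eqb_spec (th k) s); auto. destruct (Ns k); auto. }
    assert (B1 : forall k, fcons nx th k < S nx).
    { intros [|k]; simpl; [lia|]. specialize (Bth k). lia. }
    eapply evolves_after with (K1 := nx :: [] ++ []);
      [exact M'|exact St|reflexivity|lia| |].
    { intros t [<-|[]]; lia. }
    apply evolves_join; auto; try (simpl; tauto).
    + intros k Hk. specialize (Bth k). lia.
    + intros k. specialize (Bth k). lia.
    + apply decompose_spc; auto. simpl. rewrite Pu.
      apply spc_ren with (r := r) in H0; auto.
      rewrite !ren_ren, Rth in H0. unfold rn. rewrite <- Es. exact H0.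
    + intros nx' R' H' Le Gd. apply decompose_spc; auto.
      { intros k. specialize (B1 k). lia. }
      apply spc_ren with (r := r) in H2; auto. apply spc_ren with (r := r) in H3; auto.
      rewrite !ren_ren, Rth in H2, H3. unfold rn. simpl. rewrite <- Es'.
      destruct i; [rewrite P1; exact H3|rewrite P0; exact H2].
  - inversion Rp; subst; [|contradiction].
    eapply evolves_cut_l; eauto using msteps1_l, msteps1_r.
  - inversion Rp; subst; [|contradiction].
    eapply evolves_comm with (K := s :: K2 ++ K1).
    { intros t [<-|Ht]; [left; auto|]. right. apply in_app_or in Ht. apply in_or_app. tauto. }
    eapply evolves_cut_l with (L1 := L2) (L2 := L1); eauto using msteps1_l, msteps1_r.
    + eapply perm_trans; [apply Permutation_app_comm|auto].
    + eapply fresh_perm; [|exact F]. constructor. apply Permutation_app_comm.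
  - destruct (simulate_spc _ _ H _ _ _ _ _ _ G F Rp) as
      [nx1 [L1 [K1 [H2 [M1 [R1 [F1 N1]]]]]]].
    assert (G1 := good_msteps E _ _ M1 G).
    assert (Le1 := msteps_next E _ _ M1 G). simpl in Le1.
    destruct (IHred _ _ _ _ _ _ G1 F1 R1) as [nx2 [L2 [K2 [H3 [M2 [R2 [F2 N2]]]]]]].
    assert (Le2 := Next1 _ _ M2 G1). simpl in Le2.
    assert (G2 : good E (Net nx2 (L2 ++ Rs) H3)).
    { destruct M2 as [N' [S2 M2]]. eapply good_msteps; [exact M2|].
      eapply good_mstep; eauto. }
    destruct (simulate_spc _ _ H1 _ _ _ _ _ _ G2 F2 R2) as
      [nx3 [L3 [K3 [H4 [M3 [R3 [F3 N3]]]]]]].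
    exists nx3, L3, K3, H4. split.
    + eapply msteps1_l; [exact M1|]. eapply msteps1_r; eauto.
    + split; auto. split; auto. intros t Ht.
      destruct (N3 t Ht) as [I3|]; [|right; lia].
      destruct (N2 t I3) as [I2|]; [|right; lia]. auto.
Qed.
End Simulation.

(** * Infinite runs of nets *)

(** Compactness of the Cantor space: a prefix shared by infinitely many rows extends by a bit that
    infinitely many of these rows share. *)
Lemma limit_bools (O : nat -> nat -> bool) :
  exists Ol : nat -> bool,
  forall k N, exists n, N <= n /\ forall s, s < k -> O n s = Ol s.
Proof.
  set (P := fun x : nat * (nat -> bool) =>
    forall N, exists n, N <= n /\ forall s, s < fst x -> O n s = snd x s).
  set (R := fun x y : nat * (nat -> bool) =>
    fst y = S (fst x) /\ forall s, s < fst x -> snd y s = snd x s).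
  destruct (dependent_choice P R) with (x0 := (0, fun _ : nat => true))
    as [F [F0 HF]].
  - intros [k f] Hf. simpl in Hf.
    assert (K : exists b, forall N, exists n, N <= n /\ (forall s, s < k -> O n s = f s) /\
                  O n k = b).
    { apply NNPP. intros No.
      assert (T := not_ex_all_not _ _ No true). assert (Fa := not_ex_all_not _ _ No false).
      apply not_all_ex_not in T as [N1 T]. apply not_all_ex_not in Fa as [N2 Fa].
      destruct (Hf (N1 + N2)) as [n [Hn En]]. simpl in En.
      destruct (O n k) eqn:Eb; [apply T|apply Fa]; exists n; (split; [lia|auto]). }
    destruct K as [b Kb].
    exists (S k, fun s => if Nat.eqb s k then b else f s). split.
    + intros N. destruct (Kb N) as [n [Hn [H1 H2]]]. exists n. split; auto.
      simpl. intros s Hs. destruct (Nat.eqb_spec s k); [subst; auto|].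
      apply H1. lia.
    + split; auto. simpl. intros s Hs. destruct (Nat.eqb_spec s k); auto. lia.
  - intros N. exists N. split; auto. simpl. lia.
  - assert (Fk : forall k, fst (F k) = k).
    { induction k; [rewrite F0; auto|]. destruct (HF k) as [_ [E _]]. rewrite E, IHk; auto. }
    assert (St : forall s d, snd (F (S s + d)) s = snd (F (S s)) s).
    { intros s d. induction d; [rewrite Nat.add_0_r; auto|].
      rewrite Nat.add_succ_r. destruct (HF (S s + d)) as [_ [_ E]].
      rewrite E; auto. rewrite Fk. lia. }
    exists (fun s => snd (F (S s)) s). intros k N.
    destruct (HF k) as [Pk _]. destruct (Pk N) as [n [Hn En]]. exists n. split; auto.
    intros s Hs. rewrite Fk in En. rewrite En; auto.
    rewrite <- (St s (k - S s)). f_equal. f_equal. lia.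
Qed.

Lemma inf_min_is_shift_n Q g n : inf_min_is Q g -> inf_min_is Q (fun i => g (n + i)).
Proof.
  intros H. induction n; auto. apply inf_min_is_shift in IHn.
  replace (fun i => g (S n + i)) with (fun i => g (n + S i)); auto.
  extensionality i. f_equal. lia.
Qed.

Lemma eact_fired_sides nx a b s nx' : eact nx a b (Some s) nx' ->
  exists X1 X2 bb, In X1 a /\ In X2 a /\ X1 s bb /\ X2 s (negb bb).
Proof.
  intros A. remember (Some s) as ev eqn:Ev.
  destruct A; try discriminate; injection Ev as ->; exists X1, X2, b0;
    simpl; repeat split; auto; apply H; auto.
Qed.

Section Runs.
Variable E : env.

(** External sessions have no second side, so they are never used. *)
Definition external_ok (m : nat) (N : net) : Prop :=
  (forall c s, In c (ncs N) -> s < m -> ~ ceps c s false) /\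
  forall s, s < m -> nhist N s = None.

Lemma external_mstep m N N' : good E N -> m <= nnx N -> mstep N N' ->
  external_ok m N -> external_ok m N'.
Proof.
  intros G Hm [a [b [ev [r [P [A [P' Hh]]]]]]] [X1 X2].
  destruct (act_eact E _ _ _ _ _ _ _ _ G P A) as [EA _].
  assert (Ina : forall c, In c a -> In c (ncs N)).
  { intros c Hc. eapply Permutation_in; [symmetry; eauto|]. apply in_or_app; auto. }
  assert (Inr : forall c, In c r -> In c (ncs N)).
  { intros c Hc. eapply Permutation_in; [symmetry; eauto|]. apply in_or_app; auto. }
  split.
  - intros c s Hc Hs Hf. apply (Permutation_in _ P') in Hc.
    apply in_app_or in Hc as [Hc|Hc]; [|eapply X1; eauto].
    destruct (eact_origin _ _ _ _ _ _ _ _ EA (in_map ceps _ _ Hc) Hf)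
      as [[Z [HZ [Zs _]]]|]; [|lia].
    apply in_map_iff in HZ as [d [<- Hd]]. eapply X1; eauto.
  - intros s Hs. rewrite Hh. destruct ev as [[s' k]|]; simpl; auto.
    destruct (Nat.eqb_spec s s'); auto. subst s'. exfalso. simpl in EA.
    destruct (eact_fired_sides _ _ _ _ _ EA) as [Z1 [Z2 [bb [H1 [H2 [H3 H4]]]]]].
    apply in_map_iff in H1 as [c1 [<- Hc1]]. apply in_map_iff in H2 as [c2 [<- Hc2]].
    destruct bb; [eapply (X1 c2)|eapply (X1 c1)]; eauto.
Qed.

Variable Nt : nat -> net.
Variable m : nat.
Hypothesis Nt_good : forall n, good E (Nt n).
Hypothesis Nt_root : forall n, rootable m (Nt n).
Hypothesis Nt_ext : forall n, external_ok m (Nt n).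
Variable A B : nat -> list comp.
Variable Ev : nat -> option (nat * kind).
Hypothesis Nt_act : forall n, net_act (Nt n) (Nt (S n)) (A n) (B n) (Ev n).

Lemma Nt_step n : mstep (Nt n) (Nt (S n)).
Proof. exists (A n), (B n), (Ev n). apply Nt_act. Qed.

Lemma Nt_hist n n' s k : n <= n' -> nhist (Nt n) s = Some k -> nhist (Nt n') s = Some k.
Proof.
  induction 1; auto. intros H'. eapply mstep_hist; [apply Nt_good|apply Nt_step|auto].
Qed.

(** Rooting the net at a component that acts at time [n] makes every resting component point toward
    the current activity. *)
Lemma Nt_point n : exists O, (forall s, s < m -> O s = true) /\
  forall c, In c (ncs (Nt n)) -> In c (A n) \/ away O (ceps c).
Proof.
  destruct (Nt_act n) as [r [P [Ac _]]].
  assert (exists c0 a', A n = c0 :: a') as [c0 [a' Ea]].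
  { destruct Ac; eauto. }
  destruct (proj2 (Nt_root n) c0 (a' ++ r)) as [O [HO HA]].
  { rewrite P, Ea. auto. }
  exists O. split; auto. intros c Hc. apply (Permutation_in _ P) in Hc.
  apply in_app_or in Hc as [Hc|Hc]; auto. right. apply HA. apply in_or_app; auto.
Qed.

Lemma run_truth : exists (sk : nat -> kind),
  (forall n s k, nhist (Nt n) s = Some k -> sk s = k) /\
  (forall s, s < m -> sk s = KFin true) /\
  (forall n c, In c (ncs (Nt n)) -> (forall j, n <= j -> ~ In c (A j)) ->
     exists s b, ceps c s b /\ sk s = KFin (negb b)).
Proof.
  destruct (countable_choice _ Nt_point) as [O HO].
  destruct (limit_bools O) as [Ol HOl].
  destruct (countable_choice (fun s k => (forall n k', nhist (Nt n) s = Some k' -> k = k') /\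
    ((forall n, nhist (Nt n) s = None) -> k = KFin (Ol s)))) as [sk Hsk].
  { intros s. destruct (classic (exists n k, nhist (Nt n) s = Some k)) as [[n [k Hk]]|No].
    - exists k. split.
      + intros n' k' Hk'. apply (Nt_hist _ (n + n')) in Hk; [|lia].
        apply (Nt_hist _ (n + n')) in Hk'; [|lia]. congruence.
      + intros H. rewrite H in Hk. discriminate.
    - exists (KFin (Ol s)). split; auto. intros n k' Hk'. exfalso; eauto. }
  exists sk. split; [|split].
  - intros n s k Hk. destruct (Hsk s) as [H _]. eauto.
  - intros s Hs. destruct (Hsk s) as [_ H]. rewrite H.
    + destruct (HOl (S s) 0) as [n [_ Hn]]. rewrite <- Hn; [|lia].
      destruct (HO n) as [H1 _]. rewrite H1; auto.
    + intros n. apply (Nt_ext n); auto.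
  - intros n c Hc Idle.
    assert (Alive : forall j, n <= j -> In c (ncs (Nt j))).
    { induction 1 as [|j Hj IH]; auto.
      destruct (Nt_act j) as [r [P [_ [P' _]]]].
      apply (Permutation_in _ P) in IH. apply in_app_or in IH as [IH|IH].
      - exfalso; eapply Idle; eauto.
      - eapply Permutation_in; [symmetry; exact P'|]. apply in_or_app; auto. }
    (* The sessions of [c] all exist at time [n], so a late orientation that agrees with the limit
       below [nnx (Nt n)] is correct on all of them. *)
    destruct (HOl (nnx (Nt n)) n) as [j [Hj Hn]].
    destruct (proj2 (HO j) c (Alive j Hj)) as [Act|[s [b [Hs Eb]]]].
    { exfalso; eapply Idle; eauto. }
    exists s, b. split; auto.
    assert (s < nnx (Nt n)).
    { eapply (comp_ok_bounded E); [|exact Hs]. apply (net_comp _ _ _ _ (Nt_good n)); auto. }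
    rewrite <- Eb, Hn; auto. apply (Hsk s). intros i.
    assert (None' : forall i, n <= i -> nhist (Nt i) s = None).
    { intros i' Hi. eapply (net_alive _ _ _ _ (Nt_good i')); eauto. }
    destruct (Nat.le_gt_cases n i); auto.
    destruct (nhist (Nt i) s) eqn:Ek; auto.
    apply (Nt_hist _ n) in Ek; [|lia]. rewrite None' in Ek; auto; discriminate.
Qed.

(** * The walk through components with only false channels *)

Variable sk : nat -> kind.
Hypothesis sk_hist : forall n s k, nhist (Nt n) s = Some k -> sk s = k.
Hypothesis sk_idle : forall n c, In c (ncs (Nt n)) -> (forall j, n <= j -> ~ In c (A j)) ->
  exists s b, ceps c s b /\ sk s = KFin (negb b).

Record wstate := { wn : nat; wc : comp; wa : nat -> aty }.

Definition all_false (c : comp) (a : nat -> aty) : Prop :=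
  forall z T, nctx (ct c) z = Some T ->
    erase (a z) = T /\ fls sk (cs c z) (a z) (cn c z).

Definition wstate_ok (w : wstate) : Prop :=
  In (wc w) (ncs (Nt (wn w))) /\ all_false (wc w) (wa w).

(** Required of every surviving channel, since the thread is known only once the whole branch has
    been drawn. The channel named by an unfolding rule must make a proper step, which supplies the
    progress of the thread. *)
Definition child_step (c : comp) (a : nat -> aty) (p : nat) (c' : comp) (a' : nat -> aty) :=
  nth_error (kids (ct c)) p = Some (ct c') /\
  forall z, nctx (ct c) z <> None ->
    nctx (ct c') (cshift (label (ct c)) p z) <> None ->
    (a' (cshift (label (ct c)) p z) = a z \/ astep (a z) (a' (cshift (label (ct c)) p z))) /\
    (ntag (ct c) = RFix z -> astep (a z) (a' (cshift (label (ct c)) p z))).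

Lemma cshift_fix t x p : ntag t = RFix x -> cshift (label t) p = fun z => z.
Proof. unfold cshift, ntag. intros ->. auto. Qed.

Lemma cshift_ax t p : ntag t = RAx -> cshift (label t) p =
  match nproc t with
  | PIn _ _ | PCut _ _ => S
  | POut _ _ _ => if Nat.eqb p 0 then S else fun z => z
  | _ => fun z => z
  end.
Proof. unfold cshift, ntag, nproc. intros ->. auto. Qed.

Definition aupd (a : nat -> aty) (x : nat) (T : aty) : nat -> aty :=
  fun z => if Nat.eqb z x then T else a z.

Lemma all_false_upd c a x u T t : all_false c a ->
  nctx u = upd (nctx (ct c)) x (Some T) -> erase t = T -> fls sk (cs c x) t (cn c x) ->
  all_false {| ct := u; cn := cn c; cs := cs c |} (aupd a x t).
Proof.
  intros H C Et F z T' Hz. simpl in *. rewrite C in Hz. unfold upd, aupd in *.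
  destruct (Nat.eqb_spec z x); auto. subst z. injection Hz as <-. auto.
Qed.

Lemma all_false_rn c a x G u T t s' :
  (forall z T, G z = Some T -> nctx (ct c) z = Some T) ->
  (forall z, nctx (ct c) z <> None -> z <> x -> cn c z <> cn c x) ->
  all_false c a -> nctx u = upd G x (Some T) -> erase t = T -> fls sk (cs c x) t s' ->
  all_false {| ct := u; cn := rn (cn c x) s' (cn c); cs := cs c |} (aupd a x t).
Proof.
  intros HG Ne H C Et F z T' Hz. simpl in *. rewrite C in Hz. unfold upd, aupd, rn in *.
  destruct (Nat.eqb_spec z x).
  - subst z. injection Hz as <-. rewrite Nat.eqb_refl. auto.
  - apply HG in Hz. destruct (Nat.eqb_spec (cn c z) (cn c x)) as [e|e].
    + exfalso. apply (Ne z); auto. congruence.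
    + auto.
Qed.

Lemma all_false_scons c G f a u T t s' b' :
  nctx u = scons (Some T) G -> erase t = T -> fls sk b' t s' ->
  (forall z T, G z = Some T -> erase (a z) = T /\ fls sk (cs c z) (a z) (f z)) ->
  all_false {| ct := u; cn := fcons s' f; cs := fcons b' (cs c) |} (fcons t a).
Proof.
  intros C Et F H [|z] T' Hz; simpl in *; rewrite C in Hz; simpl in Hz.
  - injection Hz as <-. auto.
  - auto.
Qed.

(** Forever idle components own a true endpoint, so this one acts at some time. The action picks the
    premise: for a cut [cut_one_false] decides, an output follows a false part of its tensor, an
    input has both parts false, and a choice follows the selected branch. *)
Lemma wstate_progress w : wstate_ok w ->
  exists w', wstate_ok w' /\ exists p, child_step (wc w) (wa w) p (wc w') (wa w').
Proof.
  destruct w as [n c a]. intros [Hc Fa]. simpl in *.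
  assert (Tc : tree_ok E (ct c)) by (apply (net_comp _ _ _ _ (Nt_good n)); auto).
  destruct (classic (exists j, n <= j /\ In c (A j))) as [[j [_ Hj]]|No].
  2:{ exfalso. destruct (sk_idle n c Hc) as [s [b [[z [Hz [Ez Eb]]] Es]]].
      { intros j Hj I. apply No. eauto. }
      destruct (nctx (ct c) z) as [T|] eqn:ET; [|congruence].
      destruct (Fa z T ET) as [Er Fl]. rewrite Ez, Eb in Fl.
      apply fls_final with (b' := negb b) in Fl; auto.
      - destruct b; discriminate.
      - rewrite Er. eapply (ok_types E _ Tc); eauto. }
  assert (Go : forall c' p a', In c' (B j) -> all_false c' a' -> child_step c a p c' a' ->
    exists w', wstate_ok w' /\ exists p, child_step c a p (wc w') (wa w')).
  { intros c' p a' I F' St. exists {| wn := S j; wc := c'; wa := a' |}.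
    split; [split; auto; simpl|exists p; auto].
    destruct (Nt_act j) as [r [_ [_ [P' _]]]].
    eapply Permutation_in; [symmetry; exact P'|]. apply in_or_app; auto. }
  destruct (Nt_act j) as [r [P [Ac [_ Hh]]]].
  destruct (act_eact E _ _ _ _ _ _ _ _ (Nt_good j) P Ac) as [_ [_ [_ Ap]]].
  assert (Ok : forall d, In d (A j) -> comp_ok E (nnx (Nt j)) d).
  { intros d Hd. apply (net_comp _ _ _ _ (Nt_good j)).
    eapply Permutation_in; [symmetry; eauto|]. apply in_or_app; auto. }
  assert (Used : forall s k, Ev j = Some (s, k) -> sk s = k).
  { intros s k Ee. apply (sk_hist (S j)). rewrite Hh, Ee. simpl.
    rewrite Nat.eqb_refl. auto. }
  clear Hh P. assert (Nc := tree_ok_node E _ Tc).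
  remember (A j) as aj eqn:EA. remember (B j) as bj. remember (Ev j) as ej.
  remember (nnx (Nt (S j))) as nx'.
  destruct Ac as [d u x Tg Kd|d u n0 xs Tg Pr Kd|d u1 u2 P Q Tg Pr Kd
    |c1 c2 x y P u Tg1 Tg2 Pr1 Pr2 Kd En Es
    |c1 c2 x y P Q R u1 u2 u Tg1 Tg2 Pr1 Pr2 Kd1 Kd2 En Es
    |c1 c2 x y i P Q0 Q1 u u0 u1 Tg1 Tg2 Pr1 Pr2 Kd1 Kd2 En Es].
  - destruct Hj as [->|[]].
    destruct (fix_inv E _ x Nc Tg) as [u' [T [T' [K [X [U [_ C]]]]]]].
    assert (u' = u) by congruence. subst u'.
    destruct (Fa x T X) as [Er Fl].
    assert (TT : is_ty T) by (eapply (ok_types E _ Tc); eauto).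
    assert (Y : exists t, erase t = T' /\ fls sk (cs c x) t (cn c x) /\ astep (a x) t).
    { destruct U; [apply fls_unfold_mu|apply fls_unfold_nu]; auto. }
    destruct Y as [t [Et [Ft At]]].
    eapply (Go _ 0 (aupd a x t)); [left; reflexivity| |split].
    + eapply all_false_upd; eauto.
    + rewrite Kd; auto.
    + rewrite (cshift_fix _ x); auto. unfold aupd. intros z _ _.
      destruct (Nat.eqb_spec z x); [subst; auto|]. split; auto. congruence.
  - destruct Hj as [->|[]].
    destruct (call_inv E _ n0 xs Nc Tg Pr) as [u' [K [_ [_ C]]]].
    assert (u' = u) by congruence. subst u'.
    eapply (Go _ 0 a); [left; reflexivity| |split].
    + intros z T Hz. simpl in *. rewrite C in Hz. auto.
    + rewrite Kd; auto.
    + rewrite cshift_ax, Pr; auto. intros z _ _. split; auto. congruence.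
  - destruct Hj as [->|[]].
    destruct (cut_inv E _ P Q Nc Tg Pr) as
      [v1 [v2 [G1 [G2 [T1 [T2 [K [I1 [I2 [D [Sb [_ [C1 [_ C2]]]]]]]]]]]]]].
    assert (v1 = u1) by congruence. assert (v2 = u2) by congruence. subst v1 v2.
    assert (H1 : forall z T, G1 z = Some T -> nctx (ct c) z = Some T).
    { intros z T Hz. destruct (D z) as [[D1 D2]|[D1 D2]]; congruence. }
    assert (H2 : forall z T, G2 z = Some T -> nctx (ct c) z = Some T).
    { intros z T Hz. destruct (D z) as [[D1 D2]|[D1 D2]]; congruence. }
    (* Side [true] belongs to the first premise, as in [act_cut]. The alternative holds whatever use
       the run later makes of the new session. *)
    destruct (cut_one_false sk true T1 T2 (nnx (Nt j)) I1 I2 Sb) as [F|F].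
    + eapply (Go _ 0 (fcons (inj T1) a)); [left; reflexivity| |split].
      * eapply all_false_scons; eauto. apply erase_inj.
      * rewrite Kd; auto.
      * rewrite cshift_ax, Pr; auto. intros z _ _. simpl. split; auto. congruence.
    + eapply (Go _ 1 (fcons (inj T2) a)); [right; left; reflexivity| |split].
      * eapply all_false_scons; eauto. apply erase_inj.
      * rewrite Kd; auto.
      * rewrite cshift_ax, Pr; auto. intros z _ _. simpl. split; auto. congruence.
  - assert (Kx : sk (cn c1 x) = KEnd) by auto.
    destruct Hj as [->|[->|[]]].
    + exfalso. destruct (close_inv E _ x Nc Tg1 Pr1) as [X _].
      destruct (Fa x _ X) as [Er Fl]. apply (erase_cst_inv _ c1) in Er.
      rewrite Er in Fl. apply Fl. simpl. unfold at_final. rewrite Kx. exact I.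
    + destruct (wait_inv E _ y P Nc Tg2 Pr2) as [u' [K [_ [_ C]]]].
      assert (u' = u) by congruence. subst u'.
      eapply (Go _ 0 a); [left; reflexivity| |split].
      * intros z T Hz. simpl in *. rewrite C in Hz. unfold upd in Hz.
        destruct (Nat.eqb z y); [discriminate|auto].
      * rewrite Kd; auto.
      * rewrite cshift_ax, Pr2; auto. intros z _ _. split; auto. congruence.
  - assert (Kx : sk (cn c1 x) = KTen (nnx (Nt j)) (S (nnx (Nt j)))) by auto.
    destruct (Ok c1) as [T1 Ok1]; [left; auto|].
    destruct (Ok c2) as [T2 Ok2]; [right; left; auto|].
    destruct (out_inv E _ x P Q (tree_ok_node E _ T1) Tg1 Pr1) as
      [v1 [v2 [G1 [G2 [D1 [D2 [K1 [X [Dj [_ [C1 [_ C2]]]]]]]]]]]].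
    destruct (in_inv E _ y R (tree_ok_node E _ T2) Tg2 Pr2) as
      [v [D3 [D4 [K2 [Y [_ C]]]]]].
    assert (v1 = u1) by congruence. assert (v2 = u2) by congruence.
    assert (v = u) by congruence. subst v1 v2 v.
    destruct Ap as [Ap _]. specialize (Ap _ (or_introl eq_refl)).
    assert (NF : forall b', sk (cn c1 x) <> KFin b') by (intros; congruence).
    destruct Hj as [->|[->|[]]].
    + assert (Ne : forall z, nctx (ct c) z <> None -> z <> x -> cn c z <> cn c x).
      { apply (partner_session E c c2 x y (nnx (Nt j))); auto; [split; auto|congruence..]. }
      assert (H1 : forall z T, G1 z = Some T \/ G2 z = Some T ->
                nctx (ct c) z = Some T /\ z <> x).
      { intros z T Hz. assert (Hu : upd (nctx (ct c)) x None z = Some T).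
        { destruct (Dj z) as [[E1 E2]|[E1 E2]]; destruct Hz; congruence. }
        unfold upd in Hu. destruct (Nat.eqb_spec z x); [discriminate|auto]. }
      destruct (Fa x _ X) as [Er Fl].
      apply (erase_bin_inv _ btens) in Er as [t1 [t2 [Ea [E1 E2]]]].
      rewrite Ea in Fl. apply fls_bin in Fl; auto. rewrite Kx in Fl. simpl in Fl.
      apply not_and_or in Fl as [Fl|Fl].
      * eapply (Go _ 0 (fcons t1 a)); [left; reflexivity| |split].
        -- eapply all_false_scons; [exact C1|exact E1|exact Fl|]. intros z T Hz.
           destruct (H1 z T); auto.
        -- rewrite Kd1; auto.
        -- rewrite cshift_ax, Pr1; auto. intros z _ _. simpl. split; auto. congruence.
      * eapply (Go _ 1 (aupd a x t2)); [right; left; reflexivity| |split].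
        -- apply (all_false_rn c a x G2 u2 D2 t2); auto. intros z T Hz. destruct (H1 z T); auto.
        -- rewrite Kd1; auto.
        -- rewrite cshift_ax, Pr1; auto. intros z _ _. unfold aupd. simpl.
           destruct (Nat.eqb_spec z x); [subst z|split; auto; congruence].
           rewrite Ea. split; [right; constructor|congruence].
    + assert (Ne : forall z, nctx (ct c) z <> None -> z <> y -> cn c z <> cn c y).
      { apply (partner_session E c c1 y x (nnx (Nt j))); auto; try congruence.
        - split; auto.
        - apply apart_sym; auto.
        - rewrite Es. destruct (cs c1 x); auto. }
      destruct (Fa y _ Y) as [Er Fl].
      apply (erase_bin_inv _ bpar) in Er as [t1 [t2 [Ea [E1 E2]]]].
      rewrite Ea in Fl. apply fls_bin in Fl; [|rewrite En; auto].
      rewrite En, Kx in Fl. simpl in Fl. apply not_or_and in Fl as [F1 F2].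
      eapply (Go _ 0 (fcons t1 (aupd a y t2))); [right; right; left; reflexivity| |split].
      * assert (Ay : forall z T, upd (nctx (ct c)) y (Some D4) z = Some T ->
          erase (aupd a y t2 z) = T /\
          fls sk (cs c z) (aupd a y t2 z) (rn (cn c y) (S (nnx (Nt j))) (cn c) z)).
        { intros z T Hz. unfold upd, aupd, rn in *. destruct (Nat.eqb_spec z y).
          - subst z. injection Hz as <-. rewrite Nat.eqb_refl. auto.
          - destruct (Nat.eqb_spec (cn c z) (cn c y)) as [e|e]; auto.
            exfalso. apply (Ne z); auto. congruence. }
        eapply all_false_scons; eauto.
      * rewrite Kd2; auto.
      * rewrite cshift_ax, Pr2; auto. intros z _ _. simpl. unfold aupd.
        destruct (Nat.eqb_spec z y); [subst z|split; auto; congruence].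
        rewrite Ea. split; [right; constructor|congruence].
  - assert (Kx : sk (cn c1 x) = KSel i (nnx (Nt j))) by auto.
    destruct (Ok c1) as [T1 Ok1]; [left; auto|].
    destruct (Ok c2) as [T2 Ok2]; [right; left; auto|].
    destruct (sel_inv E _ x i P (tree_ok_node E _ T1) Tg1 Pr1) as
      [v [D0 [D1 [K1 [X [_ C]]]]]].
    destruct (case_inv E _ y Q0 Q1 (tree_ok_node E _ T2) Tg2 Pr2) as
      [v0 [v1 [D2 [D3 [K2 [Y [_ [C0 [_ C1]]]]]]]]].
    assert (v = u) by congruence. assert (v0 = u0) by congruence.
    assert (v1 = u1) by congruence. subst v v0 v1.
    destruct Ap as [Ap _]. specialize (Ap _ (or_introl eq_refl)).
    assert (NF : forall b', sk (cn c1 x) <> KFin b') by (intros; congruence).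
    destruct Hj as [->|[->|[]]].
    + assert (Ne : forall z, nctx (ct c) z <> None -> z <> x -> cn c z <> cn c x).
      { apply (partner_session E c c2 x y (nnx (Nt j))); auto; [split; auto|congruence..]. }
      destruct (Fa x _ X) as [Er Fl].
      apply (erase_bin_inv _ bplus) in Er as [t0 [t1 [Ea [E0 E1]]]].
      rewrite Ea in Fl. apply fls_bin in Fl; auto. rewrite Kx in Fl. simpl in Fl.
      eapply (Go _ 0 (aupd a x (if i then t1 else t0))); [left; reflexivity| |split].
      * apply (all_false_rn c a x (nctx (ct c)) u (if i then D1 else D0)); auto;
          destruct i; auto.
      * rewrite Kd1; auto.
      * rewrite cshift_ax, Pr1; auto. intros z _ _. unfold aupd. simpl.
        destruct (Nat.eqb_spec z x); [subst z|split; auto; congruence].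
        rewrite Ea. split; [right; destruct i; constructor|congruence].
    + assert (Ne : forall z, nctx (ct c) z <> None -> z <> y -> cn c z <> cn c y).
      { apply (partner_session E c c1 y x (nnx (Nt j))); auto; try congruence.
        - split; auto.
        - apply apart_sym; auto.
        - rewrite Es. destruct (cs c1 x); auto. }
      destruct (Fa y _ Y) as [Er Fl].
      apply (erase_bin_inv _ bwith) in Er as [t0 [t1 [Ea [E0 E1]]]].
      rewrite Ea in Fl. apply fls_bin in Fl; [|rewrite En; auto].
      rewrite En, Kx in Fl. simpl in Fl.
      eapply (Go _ (if i then 1 else 0) (aupd a y (if i then t1 else t0)));
        [right; left; reflexivity| |split].
      * eapply (all_false_rn c a y (nctx (ct c)) _ (if i then D3 else D2)); eauto;
          destruct i; auto.
      * rewrite Kd2; destruct i; auto.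
      * rewrite cshift_ax, Pr2; auto. intros z _ _. unfold aupd. simpl.
        destruct (Nat.eqb_spec z y); [subst z|split; auto; congruence].
        rewrite Ea. split; [right; destruct i; constructor|congruence].
Qed.

Lemma no_all_false n c a : In c (ncs (Nt n)) -> ~ all_false c a.
Proof.
  intros Hc Fa.
  destruct (dependent_choice wstate_ok
    (fun w w' => exists p, child_step (wc w) (wa w) p (wc w') (wa w')))
    with (x0 := {| wn := n; wc := c; wa := a |}) as [W [W0 HW]].
  { intros w Hw. destruct (wstate_progress w Hw) as [w' [H1 H2]]. eauto. }
  { split; auto. }
  destruct (countable_choice (fun i p =>
    child_step (wc (W i)) (wa (W i)) p (wc (W (S i))) (wa (W (S i)))))
    as [p Hp].
  { intros i. apply (HW i). }
  set (f i := ct (wc (W i))).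
  assert (Tok : forall i, tree_ok E (f i)).
  { intros i. destruct (HW i) as [[I _] _]. apply (net_comp _ _ _ _ (Nt_good _)) in I.
    apply I. }
  destruct (ok_valid E _ (Tok 0) f p) as [n0 [x [T1 [T2 [T3 T4]]]]].
  { split; auto. intros i. apply (Hp i). }
  assert (Ty : forall i, n0 <= i -> exists T, nctx (f i) (x i) = Some T /\
            erase (wa (W i) (x i)) = T).
  { intros i Hi. destruct (nctx (f i) (x i)) as [T|] eqn:ET; [|exfalso; eapply T1; eauto].
    exists T. split; auto. destruct (HW i) as [[_ F] _]. apply F. auto. }
  assert (St : forall i, n0 <= i ->
    (wa (W (S i)) (x (S i)) = wa (W i) (x i) \/
     astep (wa (W i) (x i)) (wa (W (S i)) (x (S i)))) /\
    (ntag (f i) = RFix (x i) ->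
     astep (wa (W i) (x i)) (wa (W (S i)) (x (S i))))).
  { intros i Hi. destruct (Hp i) as [_ H]. specialize (H (x i)).
    assert (Ex := T2 i Hi). unfold f in Ex. rewrite <- Ex in H. apply H; apply T1; lia. }
  apply (no_nu_thread (fun i => wa (W (n0 + i)) (x (n0 + i)))).
  - destruct (Ty (n0 + 0)) as [T [ET Er]]; [lia|]. rewrite Er.
    apply (ok_types E _ (Tok (n0 + 0)) (x (n0 + 0))). auto.
  - intros i. rewrite Nat.add_succ_r. apply St. lia.
  - intros k. destruct (T4 (n0 + k)) as [j [H1 [H2 [H3 _]]]].
    exists (j - n0). split; [lia|]. rewrite Nat.add_succ_r.
    replace (n0 + (j - n0)) with j by lia. apply St; auto.
  - apply inf_min_is_shift_n with (n := n0) in T3.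
    replace (fun i => erase (wa (W (n0 + i)) (x (n0 + i)))) with
      (fun i => type_or_0 (tctx (label (f (n0 + i))) (x (n0 + i)))); auto.
    extensionality i. destruct (Ty (n0 + i)) as [T [ET Er]]; [lia|].
    unfold nctx in ET. rewrite ET. auto.
Qed.
End Runs.

(** * From an infinite run of a process to an infinite run of a net *)

Theorem mainTheorem2 :
  forall (E : env) (P : proc) (G : ctx),
    env_wf E -> ctx_ok G ->
    typed E P G -> terminating E P.
Proof.
  intros E P G Ewf [[M HM] HG] [t [Pt [Gt [Lt Vt]]]] [P0 rest|s] Run _; simpl; auto.
  simpl in Run. destruct Run as [Run0 Run]. exfalso.
  (* Channels of the context become external sessions of the same number. All other names share the
     session [M], owned by no component, so there are [S M] external sessions. *)
  set (th := fun z => if Nat.ltb z M then z else M).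
  set (c := {| ct := t; cn := th; cs := fun _ => true |}).
  set (N0 := Net (S M) [c] (fun _ => None)).
  assert (Bth : forall k, th k < S M).
  { intros k. unfold th. destruct (Nat.ltb_spec k M); lia. }
  assert (Dom : forall z, nctx t z <> None -> z < M).
  { intros z Hz. destruct (Nat.lt_ge_cases z M); auto. exfalso; apply Hz.
    unfold nctx. rewrite Gt. auto. }
  assert (Tt : tree_ok E t).
  { constructor; auto. unfold nctx. rewrite Gt. exact HG. }
  assert (G0 : good E N0).
  { constructor; simpl; auto.
    - intros d [<-|[]]. split; auto. split; auto.
      intros z1 z2 H1 H2. simpl. apply Dom in H1. apply Dom in H2. unfold th.
      destruct (Nat.ltb_spec z1 M), (Nat.ltb_spec z2 M); lia.
    - split; auto. intros Y []. }
  (* A net reached midway through the simulation of a reduction need not represent any process of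
     the run; it is only asked to be able to reach one that does. Each reduction costs at least one
     net step, so a next step always exists. *)
  set (Q := fun N => (good E N /\ rootable (S M) N /\ external_ok (S M) N) /\
    exists N' n K, msteps N N' /\ rep E (s n) th (ncs N') K /\ fresh (nnx N') th K).
  destruct (dependent_choice Q mstep) with (x0 := N0) as [Nt [Nt0 HNt]].
  - intros N [[GN [RN XN]] [[nx L H] [n [K [Ms [Rp Fr]]]]]].
    assert (GN' := good_msteps E _ _ Ms GN).
    rewrite <- (app_nil_r L) in Ms, GN'.
    destruct (simulate_red E Ewf _ _ (Run n) th L K [] nx H GN' Fr Rp) as
      [nx' [L' [K' [H' [Ms' [Rp' [Fr' _]]]]]]].
    destruct (msteps1_l _ _ _ Ms Ms') as [N1 [St Ms1]].
    exists N1. split; auto. split.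
    + split; [|split].
      * exact (good_mstep E _ _ GN St).
      * exact (rootable_mstep E _ _ _ GN St RN).
      * exact (external_mstep E _ _ _ GN (proj1 RN) St XN).
    + exists (Net nx' (L' ++ []) H'), (S n), K'. split; auto. split; auto.
      simpl. rewrite app_nil_r. auto.
  - split; [split; [exact G0|]|].
    + split.
      * split; auto. intros d r Pm. exists (fun _ => true). split; auto.
        apply Permutation_length_1_inv in Pm. injection Pm as _ ->. intros e [].
      * split; auto. intros d s' [<-|[]] _ [z [_ [_ Hz]]]. discriminate.
    + destruct (decompose E P th c [] (S M) (fun _ => None) G0 Bth) as
        [nx' [L' [K' [H' [Ms [Rp [Fr _]]]]]]].
      { simpl. unfold nproc. rewrite Pt. auto. }
      exists (Net nx' (L' ++ []) H'), 0, K'. rewrite Run0. split; auto.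
      simpl. rewrite app_nil_r. auto.
  - destruct (countable_choice (fun n x =>
      net_act (Nt n) (Nt (S n)) (fst (fst x)) (snd (fst x)) (snd x))) as [F HF].
    { intros n. destruct (HNt n) as [_ [a [b [ev Ha]]]]. exists (a, b, ev). auto. }
    assert (GNt : forall n, good E (Nt n)) by (intros n; apply (HNt n)).
    destruct (run_truth E Nt (S M) GNt) with
      (A := fun n => fst (fst (F n))) (B := fun n => snd (fst (F n)))
      (Ev := fun n => snd (F n)) as [sk [K1 [K2 K3]]]; auto.
    { intros n; apply (HNt n). }
    { intros n; apply (HNt n). }
    apply (no_all_false E Nt GNt (fun n => fst (fst (F n))) (fun n => snd (fst (F n)))
      (fun n => snd (F n)) HF sk K1 K3 0 c (fun z => inj (type_or_0 (nctx t z)))).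
    + rewrite Nt0. left; auto.
    + intros z T Hz. simpl in *. rewrite Hz. simpl. split; [apply erase_inj|].
      apply fls_final_inj; [apply (ok_types E _ Tt z); auto|]. apply K2. auto.
Qed.
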